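(* Let $M$ be an oriented smooth hypersurface embedded in a Weitzenböck $(n+1)$-manifold $\tilde M$ with parallel totally skew-symmetric torsion. Let $g\colon M\to\mathbb{S}^n$ be the Gauss map, and let $\hat g=\hat\iota\circ g\colon M\to\mathbb{R}^{n+1}$, where $\hat\iota\colon\mathbb{S}^n\hookrightarrow\mathbb{R}^{n+1}$ is the inclusion. Let $\phi$ be the identification. Then $$-\phi^{-1}\Delta g=\operatorname{grad}H,\qquad-\phi^{-1}\Delta\hat g=\operatorname{grad}H+\|W\|^2N.$$ Also, $\Delta g=\bar\Delta g$, $\Delta\hat g=\bar\Delta\hat g$, $H=\bar H$, and $\|W\|^2=\|\bar W\|^2+\widetilde{\mathrm{Ric}}(N,N)$, where a bar denotes a quantity associated with the Levi-Civita connection and $\widetilde{\mathrm{Ric}}$ denotes the Ricci curvature of the ambient Levi-Civita connection.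
   Context: A Weitzenböck $(n+1)$-manifold $\tilde M$ is a smooth $(n+1)$-manifold with a fixed global smooth frame $(\tilde E_1,\dots,\tilde E_{n+1})$, equipped with the orientation and the metric making this frame oriented orthonormal, and with the metric-compatible flat connection $\tilde\nabla$ determined by $\tilde\nabla\tilde E_i=0$ for all $i$. Its torsion is $\tilde T(X,Y)=\tilde\nabla_XY-\tilde\nabla_YX-[X,Y]$. The torsion is parallel if $\tilde\nabla\tilde T=0$, and totally skew-symmetric if $(X,Y,Z)\mapsto\langle X,\tilde T(Y,Z)\rangle$ is alternating. An oriented smooth hypersurface $M\subset\tilde M$ carries the restricted metric $\langle\cdot,\cdot\rangle$ and the projected metric-compatible connection $\nabla_XY=(\tilde\nabla_XY)^\top$ (tangential part); $\bar\nabla$ is the Levi-Civita connection of the induced metric on $M$. $N$ is the unit normal vector field along $M$ such that a frame $(E_1,\dots,E_n)$ of $M$ is oriented iff $(N,E_1,\dots,E_n)$ is oriented in $\tilde M$. The Weingarten map $W$ is the $(1,1)$-tensor field on $M$ with $\langle WX,Y\rangle=\langle N,\tilde\nabla_XY\rangle$; $H=\operatorname{tr}W$; $\|W\|^2=\sum_i|WE_i|^2$ for an orthonormal frame. $\bar W$ and $\bar H=\operatorname{tr}\bar W$ are the analogous objects defined with the Levi-Civita connection of $\tilde M$ in place of $\tilde\nabla$. The Ricci curvature is $\mathrm{Ric}(X,Y)=\operatorname{tr}(R(\cdot,X)Y)$ with $R(X,Y)Z=\nabla_X\nabla_YZ-\nabla_Y\nabla_XZ-\nabla_{[X,Y]}Z$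 (here applied to the ambient Levi-Civita connection). $\operatorname{grad}f$ is the metric dual of $\mathrm{d}f$. Gauss map: writing $N=\sum_iN^i\tilde E_i$, $g=(N^1,\dots,N^{n+1})\colon M\to\mathbb{S}^n$. Identification: for $p\in M$, $\phi\colon T_p\tilde M\to\mathbb{R}^{n+1}$ is the linear isometry sending a vector to its coefficient vector relative to $(\tilde E_i|_p)$; it sends $N|_p$ to $g(p)$ and restricts to an isometry $T_pM\to T_{g(p)}\mathbb{S}^n$, giving a vector bundle isomorphism $\phi\colon TM\to g^*T\mathbb{S}^n$ (and $\phi\colon T\tilde M|_M\to\hat g^*T\mathbb{R}^{n+1}$). Laplacians: for a smooth map $F\colon M\to Q$ into a Riemannian manifold with Levi-Civita connection $\nabla^Q$ ($Q=\mathbb{S}^n$ round or $Q=\mathbb{R}^{n+1}$ Euclidean), $\Delta F=\sum_i\big[(F^*\nabla^Q)_{E_i}(\mathrm{d}F(E_i))-\mathrm{d}F(\nabla_{E_i}E_i)\big]\in\Gamma(F^*TQ)$ for a local orthonormal frame $(E_i)$ of $M$; $\bar\Delta F$ is the same expression with $\bar\nabla$ in place of $\nabla$. *)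

(* Defs.v *)
From HB Require Import structures.
From mathcomp Require Import all_boot all_order all_algebra.
From mathcomp Require Import all_classical all_reals all_analysis.
From mathcomp Require Import ring.
Set Implicit Arguments.
Unset Strict Implicit.
Unset Printing Implicit Defensive.
Import Order.TTheory GRing.Theory Num.Theory.
Import numFieldNormedType.Exports.
Local Open Scope classical_set_scope.
Local Open Scope ring_scope.

Section Smooth.
Variables (R : realType) (V W : normedModType R).

Fixpoint Cdiff (k : nat) (U : set V) (f : V -> W) : Prop :=
  match k with
  | 0 => forall x, U x -> {for x, continuous f}
  | k'.+1 => (forall x, U x -> differentiable f x) /\
             forall v, Cdiff k' U (fun x => 'd f x v)
  end.

(* Used for open [U] only: [differentiable] is two-sided. *)
Definition smooth_on (U : set V) (f : V -> W) : Prop := forall k, Cdiff k U f.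

End Smooth.

Definition dot (R : realType) (m : nat) (u v : 'rV[R]_m) : R :=
  \sum_i u 0 i * v 0 i.

(* The atlas is indexed by the points of the manifold: [chart p] is the
   preferred chart at [p], with domain [chart_dom p].  Any smooth manifold is of this
   form: choose a chart around each point.  [chart p] and [chart_inv p] are
   total functions, only meaningful on [chart_dom p] and on its image. *)
Record manifold (R : realType) (n : nat) := Manifold {
  carrier :> topologicalType;
  chart_dom : carrier -> set carrier;
  chart : carrier -> carrier -> 'rV[R]_n;
  chart_inv : carrier -> 'rV[R]_n -> carrier;
  manifold_hausdorff : hausdorff_space carrier;
  manifold_second_countable : @second_countable carrier;
  dom_open : forall p, open (chart_dom p);
  dom_self : forall p, chart_dom p p;
  chart_open : forall p, open (chart p @` chart_dom p);
  chart_continuous : forall p q, chart_dom p q -> {for q, continuous (chart p)};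
  chart_inv_continuous : forall p y, (chart p @` chart_dom p) y ->
    {for y, continuous (chart_inv p)};
  chartK : forall p q, chart_dom p q -> chart_inv p (chart p q) = q;
  transition_smooth : forall p q,
    smooth_on (chart p @` (chart_dom p `&` chart_dom q)) (chart q \o chart_inv p)
}.
Arguments chart_dom {R n m} : rename.
Arguments chart {R n m} : rename.
Arguments chart_inv {R n m} : rename.

(* The tangent space at [p] is identified with [R^n] by means of the preferred
   chart at [p]: a tangent vector at [p] is a row vector, namely its
   components with respect to [chart p].  Linear maps of tangent spaces are
   matrices acting on the right.  A vector field is a function [M -> 'rV_n]. *)

Section Manifolds.
Variables (R : realType) (n m : nat) (M : manifold R n) (Q : manifold R m).

Definition smooth_fun (V : normedModType R) (U : set M) (f : M -> V) : Prop :=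
  forall p, smooth_on (chart p @` (chart_dom p `&` U)) (f \o chart_inv p).

Definition deriv_along (V : normedModType R) (f : M -> V) (p : M)
    (u : 'rV[R]_n) : V :=
  'd (f \o chart_inv p) (chart p p) u.

(* from components in [chart p] to components in [chart c], for [p] in
   [chart_dom c], and conversely *)
Definition to_chart (c p : M) : 'M[R]_n :=
  'J (chart c \o chart_inv p) (chart p p).
Definition of_chart (c p : M) : 'M[R]_n :=
  'J (chart p \o chart_inv c) (chart c p).

(* the vector field on [chart_dom c] with constant components [u] in [chart c] *)
Definition coord_field (c : M) (u : 'rV[R]_n) : M -> 'rV[R]_n :=
  fun q => u *m of_chart c q.

Definition smooth_map (F : M -> Q) : Prop := continuous F /\
  forall p c, smooth_on (chart p @` (chart_dom p `&` F @^-1` chart_dom c))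
                        (chart c \o F \o chart_inv p).

Definition tangent_map (F : M -> Q) (p : M) : 'M[R]_(n, m) :=
  'J (chart (F p) \o F \o chart_inv p) (chart p p).

End Manifolds.

(* sections of [F^* TQ]: [V p] is a tangent vector of [Q] at [F p] *)
Definition smooth_along (R : realType) (n m : nat) (M : manifold R n)
    (Q : manifold R m) (F : M -> Q) (U : set M) (V : M -> 'rV[R]_m) : Prop :=
  forall c : Q,
    smooth_fun (U `&` F @^-1` chart_dom c) (fun q => V q *m to_chart c (F q)).

Definition smooth_field (R : realType) (n : nat) (M : manifold R n)
    (U : set M) (X : M -> 'rV[R]_n) : Prop :=
  smooth_along (id : M -> M) U X.

Definition push (R : realType) (n m : nat) (M : manifold R n)
    (Q : manifold R m) (F : M -> Q) (X : M -> 'rV[R]_n) : M -> 'rV[R]_m :=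
  fun q => X q *m tangent_map F q.

Record embedding (R : realType) (n m : nat) (M : manifold R n)
    (Q : manifold R m) (F : M -> Q) : Prop := Embedding {
  embedding_smooth : smooth_map F;
  embedding_immersion : forall p, row_free (tangent_map F p);
  embedding_inj : injective F;
  embedding_topological : forall U : set M, open U ->
    exists2 V : set Q, open V & U = F @^-1` V
}.

Definition bracket (R : realType) (n : nat) (M : manifold R n)
    (X Y : M -> 'rV[R]_n) (p : M) : 'rV[R]_n :=
  deriv_along (fun q => Y q *m to_chart p q) p (X p) -
  deriv_along (fun q => X q *m to_chart p q) p (Y p).

(* [positive p] tells whether the coordinate basis of [chart p] at [p] is
   positively oriented. *)
Record orientation (R : realType) (n : nat) (M : manifold R n) := Orientation {
  positive : M -> bool;
  orientation_locally_constant : forall p : M, \forall q \near p,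
    (positive q == positive p) = (0 < \det (to_chart p q))
}.

Definition oriented_basis (R : realType) (n : nat) (M : manifold R n)
    (o : orientation M) (p : M) (B : 'M[R]_n) : bool :=
  if positive o p then 0 < \det B else \det B < 0.

Section Connections.
Variables (R : realType) (n : nat) (M : manifold R n).

Definition metric := M -> 'rV[R]_n -> 'rV[R]_n -> R.

(* [nabla p u Y] is the derivative at [p] of the vector field [Y], defined
   and smooth near [p], in the direction of the tangent vector [u]. *)
Definition covder := M -> 'rV[R]_n -> (M -> 'rV[R]_n) -> 'rV[R]_n.

Definition covf (nabla : covder) (X Y : M -> 'rV[R]_n) : M -> 'rV[R]_n :=
  fun p => nabla p (X p) Y.

(* Locality is a consequence of the Leibniz rule applied to the indicator
   function of an open set containing [p], which is smooth near [p]. *)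
Record is_connection (nabla : covder) : Prop := IsConnection {
  conn_linear : forall (U : set M) (p : M) Y a u v,
    open U -> U p -> smooth_field U Y ->
    nabla p (a *: u + v) Y = a *: nabla p u Y + nabla p v Y;
  conn_additive : forall (U : set M) (p : M) Y Z u,
    open U -> U p -> smooth_field U Y -> smooth_field U Z ->
    nabla p u (fun q => Y q + Z q) = nabla p u Y + nabla p u Z;
  conn_leibniz : forall (U : set M) (p : M) (f : M -> R) Y u,
    open U -> U p -> smooth_fun U f -> smooth_field U Y ->
    nabla p u (fun q => f q *: Y q) =
      deriv_along f p u *: Y p + f p *: nabla p u Y;
  conn_smooth : forall (U : set M) X Y,
    open U -> smooth_field U X -> smooth_field U Y ->
    smooth_field U (covf nabla X Y)
}.

Definition torsion (nabla : covder) (X Y : M -> 'rV[R]_n) : M -> 'rV[R]_n :=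
  fun p => covf nabla X Y p - covf nabla Y X p - bracket X Y p.

Definition curvature (nabla : covder) (X Y Z : M -> 'rV[R]_n) :
    M -> 'rV[R]_n :=
  fun p => covf nabla X (covf nabla Y Z) p - covf nabla Y (covf nabla X Z) p
         - covf nabla (bracket X Y) Z p.

(* [R(u,x)y] at [p] only depends on [u], [x], [y], which are extended to
   vector fields near [p]. *)
Definition ricci (nabla : covder) (p : M) (x y : 'rV[R]_n) : R :=
  \tr (lin1_mx (fun u =>
    curvature nabla (coord_field p u) (coord_field p x) (coord_field p y) p)).

Record levi_civita (g : metric) (nabla : covder) : Prop := LeviCivita {
  lc_connection : is_connection nabla;
  lc_torsion_free : forall (U : set M) X Y p,
    open U -> smooth_field U X -> smooth_field U Y -> U p ->
    torsion nabla X Y p = 0;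
  lc_metric : forall (U : set M) X Y p u,
    open U -> smooth_field U X -> smooth_field U Y -> U p ->
    deriv_along (fun q => g q (X q) (Y q)) p u =
      g p (nabla p u X) (Y p) + g p (X p) (nabla p u Y)
}.

Definition is_gradient (g : metric) (f : M -> R) (G : M -> 'rV[R]_n) : Prop :=
  forall p u, g p (G p) u = deriv_along f p u.

Definition orthonormal_frame (g : metric) (U : set M)
    (E : 'I_n -> M -> 'rV[R]_n) : Prop :=
  (forall i, smooth_field U (E i)) /\
  (forall p i j, U p -> g p (E i p) (E j p) = (i == j)%:R).

End Connections.

Section AlongMaps.
Variables (R : realType) (n m : nat) (M : manifold R n) (Q : manifold R m).

(* [(F^* nabla)_u V] at [p], for a section [V] of [F^* TQ]: if [V] is
   [sum_a V^a (d_a o F)] in the coordinate frame [d_a] of the chart at [F p],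
   this is [sum_a u(V^a) d_a + V^a(p) nabla_{dF u} d_a]. *)
Definition pullback_conn (nabla : covder Q) (F : M -> Q)
    (p : M) (u : 'rV[R]_n) (V : M -> 'rV[R]_m) : 'rV[R]_m :=
  deriv_along (fun q => V q *m to_chart (F p) (F q)) p u +
  nabla (F p) (u *m tangent_map F p) (coord_field (F p) (V p)).

Definition induced_metric (g : metric Q) (F : M -> Q) : metric M :=
  fun p u v => g (F p) (u *m tangent_map F p) (v *m tangent_map F p).

Definition laplacian (nablaM : covder M) (nablaQ : covder Q)
    (E : 'I_n -> M -> 'rV[R]_n) (F : M -> Q) (p : M) : 'rV[R]_m :=
  \sum_i (pullback_conn nablaQ F p (E i p) (push F (E i))
          - covf nablaM (E i) (E i) p *m tangent_map F p).

End AlongMaps.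

Section SmoothTheory.
Variables (R : realType) (V : normedModType R).
Implicit Types (U : set V).

Lemma near_is_diff (W : normedModType R) (f g : V -> W) (x : V) :
  (\forall y \near x, f y = g y) -> differentiable f x ->
  differentiable g x /\ 'd g x = 'd f x :> (V -> W).
Proof.
move=> fg df.
have dfc : continuous ('d f x) by exact: diff_continuous.
have E : g \o shift x = cst (g x) + 'd f x +o_ (0 : V) id.
  apply/eqaddoP => e e0.
  have /diff_locallyP[_ /eqaddoP/(_ e e0) H] := df.
  near=> h.
  have hfg : f (h + x) = g (h + x).
    near: h; move: fg; rewrite (near_shift 0); apply: filterS => z /=.
    by rewrite subr0.
  rewrite -(nbhs_singleton fg) /=.
  suff : `|(f \o shift x - (cst (f x) + 'd f x)) h| <= e * `|id h|.
    by rewrite !fctE /= hfg.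
  by near: h.
have dg := diff_unique dfc E.
split => //; apply/diff_locallyP; split; first by rewrite dg.
by rewrite dg.
Unshelve. all: by end_near. Qed.

Lemma Cdiff_ext (W : normedModType R) k U (f g : V -> W) : open U ->
  (forall x, U x -> f x = g x) -> Cdiff k U f -> Cdiff k U g.
Proof.
move=> oU; elim: k f g => [|k IH] f g fg /=.
  move=> cf x Ux; rewrite /prop_for /continuous_at -(fg _ Ux).
  apply: cvg_trans (cf x Ux); apply: near_eq_cvg.
  by apply: filterS (open_nbhs_nbhs (conj oU Ux)) => y /fg.
have near_fg x : U x -> \forall y \near x, f y = g y.
  by move=> Ux; apply: filterS (open_nbhs_nbhs (conj oU Ux)).
move=> [df Cf]; split => [x Ux|v].
  by have [] := near_is_diff (near_fg x Ux) (df x Ux).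
apply: IH (Cf v) => x Ux.
by have [_ ->] := near_is_diff (near_fg x Ux) (df x Ux).
Qed.

Lemma CdiffW (W : normedModType R) k U (f : V -> W) :
  Cdiff k.+1 U f -> Cdiff k U f.
Proof.
elim: k f => [|k IH] f [df Cf]; last by split=> // v; exact/IH/Cf.
by move=> x Ux; exact/differentiable_continuous/df.
Qed.

Lemma Cdiff_cst (W : normedModType R) k U (a : W) : Cdiff k U (fun=> a).
Proof.
elim: k a => [|k IH] a /=; first by move=> x _; exact: cst_continuous.
split=> [x _|v]; first exact: differentiable_cst.
have -> : (fun x => 'd (fun=> a) x v) = fun=> 0; last exact: IH.
by apply/funext => x; rewrite (_ : (fun=> a) = cst a) ?diff_cst.
Qed.

Lemma CdiffD (W : normedModType R) k U (f g : V -> W) : open U ->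
  Cdiff k U f -> Cdiff k U g -> Cdiff k U (fun x => f x + g x).
Proof.
move=> oU; elim: k f g => [|k IH] f g /=.
  by move=> cf cg x Ux; apply: continuousD; [exact: cf|exact: cg].
move=> [df Cf] [dg Cg]; split=> [x Ux|v].
  by apply: differentiableD; [exact: df|exact: dg].
apply: (Cdiff_ext oU _ (IH _ _ (Cf v) (Cg v))) => x Ux.
by rewrite (diffD (df x Ux) (dg x Ux)).
Qed.

Lemma Cdiff_sum (W : normedModType R) k U m (f : 'I_m -> V -> W) : open U ->
  (forall i, Cdiff k U (f i)) -> Cdiff k U (fun x => \sum_i f i x).
Proof.
move=> oU; elim: m f => [|m IH] f Cf.
  by apply: Cdiff_ext (Cdiff_cst _ _ 0) => // x _; rewrite big_ord0.
apply: (Cdiff_ext oU _ (CdiffD oU (IH (f \o lift ord0) _) (Cf ord0))).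
  by move=> x _; rewrite big_ord_recl addrC.
by move=> i; exact: Cf.
Qed.

Lemma CdiffM k U (f g : V -> R) : open U ->
  Cdiff k U f -> Cdiff k U g -> Cdiff k U (fun x => f x * g x : R).
Proof.
move=> oU; elim: k f g => [|k IH] f g.
  by move=> cf cg x Ux; apply: (@continuousM R V f g); [exact: cf|exact: cg].
move=> Cf' Cg'; have [df Cf] := Cf'; have [dg Cg] := Cg'; split=> [x Ux|v].
  by apply: (@differentiableM R V f g); [exact: df|exact: dg].
have := CdiffD oU (IH _ _ (CdiffW Cf') (Cg v)) (IH _ _ (CdiffW Cg') (Cf v)).
apply: Cdiff_ext => // x Ux.
have E : 'd (f * g) x v = f x * 'd g x v + g x * 'd f x v.
  by rewrite (diffM (df x Ux) (dg x Ux)).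
exact/esym/E.
Qed.

Lemma CdiffV k U (f : V -> R) : open U -> (forall x, U x -> f x != 0) ->
  Cdiff k U f -> Cdiff k U (fun x => (f x)^-1 : R).
Proof.
move=> oU f0; elim: k f f0 => [|k IH] f f0.
  by move=> cf x Ux; apply: (@continuousV R V f); [exact: f0|exact: cf].
move=> Cf'; have [df Cf] := Cf'; split=> [x Ux|v].
  by apply: (@differentiableV R V f); [exact: df|exact: f0].
have Ci := IH f f0 (CdiffW Cf').
have := CdiffM oU (CdiffM oU (Cdiff_cst k U (-1 : R)) (CdiffM oU Ci Ci)) (Cf v).
apply: Cdiff_ext => // x Ux.
have E : 'd (fun y => (f y)^-1) x v = - (f x) ^- 2 * 'd f x v.
  by rewrite (diffV (df x Ux) (f0 x Ux)).
by rewrite E mulN1r expr2 invfM.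
Qed.

Lemma CdiffZl (W : normedModType R) k U (f : V -> R) (w : W) : open U ->
  Cdiff k U f -> Cdiff k U (fun x => f x *: w).
Proof.
move=> oU; elim: k f => [|k IH] f.
  by move=> cf x Ux; apply: continuousZl; exact: cf.
move=> [df Cf]; split=> [x Ux|v].
  by apply: differentiableZl; exact: df.
apply: (Cdiff_ext oU _ (IH _ (Cf v))) => x Ux.
have E : 'd (fun z => f z *: w) x v = 'd f x v *: w.
  by rewrite (diffZl w (df x Ux)).
exact/esym/E.
Qed.

Lemma Cdiff_row k U m (f : V -> 'rV[R]_m) : open U ->
  (forall i, Cdiff k U (fun x => f x 0 i : R)) -> Cdiff k U f.
Proof.
move=> oU Cf; apply: (Cdiff_ext oU _ (Cdiff_sum oU (fun i =>
  CdiffZl (delta_mx 0 i : 'rV[R]_m) oU (Cf i)))) => x _.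
by rewrite [RHS]row_sum_delta.
Qed.

End SmoothTheory.

Lemma Cdiff_coord (R : realType) m k (U : set 'rV[R]_m) (i : 'I_m) :
  Cdiff k U (fun x => x 0 i : R).
Proof.
case: k => [|k].
  by move=> x _; exact: coord_continuous.
split=> [x _|v]; first exact: differentiable_coord.
have -> : (fun x => 'd (fun x : 'rV[R]_m => x 0 i : R) x v) =
          fun=> v 0 i; last exact: Cdiff_cst.
apply/funext => x.
have lin : linear (fun N : 'rV[R]_m => N 0 i : R).
  by move=> a u w; rewrite !mxE.
pose flinM := GRing.isLinear.Build _ _ _ _ _ lin.
pose flin : {linear 'rV[R]_m -> R} :=
  HB.pack (fun N : 'rV[R]_m => N 0 i : R) flinM.
have := @diff_lin R _ _ flin x (@coord_continuous R 1 m 0 i).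
by move=> ->.
Qed.

Lemma second_countable_rV (R : realType) (m : nat) :
  @second_countable 'rV[R]_m.
Proof.
pose b (ck : 'rV[rat]_m * nat) : set 'rV[R]_m :=
  ball (map_mx ratr ck.1 : 'rV[R]_m) ck.2.+1%:R^-1.
exists (range b).
  exact: card_le_trans (card_image_le _ _) (countableP _).
split=> [_ [ck _ <-]|x A].
  exact: ball_open.
move=> /nbhs_ballP[e e0 xeA].
have [k ke] : exists k, k.+1%:R^-1 < e / 2 :> R.
  have e20 : 0 < e / 2 by rewrite divr_gt0.
  exists (Num.truncn (e / 2)^-1).
  rewrite -[ltRHS]invrK ltf_pV2 ?posrE ?invr_gt0 //.
  exact: truncnS_gt.
have k0 : 0 < k.+1%:R^-1 :> R by rewrite invr_gt0.
have hc (i : 'I_m) : {q : rat | ball (x 0 i) k.+1%:R^-1 (ratr q : R)}.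
  apply: cid; have [|y [By [q _ qy]]] :=
      @dense_rat R (ball (x 0 i) k.+1%:R^-1) _ (ball_open _ _).
    by exists (x 0 i); exact: ballxx.
  by exists q; rewrite qy.
pose c : 'rV[rat]_m := \row_i sval (hc i).
have xc : ball (map_mx ratr c : 'rV[R]_m) k.+1%:R^-1 x.
  split=> // i j; rewrite ord1 !mxE; apply: ball_sym; exact: svalP (hc j).
exists (b (c, k)); first by split=> //; exists (c, k).
move=> y by_; apply: xeA; rewrite (splitr e).
have := ball_triangle (ball_sym xc) by_.
by apply: le_ball; rewrite lerD // ltW.
Qed.

Lemma second_countable_set_type (T : topologicalType) (A : set T) :
  @second_countable T -> @second_countable A.
Proof.
move=> [B cB [oB bB]].
exists [set set_val @^-1` U | U in B].
  exact: card_le_trans (card_image_le _ _) cB.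
split=> [_ [U BU <-]|x W].
  by exists U => //; exact: oB.
move=> [_ [[U oU <-] Ux UW]].
have [V [BV Vx] VU] := bB (set_val x) U (open_nbhs_nbhs (conj oU Ux)).
exists (set_val @^-1` V); first by split=> //; exists V.
by move=> y /VU /UW.
Qed.

Lemma hausdorff_set_type (T : topologicalType) (A : set T) :
  hausdorff_space T -> hausdorff_space A.
Proof.
move=> hT p q pq; apply/val_inj/hT => U V Up Vq.
have cv := @initial_continuous A T set_val.
have [r [Ur Vr]] := pq _ _ (cv p U Up) (cv q V Vq).
by exists (set_val r).
Qed.

Section Euclidean.
Variables (R : realType) (m : nat).

Fact euclid_open (p : 'rV[R]_m) : open (id @` [set: 'rV[R]_m]).
Proof. by rewrite image_id; exact: openT. Qed.

Fact euclid_transition (p q : 'rV[R]_m) :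
  smooth_on (id @` ([set: 'rV[R]_m] `&` [set: 'rV[R]_m]))
    ((id : 'rV[R]_m -> 'rV[R]_m) \o id).
Proof.
rewrite setTI image_id => k; apply: Cdiff_row; first exact: openT.
by move=> i; exact: Cdiff_coord.
Qed.

Definition euclid : manifold R m :=
  @Manifold R m 'rV[R]_m (fun=> setT) (fun=> id) (fun=> id)
    (@norm_hausdorff _ _) (@second_countable_rV R m)
    (fun=> openT) (fun=> I) euclid_open
    (fun _ q _ => cvg_id) (fun _ y _ => cvg_id) (fun _ _ _ => erefl)
    euclid_transition.

Definition euclid_metric : metric euclid := fun _ u v => dot u v.

End Euclidean.

Lemma Cdiff_sub (R : realType) (V W : normedModType R) k (U U' : set V)
  (f : V -> W) : U' `<=` U -> Cdiff k U f -> Cdiff k U' f.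
Proof.
move=> sU; elim: k f => [|k IH] f; first by move=> cf x /sU; exact: cf.
by move=> [df Cf]; split=> [x /sU|v]; [exact: df|exact/IH/Cf].
Qed.

Section Sphere.
Variables (R : realType) (n : nat).

Definition unit_sphere : set 'rV[R]_n.+1 := [set x | dot x x = 1].

(* For [e = 1] or [e = -1]: the stereographic projection from the point with
   first coordinate [- e] and other coordinates [0], and its inverse. *)
Definition stereo (e : R) (x : 'rV[R]_n.+1) : 'rV[R]_n :=
  \row_i (x 0 (lift ord0 i) / (1 + e * x 0 ord0)).
Definition stereo_inv (e : R) (y : 'rV[R]_n) : 'rV[R]_n.+1 :=
  \row_i if unlift ord0 i is Some j then 2 * y 0 j / (1 + dot y y)
         else e * (1 - dot y y) / (1 + dot y y).

(* The preferred chart at [x] is the projection from the pole in the opposite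
   hemisphere. *)
Definition hemisphere (x : 'rV[R]_n.+1) : R := if 0 <= x 0 ord0 then 1 else -1.

Lemma hemisphere_sqr x : hemisphere x * hemisphere x = 1.
Proof. by rewrite /hemisphere; case: ifP; rewrite ?mulrNN mulr1. Qed.

Lemma dot_ge0 m (y : 'rV[R]_m) : 0 <= dot y y.
Proof. by apply: sumr_ge0 => i _; rewrite -expr2 sqr_ge0. Qed.

Lemma dot1_gt0 m (y : 'rV[R]_m) : 0 < 1 + dot y y.
Proof. by rewrite ltr_pwDl // dot_ge0. Qed.

Lemma dot_lift (x : 'rV[R]_n.+1) :
  dot x x = x 0 ord0 * x 0 ord0 + \sum_(i < n) x 0 (lift ord0 i) * x 0 (lift ord0 i).
Proof. by rewrite /dot big_ord_recl. Qed.

Lemma stereo_inv0 e y :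
  stereo_inv e y 0 ord0 = e * (1 - dot y y) / (1 + dot y y).
Proof. by rewrite mxE unlift_none. Qed.

Lemma stereo_invS e y j :
  stereo_inv e y 0 (lift ord0 j) = 2 * y 0 j / (1 + dot y y).
Proof. by rewrite mxE liftK. Qed.

Lemma stereo_inv_unit e y : e * e = 1 -> unit_sphere (stereo_inv e y).
Proof.
move=> ee; rewrite /unit_sphere /= dot_lift stereo_inv0.
under eq_bigr do rewrite stereo_invS.
have y1 := lt0r_neq0 (dot1_gt0 y).
rewrite (_ : \sum_i _ = 4 * dot y y / (1 + dot y y) ^+ 2); last first.
  move: y1; set D := 1 + _ => D0.
  by rewrite /dot mulr_sumr mulr_suml; apply: eq_bigr => i _; field.
have -> : e * (1 - dot y y) / (1 + dot y y) * (e * (1 - dot y y) / (1 + dot y y))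
  = (e * e) * (1 - dot y y) ^+ 2 / (1 + dot y y) ^+ 2 by field.
by rewrite ee; field.
Qed.

Lemma stereoK (e : R) (x : 'rV[R]_n.+1) : e * e = 1 -> unit_sphere x ->
  1 + e * x 0 ord0 != 0 -> stereo_inv e (stereo e x) = x.
Proof.
rewrite /unit_sphere /= => ee; rewrite dot_lift => x1 x0.
set a := x 0 ord0 in x1 x0 *.
have ds : dot (stereo e x) (stereo e x) = (1 - a * a) / (1 + e * a) ^+ 2.
  have -> : 1 - a * a = \sum_(i < n) x 0 (lift ord0 i) * x 0 (lift ord0 i).
    by rewrite -x1 addrC addKr.
  by rewrite /dot mulr_suml; apply: eq_bigr => i _; rewrite mxE -/a; field.
have aa : 1 - a * a = (1 + e * a) * (1 - e * a).
  by transitivity (1 - e * e * (a * a)); [rewrite ee mul1r|ring].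
have {}ds : dot (stereo e x) (stereo e x) = (1 - e * a) / (1 + e * a).
  by rewrite ds aa; field.
have d1 : 1 + dot (stereo e x) (stereo e x) = 2 / (1 + e * a).
  by rewrite ds; field.
have d1' : 1 - dot (stereo e x) (stereo e x) = 2 * e * a / (1 + e * a).
  by rewrite ds; field.
apply/rowP => i; case: (unliftP ord0 i) => [j|] ->.
  by rewrite stereo_invS d1 mxE -/a; field.
rewrite stereo_inv0 d1 d1' -/a.
by transitivity (e * e * a); [field|rewrite ee mul1r].
Qed.

Lemma stereo_inv_dom e y : e * e = 1 ->
  1 + e * stereo_inv e y 0 ord0 = 2 / (1 + dot y y).
Proof.
move=> ee; rewrite stereo_inv0 -!mulrA (mulrA e e) ee.
by field; exact: lt0r_neq0 (dot1_gt0 y).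
Qed.

Lemma stereo_invK e y : e * e = 1 -> stereo e (stereo_inv e y) = y.
Proof.
move=> ee; apply/rowP => i; rewrite mxE stereo_inv_dom // stereo_invS.
by field; exact: lt0r_neq0 (dot1_gt0 y).
Qed.

Lemma stereo_inv_domN e y : e * e = 1 ->
  1 - e * stereo_inv e y 0 ord0 = 2 * dot y y / (1 + dot y y).
Proof.
move=> ee; rewrite stereo_inv0 -!mulrA (mulrA e e) ee.
by field; exact: lt0r_neq0 (dot1_gt0 y).
Qed.

Lemma Cdiff_dot m k (U : set 'rV[R]_m) : open U ->
  Cdiff k U (fun y => dot y y : R).
Proof.
move=> oU; apply: Cdiff_sum => // i.
by apply: CdiffM => //; exact: Cdiff_coord.
Qed.

Lemma continuous_open_neq0 (V : normedModType R) (f : V -> R) :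
  continuous f -> open [set x | f x != 0].
Proof.
move=> /continuousP cf; apply: (cf [set r | r != 0]).
exact: open_neq.
Qed.

Lemma Cdiff_stereo_inv k e : Cdiff k setT (stereo_inv e).
Proof.
have oT := @openT 'rV[R]_n.
have Cd : Cdiff k setT (fun y : 'rV[R]_n => (1 + dot y y)^-1 : R).
  apply: CdiffV => // [y _|]; first exact: lt0r_neq0 (dot1_gt0 y).
  by apply: CdiffD => //; [exact: Cdiff_cst|exact: Cdiff_dot].
apply: Cdiff_row => // i; case: (unliftP ord0 i) => [j|] ->.
  apply: (Cdiff_ext oT (f := fun y : 'rV[R]_n =>
    (2 * y 0 j) * (1 + dot y y)^-1 : R)) => [y _|]; first by rewrite stereo_invS.
  apply: CdiffM => //; apply: CdiffM => //; first exact: Cdiff_cst.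
  exact: Cdiff_coord.
apply: (Cdiff_ext oT (f := fun y : 'rV[R]_n =>
  (e * (1 + (-1) * dot y y)) * (1 + dot y y)^-1 : R)) => [y _|].
  by rewrite stereo_inv0 mulN1r.
apply: CdiffM => //; apply: CdiffM => //; first exact: Cdiff_cst.
apply: CdiffD => //; first exact: Cdiff_cst.
by apply: CdiffM => //; [exact: Cdiff_cst|exact: Cdiff_dot].
Qed.

Definition stereo_dom (e : R) : set 'rV[R]_n.+1 :=
  [set x | 1 + e * x 0 ord0 != 0].

Lemma open_stereo_dom e : open (stereo_dom e).
Proof.
apply: continuous_open_neq0 => x.
suff : Cdiff 0 setT (fun x : 'rV[R]_n.+1 => 1 + e * x 0 ord0 : R) by apply.
have oT := @openT 'rV[R]_n.+1.
apply: CdiffD => //; first exact: Cdiff_cst.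
by apply: CdiffM => //; [exact: Cdiff_cst|exact: Cdiff_coord].
Qed.

Lemma Cdiff_stereo k e : Cdiff k (stereo_dom e) (stereo e).
Proof.
have oD := @open_stereo_dom e.
apply: Cdiff_row => // i.
apply: (Cdiff_ext oD (f := fun x : 'rV[R]_n.+1 =>
  x 0 (lift ord0 i) * (1 + e * x 0 ord0)^-1 : R)) => [x _|].
  by rewrite mxE.
apply: CdiffM => //; first exact: Cdiff_coord.
apply: CdiffV => //; apply: CdiffD => //; first exact: Cdiff_cst.
by apply: CdiffM => //; [exact: Cdiff_cst|exact: Cdiff_coord].
Qed.

Definition sphere_point (p : unit_sphere) (y : 'rV[R]_n) : unit_sphere :=
  let e := hemisphere (set_val p) in
  exist _ (stereo_inv e y) (mem_set (stereo_inv_unit y (hemisphere_sqr _))).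

Definition sphere_chart (p q : unit_sphere) : 'rV[R]_n :=
  stereo (hemisphere (set_val p)) (set_val q).

Definition sphere_dom (p : unit_sphere) : set unit_sphere :=
  set_val @^-1` stereo_dom (hemisphere (set_val p)).

Fact sphere_dom_open p : open (sphere_dom p).
Proof.
have cv := @initial_continuous unit_sphere _ set_val.
by move/continuousP : cv; apply; exact: open_stereo_dom.
Qed.

Fact sphere_dom_self p : sphere_dom p p.
Proof.
rewrite /sphere_dom /stereo_dom /= /hemisphere; case: ifPn => [p0|].
  by rewrite mul1r lt0r_neq0 // ltr_pwDl.
by rewrite -ltNge => p0; rewrite mulN1r lt0r_neq0 // ltr_pwDl // oppr_ge0 ltW.
Qed.

Fact sphere_pointK p y : sphere_chart p (sphere_point p y) = y.
Proof. by apply: stereo_invK; exact: hemisphere_sqr. Qed.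

Fact sphere_point_dom p y : sphere_dom p (sphere_point p y).
Proof.
rewrite /sphere_dom /stereo_dom /= stereo_inv_dom; last exact: hemisphere_sqr.
by rewrite mulf_neq0 // invr_neq0 // lt0r_neq0 // dot1_gt0.
Qed.

Fact sphere_chart_open p : open (sphere_chart p @` sphere_dom p).
Proof.
rewrite (_ : _ @` _ = setT); first exact: openT.
by apply/seteqP; split=> // y _; exists (sphere_point p y);
  [exact: sphere_point_dom|exact: sphere_pointK].
Qed.

Fact sphere_chart_continuous p q :
  sphere_dom p q -> {for q, continuous (sphere_chart p)}.
Proof.
move=> pq; apply: continuous_comp; first exact: initial_continuous.
exact: (Cdiff_stereo 0).
Qed.

Fact sphere_point_continuous p y : (sphere_chart p @` sphere_dom p) y ->
  {for y, continuous (sphere_point p)}.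
Proof.
move=> _ W [_ [[U oU <-] Uy UW]].
have cf : {for y, continuous (stereo_inv (hemisphere (set_val p)))}.
  exact: (Cdiff_stereo_inv 0).
have H := cf U (open_nbhs_nbhs (conj oU Uy)).
have sUW : stereo_inv (hemisphere (set_val p)) @^-1` U `<=`
    sphere_point p @^-1` W by move=> z Uz; exact: UW.
exact: filterS sUW H.
Qed.

Fact sphere_chartK p q :
  sphere_dom p q -> sphere_point p (sphere_chart p q) = q.
Proof.
move=> pq; apply/val_inj; apply: stereoK => //; first exact: hemisphere_sqr.
exact: set_valP.
Qed.

Fact sphere_transition p q :
  smooth_on (sphere_chart p @` (sphere_dom p `&` sphere_dom q))
    (sphere_chart q \o sphere_point p).
Proof.
move=> k; set e := hemisphere (set_val p); set e' := hemisphere (set_val q).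
have ee : e * e = 1 by exact: hemisphere_sqr.
have [e'e|e'e] : e' = e \/ e' = - e.
  by rewrite /e /e' /hemisphere; do 2 case: ifP; rewrite ?opprK; auto.
- apply: (@Cdiff_sub _ _ _ k setT) => //.
  apply: (Cdiff_ext (@openT _) (f := id)) => [y _|].
    by rewrite /= /sphere_chart -/e' e'e stereo_invK.
  by apply: Cdiff_row => [|i]; [exact: openT|exact: Cdiff_coord].
- pose U : set 'rV[R]_n := [set y | dot y y != 0].
  have oU : open U.
    by apply: continuous_open_neq0 => y; exact: (Cdiff_dot 0 (@openT _)).
  apply: (@Cdiff_sub _ _ _ k U).
    move=> _ [r [pr qr] <-]; rewrite /U /=; apply: contraTneq qr => dy.
    rewrite /sphere_dom /stereo_dom /= -/e' e'e mulNr -(sphere_chartK pr) /=.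
    by rewrite stereo_inv_domN // dy mulr0 mul0r negbK.
  apply: Cdiff_row => // i.
  apply: (Cdiff_ext oU (f := fun y : 'rV[R]_n => y 0 i * (dot y y)^-1 : R)).
    move=> y Uy; rewrite /= /sphere_chart /= -/e' e'e [RHS]mxE mulNr.
    rewrite stereo_invS stereo_inv_domN //.
    by field; rewrite Uy lt0r_neq0 // dot1_gt0.
  apply: CdiffM => //; first exact: Cdiff_coord.
  by apply: CdiffV => //; exact: Cdiff_dot.
Qed.

Definition sphere : manifold R n :=
  @Manifold R n unit_sphere sphere_dom sphere_chart sphere_point
    (@hausdorff_set_type _ unit_sphere (@norm_hausdorff _ _))
    (@second_countable_set_type _ unit_sphere (@second_countable_rV R n.+1))
    sphere_dom_open sphere_dom_self sphere_chart_open
    sphere_chart_continuous sphere_point_continuous sphere_chartK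
    sphere_transition.

Definition sphere_incl : sphere -> euclid R n.+1 := set_val.

Definition round_metric : metric sphere :=
  induced_metric (@euclid_metric R n.+1) sphere_incl.

End Sphere.

Record weitzenbock (R : realType) (m : nat) := Weitzenbock {
  wz_manifold :> manifold R m;
  frame : 'I_m -> wz_manifold -> 'rV[R]_m;
  frame_smooth : forall i, smooth_field setT (frame i);
  frame_basis : forall p, (\matrix_i frame i p) \in unitmx;
  wz_conn : covder wz_manifold;
  wz_connection : is_connection wz_conn;
  wz_frame_parallel : forall i p u, wz_conn p u (frame i) = 0
}.
Arguments frame {R m w} : rename.
Arguments wz_conn {R m w} : rename.

Section Weitzenbock.
Variables (R : realType) (m : nat) (Mt : weitzenbock R m).

Definition frame_mx (p : Mt) : 'M[R]_m := \matrix_i frame i p.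

(* the coefficients of a tangent vector at [p] with respect to the frame; this
   is the identification [phi] at [p], with inverse [fun x => x *m frame_mx p] *)
Definition coords (p : Mt) (u : 'rV[R]_m) : 'rV[R]_m := u *m invmx (frame_mx p).

(* the metric for which the frame is orthonormal *)
Definition wz_metric : metric Mt := fun p u v => dot (coords p u) (coords p v).

(* the orientation for which the frame is oriented *)
Definition wz_oriented_basis (p : Mt) (B : 'M[R]_m) : bool :=
  0 < \det (B *m invmx (frame_mx p)).

Definition wz_torsion (X Y : Mt -> 'rV[R]_m) : Mt -> 'rV[R]_m :=
  torsion wz_conn X Y.

Definition parallel_torsion : Prop :=
  forall (U : set Mt) X Y Z p, open U -> U p ->
    smooth_field U X -> smooth_field U Y -> smooth_field U Z ->
    wz_conn p (X p) (wz_torsion Y Z) =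
      wz_torsion (covf wz_conn X Y) Z p + wz_torsion Y (covf wz_conn X Z) p.

Definition skew_torsion : Prop :=
  forall (U : set Mt) X Y p, open U -> U p ->
    smooth_field U X -> smooth_field U Y ->
    [/\ wz_metric p (X p) (wz_torsion X Y p) = 0,
        wz_metric p (X p) (wz_torsion Y X p) = 0 &
        wz_metric p (X p) (wz_torsion Y Y p) = 0].

End Weitzenbock.

Record hypersurface (R : realType) (n : nat) (Mt : weitzenbock R n.+1) :=
  Hypersurface {
  hs_manifold :> manifold R n;
  hs_incl : hs_manifold -> Mt;
  hs_incl_embedding : embedding hs_incl;
  hs_orientation : orientation hs_manifold;
  hs_normal : hs_manifold -> 'rV[R]_n.+1;
  normal_smooth : smooth_along hs_incl setT hs_normal;
  normal_unit : forall p, wz_metric (hs_incl p) (hs_normal p) (hs_normal p) = 1;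
  normal_orthogonal : forall p u,
    wz_metric (hs_incl p) (hs_normal p) (u *m tangent_map hs_incl p) = 0;
  normal_oriented : forall p (B : 'M[R]_n), B \in unitmx ->
    oriented_basis hs_orientation p B =
    wz_oriented_basis (hs_incl p)
      (col_mx (hs_normal p) (B *m tangent_map hs_incl p) : 'M[R]_n.+1)
}.
Arguments hs_incl {R n Mt h} : rename.
Arguments hs_normal {R n Mt h} : rename.

Section Hypersurface.
Variables (R : realType) (n : nat) (Mt : weitzenbock R n.+1).
Variable M : hypersurface Mt.

Definition hs_metric : metric M := induced_metric (@wz_metric R n.+1 Mt) hs_incl.

(* the tangent vector of [M] at [p] whose image is the tangential part of [z] *)
Definition tangential (p : M) (z : 'rV[R]_n.+1) : 'rV[R]_n :=
  (z - wz_metric (hs_incl p) z (hs_normal p) *: hs_normal p)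
    *m pinvmx (tangent_map hs_incl p).

Definition hs_conn : covder M := fun p u Y =>
  tangential p (pullback_conn wz_conn hs_incl p u (push hs_incl Y)).

(* [W] is the Weingarten map with respect to the ambient connection [nabla],
   where the endomorphism [W p] of the tangent space at [p] is [x |-> x *m W p] *)
Definition is_weingarten (nabla : covder Mt) (W : M -> 'M[R]_n) : Prop :=
  forall (U : set M) Y p x, open U -> U p -> smooth_field U Y ->
    hs_metric p (x *m W p) (Y p) =
    wz_metric (hs_incl p) (hs_normal p) (pullback_conn nabla hs_incl p x (push hs_incl Y)).

Definition sqnorm (E : 'I_n -> M -> 'rV[R]_n) (W : M -> 'M[R]_n) (p : M) : R :=
  \sum_i hs_metric p (E i p *m W p) (E i p *m W p).

Definition gauss_map (p : M) : sphere R n :=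
  exist _ (coords (hs_incl p) (hs_normal p)) (mem_set (normal_unit p)).

Definition gauss_map_hat : M -> euclid R n.+1 := @sphere_incl R n \o gauss_map.

(* the isomorphism from [T_p M] to the tangent space of the sphere at
   [gauss_map p] obtained by restricting [coords]: the image of [u] is the
   tangent vector of the sphere which is mapped by the differential of the
   inclusion to the coefficients of [u] *)
Definition phi (p : M) : 'M[R]_n :=
  tangent_map hs_incl p *m invmx (frame_mx (hs_incl p))
    *m pinvmx (tangent_map (@sphere_incl R n) (gauss_map p)).

End Hypersurface.

Arguments wz_metric {R m} Mt.
Arguments hs_metric {R n Mt} M.
Arguments hs_conn {R n Mt} M.
Arguments gauss_map {R n Mt} M.
Arguments gauss_map_hat {R n Mt} M.
Arguments round_metric : clear implicits.
Arguments euclid_metric : clear implicits.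

(* Main.v *)
Require Import Defs.
From HB Require Import structures.
From mathcomp Require Import all_boot all_order all_algebra.
From mathcomp Require Import all_classical all_reals all_analysis.
From mathcomp Require Import perm ring lra.
Set Implicit Arguments.
Unset Strict Implicit.
Unset Printing Implicit Defensive.
Import Order.TTheory GRing.Theory Num.Theory.
Import numFieldNormedType.Exports.
Local Open Scope classical_set_scope.
Local Open Scope ring_scope.

(** Coefficients with respect to the parallel frame turn vector fields into
    vector-valued functions, which [wz_conn] differentiates componentwise
    ([wz_connE]). The coframe is a vector-valued 1-form whose exterior derivative is
    the torsion ([wz_torsionE]); written as a product S on coefficient vectors
    ([structure]), a parallel torsion has locally constant coefficients
    ([deriv_structure]), and total skewness says that <a, S(b, c)> is alternating. The
    exterior derivative commutes with pullbacks ([ext_deriv_pull]), so the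
    restriction [omega] of the coframe to the hypersurface satisfies the same structure
    equation ([structure_eq_omega]), and the Gauss map is the coefficient vector
    [nu] of the normal.

    Let E_i be an orthonormal frame with coefficient vectors e_i, and D_i the
    derivative along E_i. Weingarten's equation [deriv_nu] reads
    D_i nu = - omega(W E_i), and the structure equation shows that the second
    fundamental form fails to be symmetric by the normal component of S
    ([shape_skew]). As [nu] takes values in a vector space, its Laplacian is the sum
    of the D_i D_i nu minus the derivative along the sum of the nabla_(E_i) E_i.
    Differentiating <D_i nu, nu> = 0 gives the normal part - |W|^2
    ([laplacian_normal]). For the tangential part one exchanges D_i and D_j and
    differentiates [shape_skew] along E_i ([codazzi_term]); because the torsion is
    parallel, no derivative of S appears. Summed over i, the remaining terms pair a
    skew-symmetric matrix with a symmetric one and vanish, which leaves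
    - grad H ([laplacian_tangent], [laplacian_nu]). Gauss's formula for the sphere
    ([pullback_conn_sphere]) says that the Laplacian of the map into the sphere is the
    tangential part of the Euclidean one, which proves the two formulas.

    For the comparison with Levi-Civita connections: the sum of the
    nabla_(E_i) E_i is the same for all metric connections with totally skew torsion
    ([sum_conn_frame]), so the Laplacians agree. In the ambient manifold the two
    connections differ by S / 2 ([lc_wzE]), by the uniqueness argument [koszul], which
    also yields the connections of the sphere and of the Euclidean space. Hence Wbar
    is the symmetric part of W, so the traces agree, and the difference of the square
    norms is a quarter of the sum of the <nu, S(e_i, e_j)>^2. This is the Ricci
    curvature, since the Levi-Civita curvature satisfies
    R(x, nu) nu = - S(S(x, nu), nu) / 4 ([lc_curvatureE], [ricciE]). *)

(** * Linear algebra *)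

Section Dot.
Variables (R : realType) (k : nat).
Implicit Types (u v w : 'rV[R]_k).

Lemma dot_mulmx u v : dot u v = (u *m v^T) 0 0.
Proof. by rewrite mxE; apply: eq_bigr => i _; rewrite mxE. Qed.

Lemma dotC u v : dot u v = dot v u.
Proof. by apply: eq_bigr => i _; rewrite mulrC. Qed.

Lemma dotDl u v w : dot (u + v) w = dot u w + dot v w.
Proof. by rewrite !dot_mulmx mulmxDl mxE. Qed.

Lemma dotZl a u v : dot (a *: u) v = a * dot u v.
Proof. by rewrite !dot_mulmx -scalemxAl mxE. Qed.

Lemma dotNl u v : dot (- u) v = - dot u v.
Proof. by rewrite -scaleN1r dotZl mulN1r. Qed.

Lemma dotBl u v w : dot (u - v) w = dot u w - dot v w.
Proof. by rewrite dotDl dotNl. Qed.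

Lemma dot0l v : dot 0 v = 0.
Proof. by rewrite -(scale0r (0 : 'rV[R]_k)) dotZl mul0r. Qed.

Lemma dotDr u v w : dot u (v + w) = dot u v + dot u w.
Proof. by rewrite !(dotC u) dotDl. Qed.

Lemma dotZr a u v : dot u (a *: v) = a * dot u v.
Proof. by rewrite !(dotC u) dotZl. Qed.

Lemma dotNr u v : dot u (- v) = - dot u v.
Proof. by rewrite !(dotC u) dotNl. Qed.

Lemma dotBr u v w : dot u (v - w) = dot u v - dot u w.
Proof. by rewrite !(dotC u) dotBl. Qed.

Lemma dot0r v : dot v 0 = 0.
Proof. by rewrite dotC dot0l. Qed.

Lemma dot_suml m (f : 'I_m -> 'rV[R]_k) v : dot (\sum_i f i) v = \sum_i dot (f i) v.
Proof.
by elim/big_rec2: _ => [|i y1 y2 _ IH]; rewrite ?dot0l // dotDl IH.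
Qed.

Lemma dot_sumr m (f : 'I_m -> 'rV[R]_k) v : dot v (\sum_i f i) = \sum_i dot v (f i).
Proof. by rewrite dotC dot_suml; apply: eq_bigr => i _; rewrite dotC. Qed.

Lemma dot_eq0 u : dot u u = 0 -> u = 0.
Proof.
move=> /eqP; rewrite psumr_eq0 => [/allP H|i _]; last by rewrite -expr2 sqr_ge0.
apply/rowP => i; rewrite mxE; apply/eqP.
by have := H i (mem_index_enum _); rewrite -expr2 sqrf_eq0.
Qed.

End Dot.

Lemma mulmx_trE (R : realType) (a b k : nat) (B : 'M[R]_(a, k)) (C : 'M[R]_(b, k)) i j :
  (B *m C^T) i j = dot (row i B) (row j C).
Proof. by rewrite mxE; apply: eq_bigr => l _; rewrite !mxE. Qed.

(** Both row spaces lie in the orthogonal complement of [u], which has the dimension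
    of that of [A]. *)
Lemma submx_orthogonal (F : fieldType) (n : nat) (A : 'M[F]_(n, n.+1))
    (u : 'rV[F]_n.+1) (m : nat) (v : 'M[F]_(m, n.+1)) :
  row_free A -> u != 0 -> A *m u^T = 0 -> v *m u^T = 0 -> (v <= A)%MS.
Proof.
move=> fA u0 Au vu.
have AK : (A <= kermx u^T)%MS by apply/sub_kermxP.
have rK : \rank (kermx u^T) = n.
  by rewrite mxrank_ker mxrank_tr rank_rV u0 subn1.
have := mxrank_leqif_sup AK; rewrite rK (eqP fA) => -[_].
rewrite eqxx => /esym KA; apply: submx_trans KA; exact/sub_kermxP.
Qed.

(** Polarization. *)
Lemma skew_form_mx (F : numDomainType) (n : nat) (A : 'M[F]_n) :
  (forall x : 'rV_n, (x *m A *m x^T) 0 0 = 0) -> A^T = - A.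
Proof.
move=> skew; apply/matrixP => i j; rewrite mxE [RHS]mxE.
pose f (x y : 'rV[F]_n) := (x *m A *m y^T) 0 0.
have fE a b : A a b = f (delta_mx 0 a) (delta_mx 0 b).
  by rewrite /f trmx_delta -rowE -colE !mxE.
have fD x y : f (x + y) (x + y) = f x x + f x y + f y x + f y y.
  have addE (B C : 'M[F]_1) : (B + C) 0 0 = B 0 0 + C 0 0 by rewrite mxE.
  by rewrite /f mulmxDl linearD /= mulmxDr !mulmxDl !addE; ring.
apply/eqP; rewrite -addr_eq0 !fE; apply/eqP.
have := skew (delta_mx 0 i + delta_mx 0 j).
by rewrite -/(f _ _) fD /f !skew add0r addr0 addrC.
Qed.

(** * Calculus in normed spaces *)

Section Calculus.
Variables (R : realType) (V : normedModType R).
Implicit Types (U : set V).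

Lemma diff_entry (a b : nat) (f : V -> 'M[R]_(a, b)) (x v : V) i j :
  differentiable f x ->
  differentiable (fun y => f y i j : R) x /\
  'd (fun y => f y i j : R) x v = ('d f x v) i j.
Proof.
move=> df.
have lin : linear (fun N : 'M[R]_(a, b) => N i j : R).
  by move=> k u w; rewrite !mxE.
pose flinM := GRing.isLinear.Build _ _ _ _ _ lin.
pose flin : {linear 'M[R]_(a, b) -> R} :=
  HB.pack (fun N : 'M[R]_(a, b) => N i j : R) flinM.
have cflin : continuous flin by exact: coord_continuous.
have dl := linear_differentiable (f x) cflin.
split; first exact: (differentiable_comp df dl).
have := diff_comp df dl.
rewrite (diff_lin _ cflin) => E.
exact: (congr1 (fun h => h v) E).
Qed.

Lemma differentiable_row (m : nat) (f : V -> 'rV[R]_m) (x : V) :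
  (forall j, differentiable (fun y => f y 0 j : R) x) -> differentiable f x.
Proof.
move=> df.
have -> : f = fun y => (\sum_(i < m) (fun z => f z 0 i *: delta_mx 0 i)) y.
  by apply/funext => y; rewrite fct_sumE -row_sum_delta.
by apply: differentiable_sum => i; exact: differentiableZl.
Qed.

Lemma Cdiff_entry (a b : nat) k U (f : V -> 'M[R]_(a, b)) i j : open U ->
  Cdiff k U f -> Cdiff k U (fun y => f y i j : R).
Proof.
move=> oU; elim: k f => [|k IH] f.
  by move=> cf x Ux; apply: continuous_comp (cf x Ux) (@coord_continuous _ _ _ i j _).
move=> [df Cf]; split=> [x Ux|v].
  by have [] := diff_entry x i j (df x Ux).
apply: (Cdiff_ext oU _ (IH _ (Cf v))) => x Ux.
by have [_ ->] := diff_entry v i j (df x Ux).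
Qed.

Lemma Cdiff_local (W : normedModType R) k U (f : V -> W) :
  (forall x, U x -> exists2 U', U' x & Cdiff k U' f) -> Cdiff k U f.
Proof.
elim: k f => [|k IH] f loc.
  by move=> x Ux; have [U' U'x] := loc x Ux; apply.
split=> [x Ux|v].
  by have [U' U'x [df _]] := loc x Ux; exact: df.
apply: IH => x Ux; have [U' U'x [_ Cf]] := loc x Ux.
by exists U' => //; exact: Cf.
Qed.

Lemma Cdiff_prod k U m (f : 'I_m -> V -> R) : open U ->
  (forall i, Cdiff k U (f i)) -> Cdiff k U (fun x => \prod_i f i x : R).
Proof.
move=> oU; elim: m f => [|m IH] f Cf.
  by apply: Cdiff_ext (Cdiff_cst _ _ (1 : R)) => // x _; rewrite big_ord0.
apply: (Cdiff_ext oU _ (CdiffM oU (Cf ord0) (IH (f \o lift ord0) _))).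
  by move=> x _; rewrite big_ord_recl.
by move=> i; exact: Cf.
Qed.

Lemma Cdiff_det k U m (A : V -> 'M[R]_m) : open U ->
  (forall i j, Cdiff k U (fun x => A x i j : R)) -> Cdiff k U (fun x => \det (A x) : R).
Proof.
move=> oU CA.
pose P (s : 'S_m) := fun x => (-1) ^+ s * \prod_i A x i (s i) : R.
have CP s : Cdiff k U (P s).
  by apply: CdiffM => //; [exact: Cdiff_cst|apply: Cdiff_prod].
have -> : (fun x => \det (A x) : R) = fun x => \sum_(i < #|{: 'S_m}|) P (enum_val i) x.
  apply/funext => x; rewrite /determinant (reindex (fun i : 'I_#|{: 'S_m}| => enum_val i)) //.
  by exists enum_rank => ? _; [exact: enum_valK|exact: enum_rankK].
by apply: Cdiff_sum.
Qed.

(** Cramer's rule makes matrix inversion a rational, hence smooth, function of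
    the entries. *)
Lemma Cdiff_invmx k U m (A : V -> 'M[R]_m) i j : open U ->
  (forall x, U x -> A x \in unitmx) ->
  (forall i j, Cdiff k U (fun x => A x i j : R)) ->
  Cdiff k U (fun x => invmx (A x) i j : R).
Proof.
move=> oU uA CA.
apply: (Cdiff_ext oU (f := fun x => (\det (A x))^-1 *
    ((-1) ^+ (j + i) * \det (row' j (col' i (A x)))) : R)).
  by move=> x Ux; rewrite /invmx uA // !mxE.
apply: CdiffM => //.
  apply: CdiffV => // [x /uA|]; first by rewrite unitmxE unitfE.
  exact: Cdiff_det.
apply: CdiffM => //; first exact: Cdiff_cst.
apply: Cdiff_det => // a b.
by apply: (Cdiff_ext oU _ (CA (lift j a) (lift i b))) => x _; rewrite !mxE.
Qed.

Lemma diff_row_basis (m : nat) (W : normedModType R) (f : 'rV[R]_m -> W) x v :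
  'd f x v = \sum_j v 0 j *: 'd f x (delta_mx 0 j).
Proof. by rewrite {1}(row_sum_delta v) linear_sum; apply: eq_bigr => j _; rewrite linearZ. Qed.

(** Induction on [k]: the differential of the composite is a sum of products of
    partial derivatives of [g], composed with [f], and of entries of the differential
    of [f]. *)
Lemma Cdiff_comp (m k : nat) U (U' : set 'rV[R]_m) (f : V -> 'rV[R]_m)
    (g : 'rV[R]_m -> R) : open U ->
  (forall x, U x -> U' (f x)) -> Cdiff k U f -> Cdiff k U' g ->
  Cdiff k U (g \o f).
Proof.
move=> oU fU; elim: k g => [|k IH] g.
  by move=> cf cg x Ux; apply: continuous_comp (cf x Ux) (cg _ (fU _ Ux)).
move=> Cf' [dg Cg]; have [df Cf] := Cf'; split=> [x Ux|v].
  by apply: differentiable_comp; [exact: df|exact/dg/fU].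
apply: (Cdiff_ext oU (f := fun x => \sum_j ('d f x v) 0 j * 'd g (f x) (delta_mx 0 j))).
  move=> x Ux; rewrite (diff_comp (df x Ux) (dg _ (fU _ Ux))) /=.
  by rewrite [RHS]diff_row_basis.
apply: Cdiff_sum => // j; apply: CdiffM => //; first exact: (Cdiff_entry 0 j oU (Cf v)).
exact: (IH (fun y => 'd g y (delta_mx 0 j)) (CdiffW Cf') (Cg _)).
Qed.

End Calculus.

Section Schwarz.
Variables (R : realType) (V : normedModType R).

Lemma MVT_line (f : V -> R) (x v : V) (h : R) : 0 < h ->
  (forall t, 0 <= t <= h -> differentiable f (x + t *: v)) ->
  exists2 t, 0 < t < h & f (x + h *: v) - f x = 'd f (x + t *: v) v * h.
Proof.
move=> h0 df; pose F (t : R) := f (x + t *: v).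
have dF t : 0 <= t <= h -> is_diff t F (fun s => 'd f (x + t *: v) (s *: v)).
  move=> th.
  have d1 : is_diff (t : R) (fun s : R => x + s *: v) (fun s : R => s *: v).
    have /is_diff_eq := is_diffD (is_diff_cst x (t : R)) (is_diff_scalel t v).
    by apply; rewrite add0r.
  have d2 : is_diff (x + t *: v) f ('d f (x + t *: v)).
    by apply: DiffDef => //; exact: df.
  exact: is_diff_comp.
have derF t : 0 <= t <= h -> is_derive t 1 F ('d f (x + t *: v) v).
  move=> th; have dFt := dF t th.
  have diffF : differentiable F t by exact: ex_diff.
  apply: DeriveDef; first exact: diff_derivable.
  by rewrite deriveE // diff_val scale1r.
have dI t : t \in `]0, h[%R -> is_derive t 1 F ('d f (x + t *: v) v).
  by rewrite in_itv /= => /andP[/ltW t0 /ltW th]; apply: derF; rewrite t0 th.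
have cF : {within `[0, h], continuous F}.
  apply: derivable_within_continuous => t; rewrite in_itv /= => th.
  by have := derF t th => dFt; exact: ex_derive.
have [t] := MVT h0 dI cF; rewrite in_itv /= => th E.
by exists t => //; move: E; rewrite /F scale0r addr0 subr0.
Qed.

Lemma near_parallelogram (P : set V) (x w w' : V) : nbhs x P ->
  \forall h \near 0^'+, forall s t : R, 0 <= s <= h -> 0 <= t <= h ->
    P (x + s *: w + t *: w').
Proof.
move=> /nbhs_ballP[r /= r0 xr].
have k0 : 0 < `|w| + `|w'| + 1 by rewrite ltr_wpDl // addr_ge0.
have rk0 : 0 < r / (`|w| + `|w'| + 1) by rewrite divr_gt0.
near=> h => s t /andP[s0 sh] /andP[t0 th]; apply: xr.
rewrite -ball_normE /= -addrA opprD addNKr normrN.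
apply: le_lt_trans (_ : h * (`|w| + `|w'| + 1) < r); last first.
  by rewrite -ltr_pdivlMr //; near: h; exact: nbhs_right_lt.
apply: le_trans (ler_normD _ _) _; rewrite !normrZ !ger0_norm //.
have h00 : 0 <= h by apply: le_trans sh.
by rewrite !mulrDr mulr1 -[leLHS]addr0 lerD // lerD //; exact: ler_wpM2r.
Unshelve. all: by end_near. Qed.

(** Both mixed second derivatives are attained, at points near [x], by the same
    second difference of [f]; continuity of the mixed derivatives concludes. *)
Lemma schwarz (U : set V) (f : V -> R) (x u v : V) : open U -> U x ->
  smooth_on U f ->
  'd (fun y => 'd f y u : R) x v = 'd (fun y => 'd f y v : R) x u.
Proof.
move=> oU Ux sf.
have [df d1] := sf 1; have Cf := sf 2.
have d2 w y : U y -> differentiable (fun y => 'd f y w : R) y.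
  by case: Cf => _ /(_ w)[+ _] => /(_ y).
pose D2 w w' y := 'd (fun y => 'd f y w : R) y w' : R.
have c2 w w' : {for x, continuous (D2 w w')}.
  by case: Cf => _ /(_ w)[_ /(_ w')]; apply.
have mean w w' h : 0 < h -> (forall s t : R, 0 <= s <= h -> 0 <= t <= h ->
    U (x + s *: w + t *: w')) -> exists s t, [/\ 0 <= s <= h, 0 <= t <= h &
   f (x + h *: w + h *: w') - f (x + h *: w) - f (x + h *: w') + f x =
   D2 w w' (x + s *: w + t *: w') * h * h].
  move=> h0 UU; have hh : 0 <= h <= h by apply/andP; split=> //; exact: ltW.
  have h00 : (0 : R) <= 0 <= h by apply/andP; split=> //; exact: ltW.
  pose F y := f (y + h *: w') - f y.
  have dF y : U y -> U (y + h *: w') ->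
      differentiable F y /\ 'd F y w = 'd f (y + h *: w') w - 'd f y w.
    move=> Uy Uy'.
    have ds : is_diff y (fun z => z + h *: w') id.
      have /is_diff_eq := is_diffD (is_diff_id y) (is_diff_cst (h *: w') y).
      by apply; rewrite addr0.
    have dy : is_diff y f ('d f y) by apply: DiffDef => //; exact: df.
    have dy' : is_diff (y + h *: w') f ('d f (y + h *: w')).
      by apply: DiffDef => //; exact: df.
    have dFy := is_diffB (is_diff_comp ds dy') dy.
    split; first exact: ex_diff.
    by rewrite (@diff_val _ _ _ _ _ _ _ dFy).
  have [|s /andP[s0 sh]] := @MVT_line F x w h h0.
    move=> t th; have := UU t 0 th h00; rewrite scale0r addr0 => U1.
    by have [] := dF _ U1 (UU t h th hh).
  have shh : 0 <= s <= h by rewrite !ltW.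
  have := UU s 0 shh h00; rewrite scale0r addr0 => U1.
  have [_ ->] := dF _ U1 (UU s h shh hh).
  have [|t /andP[t0 th]] := @MVT_line (fun y => 'd f y w) (x + s *: w) w' h h0.
    by move=> t th; apply: d2; apply: UU.
  move=> -> EF; exists s, t; split; rewrite ?ltW ?t0 ?s0 //.
  by rewrite /D2 -EF /F; ring.
apply/eqP; rewrite -subr_eq0 -normr_le0; apply/ler_addgt0Pl => e e0.
rewrite addr0.
have e20 : 0 < e / 2 by rewrite divr_gt0.
have nx w w' : nbhs x (fun y => U y /\ `|D2 w w' x - D2 w w' y| < e / 2).
  apply: filterI; first exact: open_nbhs_nbhs.
  by have /cvgrPdist_lt /(_ _ e20) := c2 w w'.
have [h [[h0 P1] P2]] := @filter_ex _ (0^'+ : set_system R) _ _ (filterI (filterI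
  (@nbhs_right_gt R 0) (near_parallelogram u v (nx u v)))
  (near_parallelogram v u (nx v u))).
have [|s [t [s0 t0 E1]]] := mean u v h h0; first by move=> s t s0 t0; case: (P1 s t s0 t0).
have [|t' [s' [t'0 s'0 E2]]] := mean v u h h0.
  by move=> s' t' s'0 t'0; case: (P2 s' t' s'0 t'0).
have E : D2 u v (x + s *: u + t *: v) = D2 v u (x + t' *: v + s' *: u).
  apply: (mulIf (lt0r_neq0 h0)); apply: (mulIf (lt0r_neq0 h0)).
  by rewrite -E1 -E2 (addrAC x (h *: v)); ring.
have [_ N1] := P1 s t s0 t0; have [_ N2] := P2 t' s' t'0 s'0.
rewrite -/(D2 u v x) -/(D2 v u x) (splitr e).
rewrite -(subrK (D2 u v (x + s *: u + t *: v)) (D2 u v x)) -addrA {2}E.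
apply: le_trans (ler_normD _ _) _; rewrite lerD // ?ltW //.
by rewrite distrC.
Qed.
End Schwarz.

(** * Differentiation in charts *)

Lemma mul_jacobian (R : realType) (a b : nat) (f : 'rV[R]_a -> 'rV[R]_b) x u :
  u *m 'J f x = 'd f x u.
Proof. by rewrite /jacobian mul_rV_lin1. Qed.

Section ChartCalculus.
Variables (R : realType) (n : nat) (M : manifold R n).
Implicit Types (p q c : M) (U : set M).

Lemma near_chart c q (P : set M) : chart_dom c q -> nbhs q P ->
  \forall y \near chart c q,
    [/\ chart_dom c (chart_inv c y), chart c (chart_inv c y) = y &
        P (chart_inv c y)].
Proof.
move=> cq Pq.
have cIq : (chart c @` chart_dom c) (chart c q) by exists q.
have nI := open_nbhs_nbhs (conj (@chart_open _ _ _ c) cIq).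
have ci := chart_inv_continuous cIq.
have nd : nbhs q (chart_dom c `&` P).
  by apply: filterI => //; exact: open_nbhs_nbhs (conj (@dom_open _ _ _ c) cq).
have := ci (chart_dom c `&` P); rewrite chartK // => /(_ nd) ni.
apply: filterS2 nI ni => y [r cr <-] /= []; rewrite chartK //.
Qed.

Lemma open_chart_image c U : open U -> open (chart c @` (chart_dom c `&` U)).
Proof.
move=> oU; rewrite openE => _ [q [cq Uq] <-].
have nU := open_nbhs_nbhs (conj oU Uq).
apply: filterS (near_chart cq nU) => y [cy yK Uy].
by exists (chart_inv c y).
Qed.

Lemma smooth_fun_ext (W : normedModType R) U (f g : M -> W) : open U ->
  (forall q, U q -> f q = g q) -> smooth_fun U f -> smooth_fun U g.
Proof.
move=> oU fg sf c k; apply: (Cdiff_ext (@open_chart_image c _ oU) _ (sf c k)).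
by move=> _ [q [cq Uq] <-] /=; rewrite chartK // fg.
Qed.

Lemma smooth_fun_sub (W : normedModType R) U U' (f : M -> W) : U' `<=` U ->
  smooth_fun U f -> smooth_fun U' f.
Proof.
move=> sU sf c k; apply: Cdiff_sub (sf c k).
by move=> _ [q [cq Uq] <-]; exists q => //; split => //; exact: sU.
Qed.

Lemma smooth_fun_local (W : normedModType R) U (f : M -> W) :
  (forall q, U q -> exists2 U', U' q & smooth_fun U' f) -> smooth_fun U f.
Proof.
move=> loc c k; apply: Cdiff_local => _ [q [cq Uq] <-].
have [U' U'q sf] := loc q Uq.
by exists (chart c @` (chart_dom c `&` U')); [exists q|exact: sf].
Qed.

Lemma smooth_fun_dom (W : normedModType R) U (f : M -> W) :
  (forall c, smooth_fun (U `&` chart_dom c) f) -> smooth_fun U f.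
Proof.
move=> loc; apply: smooth_fun_local => q Uq.
by exists (U `&` chart_dom q) => //; split => //; exact: dom_self.
Qed.

Lemma smooth_cst (W : normedModType R) U (a : W) : smooth_fun U (fun=> a).
Proof. by move=> c k; exact: Cdiff_cst. Qed.

Lemma smoothD (W : normedModType R) U (f g : M -> W) : open U ->
  smooth_fun U f -> smooth_fun U g -> smooth_fun U (fun q => f q + g q).
Proof.
move=> oU sf sg c k.
exact: (CdiffD (@open_chart_image c _ oU) (sf c k) (sg c k)).
Qed.

Lemma smoothM U (f g : M -> R) : open U ->
  smooth_fun U f -> smooth_fun U g -> smooth_fun U (fun q => f q * g q : R).
Proof.
move=> oU sf sg c k.
exact: (CdiffM (@open_chart_image c _ oU) (sf c k) (sg c k)).
Qed.

Lemma smooth_sum (W : normedModType R) U m (f : 'I_m -> M -> W) : open U ->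
  (forall i, smooth_fun U (f i)) -> smooth_fun U (fun q => \sum_i f i q).
Proof.
move=> oU sf c k.
exact: (Cdiff_sum (@open_chart_image c _ oU) (fun i => sf i c k)).
Qed.

Lemma smooth_entry (a b : nat) U (f : M -> 'M[R]_(a, b)) i j : open U ->
  smooth_fun U f -> smooth_fun U (fun q => f q i j : R).
Proof.
move=> oU sf c k.
exact: (Cdiff_entry i j (@open_chart_image c _ oU) (sf c k)).
Qed.

Lemma smooth_row (m : nat) U (f : M -> 'rV[R]_m) : open U ->
  (forall j, smooth_fun U (fun q => f q 0 j : R)) -> smooth_fun U f.
Proof.
move=> oU sf c k.
exact: (Cdiff_row (@open_chart_image c _ oU) (fun j => sf j c k)).
Qed.

Lemma smooth_of_chart c U (h : 'rV[R]_n -> R) : open U ->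
  smooth_on (chart c @` (chart_dom c `&` U)) h ->
  smooth_fun (U `&` chart_dom c) (fun q => h (chart c q)).
Proof.
move=> oU sh p k.
have oI := @open_chart_image p _ (openI oU (@dom_open _ _ _ c)).
apply: (@Cdiff_comp _ _ n k _ (chart c @` (chart_dom c `&` U))
  (chart c \o chart_inv p)) (sh k) => //.
  by move=> _ [q [pq [Uq cq]] <-]; rewrite /= chartK //; exists q.
apply: Cdiff_sub (transition_smooth p c k).
by move=> _ [q [pq [Uq cq]] <-]; exists q.
Qed.

Definition mdiff (W : normedModType R) (f : M -> W) p :=
  differentiable (f \o chart_inv p) (chart p p).

Lemma smooth_differentiable (W : normedModType R) U (f : M -> W) c q : U q ->
  chart_dom c q -> smooth_fun U f -> differentiable (f \o chart_inv c) (chart c q).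
Proof. by move=> Uq cq /(_ c 1)[df _]; apply: df; exists q. Qed.

Lemma smooth_mdiff (W : normedModType R) U (f : M -> W) p : U p ->
  smooth_fun U f -> mdiff f p.
Proof. by move=> Up; apply: smooth_differentiable Up (dom_self p). Qed.

Lemma near_deriv_along (W : normedModType R) (f g : M -> W) p :
  (\forall q \near p, f q = g q) -> mdiff f p ->
  mdiff g p /\ deriv_along g p = deriv_along f p :> (_ -> _).
Proof.
move=> fg df; apply: near_is_diff df.
by apply: filterS (near_chart (dom_self p) fg) => y [].
Qed.

Lemma deriv_along_ext (W : normedModType R) (f g : M -> W) p U u :
  open U -> U p -> (forall q, U q -> f q = g q) -> mdiff f p ->
  deriv_along f p u = deriv_along g p u.
Proof.
move=> oU Up fg df.
have nfg : \forall q \near p, f q = g q.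
  by apply: filterS (open_nbhs_nbhs (conj oU Up)) => q /fg.
by have [_ ->] := near_deriv_along nfg df.
Qed.

Lemma deriv_along_cst (W : normedModType R) (a : W) p u :
  deriv_along (fun=> a) p u = 0.
Proof.
rewrite /deriv_along (_ : _ \o _ = cst a) ?diff_cst //.
Qed.

Lemma deriv_alongP (W : normedModType R) (f : M -> W) p a u v :
  deriv_along f p (a *: u + v) = a *: deriv_along f p u + deriv_along f p v.
Proof. exact: linearP. Qed.

Lemma mdiff_cst (W : normedModType R) (a : W) p : mdiff (fun=> a) p.
Proof. exact: differentiable_cst. Qed.

Lemma mdiffD (f g : M -> R) p : mdiff f p -> mdiff g p ->
  mdiff (fun q => f q + g q) p.
Proof. exact: differentiableD. Qed.

Lemma deriv_alongD (f g : M -> R) p u : mdiff f p -> mdiff g p ->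
  deriv_along (fun q => f q + g q) p u = deriv_along f p u + deriv_along g p u.
Proof.
move=> df dg; have E := diffD df dg.
exact: (congr1 (fun h => h u) E).
Qed.

Lemma mdiffM (f g : M -> R) p : mdiff f p -> mdiff g p ->
  mdiff (fun q => f q * g q : R) p.
Proof. exact: differentiableM. Qed.

Lemma deriv_alongM (f g : M -> R) p u : mdiff f p -> mdiff g p ->
  deriv_along (fun q => f q * g q : R) p u =
  deriv_along f p u * g p + f p * deriv_along g p u.
Proof.
move=> df dg; have pK := chartK (dom_self p).
have -> : deriv_along (fun q => f q * g q : R) p u =
    'd ((f \o chart_inv p : _ -> R) * (g \o chart_inv p)) (chart p p) u by [].
rewrite (diffM df dg) /deriv_along.
set df' := 'd _ _; set dg' := 'd _ _.
have -> : (f \o chart_inv p) (chart p p) = f p by rewrite /= pK.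
have -> : (g \o chart_inv p) (chart p p) = g p by rewrite /= pK.
by rewrite addrC mulrC.
Qed.

Lemma mdiff_sum m (f : 'I_m -> M -> R) p : (forall i, mdiff (f i) p) ->
  mdiff (fun q => \sum_i f i q) p.
Proof.
move=> df; rewrite /mdiff.
have -> : (fun q => \sum_i f i q) \o chart_inv p =
    \sum_i (f i \o chart_inv p) by apply/funext => y; rewrite fct_sumE.
exact: differentiable_sum.
Qed.

Lemma deriv_along_sum m (f : 'I_m -> M -> R) p u : (forall i, mdiff (f i) p) ->
  deriv_along (fun q => \sum_i f i q) p u = \sum_i deriv_along (f i) p u.
Proof.
elim: m f => [|m IH] f df.
  rewrite big_ord0; under [X in deriv_along X]eq_fun do rewrite big_ord0.
  exact: deriv_along_cst.
under [X in deriv_along X]eq_fun do rewrite big_ord_recl.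
rewrite big_ord_recl -IH // deriv_alongD //.
exact: mdiff_sum.
Qed.

Lemma deriv_along_entry (a b : nat) (f : M -> 'M[R]_(a, b)) p u i j : mdiff f p ->
  deriv_along (fun q => f q i j : R) p u = (deriv_along f p u) i j.
Proof. by move=> df; have [_] := diff_entry u i j df. Qed.

Lemma mdiff_row (m : nat) (f : M -> 'rV[R]_m) p :
  (forall j, mdiff (fun q => f q 0 j : R) p) -> mdiff f p.
Proof. exact: differentiable_row. Qed.

(** Entrywise, so that the product rule [deriv_mxM], for matrices of any sizes, reduces
    to that for scalar functions. *)
Definition deriv_mx (a b : nat) :=
  locked_with matrix_key (fun (A : M -> 'M[R]_(a, b)) p u =>
    \matrix_(i, j) deriv_along (fun q => A q i j : R) p u : 'M[R]_(a, b)).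

Lemma deriv_mxE (a b : nat) (A : M -> 'M[R]_(a, b)) p u i j :
  deriv_mx A p u i j = deriv_along (fun q => A q i j : R) p u.
Proof. by rewrite /deriv_mx unlock mxE. Qed.

Definition mdiff_mx (a b : nat) (A : M -> 'M[R]_(a, b)) p :=
  forall i j, mdiff (fun q => A q i j : R) p.

Lemma deriv_along_row (m : nat) (f : M -> 'rV[R]_m) p u : mdiff_mx f p ->
  deriv_along f p u = deriv_mx f p u.
Proof.
move=> df; apply/rowP => j; rewrite (deriv_mxE, mxE) deriv_along_entry //.
exact/mdiff_row/df.
Qed.

Lemma mdiff_mxM (a b d : nat) (A : M -> 'M[R]_(a, b)) (B : M -> 'M[R]_(b, d)) p :
  mdiff_mx A p -> mdiff_mx B p -> mdiff_mx (fun q => A q *m B q) p.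
Proof.
move=> dA dB i j; rewrite (_ : (fun q => _) = fun q => \sum_k A q i k * B q k j).
  by apply: mdiff_sum => k; apply: mdiffM.
by apply/funext => q; rewrite mxE.
Qed.

Lemma deriv_mxM (a b d : nat) (A : M -> 'M[R]_(a, b)) (B : M -> 'M[R]_(b, d)) p u :
  mdiff_mx A p -> mdiff_mx B p ->
  deriv_mx (fun q => A q *m B q) p u =
  deriv_mx A p u *m B p + A p *m deriv_mx B p u.
Proof.
move=> dA dB; apply/matrixP => i j; rewrite !(deriv_mxE, mxE).
rewrite (_ : (fun q => _) = fun q => \sum_k A q i k * B q k j); last first.
  by apply/funext => q; rewrite mxE.
rewrite deriv_along_sum => [|k]; last exact: mdiffM.
rewrite -big_split /=; apply: eq_bigr => k _.
by rewrite deriv_alongM // !(deriv_mxE, mxE).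
Qed.

Lemma deriv_mx_ext (a b : nat) (A B : M -> 'M[R]_(a, b)) p U u :
  open U -> U p -> (forall q, U q -> A q = B q) -> mdiff_mx A p ->
  deriv_mx A p u = deriv_mx B p u.
Proof.
move=> oU Up AB dA; apply/matrixP => i j; rewrite !(deriv_mxE, mxE).
by apply: (deriv_along_ext _ oU Up) => // q Uq; rewrite AB.
Qed.

Lemma deriv_mx_cst (a b : nat) (A : 'M[R]_(a, b)) p u :
  deriv_mx (fun=> A) p u = 0.
Proof. by apply/matrixP => i j; rewrite !(deriv_mxE, mxE) deriv_along_cst. Qed.

Lemma mdiff_mx_cst (a b : nat) (A : 'M[R]_(a, b)) p : mdiff_mx (fun=> A) p.
Proof. by move=> i j; exact: mdiff_cst. Qed.

Definition smooth_mx (a b : nat) U (A : M -> 'M[R]_(a, b)) :=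
  forall i j, smooth_fun U (fun q => A q i j : R).

Lemma smooth_mdiff_mx (a b : nat) U (A : M -> 'M[R]_(a, b)) p : U p ->
  smooth_mx U A -> mdiff_mx A p.
Proof. by move=> Up sA i j; exact: smooth_mdiff Up (sA i j). Qed.

Lemma smooth_mxM (a b d : nat) U (A : M -> 'M[R]_(a, b)) (B : M -> 'M[R]_(b, d)) :
  open U -> smooth_mx U A -> smooth_mx U B -> smooth_mx U (fun q => A q *m B q).
Proof.
move=> oU sA sB i j.
apply: (smooth_fun_ext oU (f := fun q => \sum_k A q i k * B q k j)).
  by move=> q _; rewrite mxE.
by apply: smooth_sum => // k; exact: smoothM.
Qed.

Lemma smooth_mx_inv (a : nat) U (A : M -> 'M[R]_a) : open U ->
  (forall q, U q -> A q \in unitmx) -> smooth_mx U A ->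
  smooth_mx U (fun q => invmx (A q)).
Proof.
move=> oU uA sA i j c k.
apply: (@Cdiff_invmx _ _ k _ a (A \o chart_inv c)); first exact: open_chart_image.
  by move=> _ [q [cq Uq] <-] /=; rewrite chartK // uA.
by move=> i' j'; exact: sA.
Qed.

Lemma smooth_mx_ext (a b : nat) U (A B : M -> 'M[R]_(a, b)) : open U ->
  (forall q, U q -> A q = B q) -> smooth_mx U A -> smooth_mx U B.
Proof.
by move=> oU AB sA i j; apply: (smooth_fun_ext oU _ (sA i j)) => q Uq; rewrite AB.
Qed.

Lemma smooth_mx_row (m : nat) U (f : M -> 'rV[R]_m) : open U ->
  smooth_mx U f -> smooth_fun U f.
Proof. by move=> oU sf; apply: smooth_row => // j; exact: sf. Qed.

Lemma row_smooth_mx (m : nat) U (f : M -> 'rV[R]_m) : open U ->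
  smooth_fun U f -> smooth_mx U f.
Proof. by move=> oU sf i j; exact: smooth_entry. Qed.

End ChartCalculus.

(** * Chain rule, coordinate fields and brackets *)

Section ChainRule.
Variables (R : realType) (n m : nat) (M : manifold R n) (Q : manifold R m).

(** The target chart [c] is arbitrary: for [F] the identity this is the change of
    chart, and for [c = F p] the chain rule for [tangent_map]. *)
Lemma deriv_along_comp (W : normedModType R) (F : M -> Q) (f : Q -> W) p c u :
  {for p, continuous F} -> chart_dom c (F p) ->
  differentiable (chart c \o F \o chart_inv p) (chart p p) ->
  differentiable (f \o chart_inv c) (chart c (F p)) ->
  mdiff (f \o F) p /\
  deriv_along (f \o F) p u =
    'd (f \o chart_inv c) (chart c (F p))
      (u *m 'J (chart c \o F \o chart_inv p) (chart p p)).
Proof.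
move=> cF cp dF df.
set F' := chart c \o F \o chart_inv p; set f' := f \o chart_inv c.
have pK : F' (chart p p) = chart c (F p).
  by rewrite /F' /= chartK //; exact: dom_self.
have E : \forall y \near chart p p, (f' \o F') y = ((f \o F) \o chart_inv p) y.
  have nd : nbhs p (F @^-1` chart_dom c).
    by apply: cF; exact: open_nbhs_nbhs (conj (@dom_open _ _ _ c) cp).
  apply: filterS (near_chart (dom_self p) nd) => y [_ _ Fc].
  by rewrite /f' /F' /= chartK.
rewrite -pK in df.
have [d1 d2] := near_is_diff E (differentiable_comp dF df).
split => //; rewrite /deriv_along d2 (diff_comp dF df) mul_jacobian -pK.
by [].
Qed.

End ChainRule.

Section ChartChange.
Variables (R : realType) (n : nat) (M : manifold R n).
Implicit Types (p q c : M) (U : set M).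

Lemma deriv_along_chart (W : normedModType R) (f : M -> W) c p u :
  chart_dom c p -> differentiable (f \o chart_inv c) (chart c p) ->
  mdiff f p /\
  deriv_along f p u = 'd (f \o chart_inv c) (chart c p) (u *m to_chart c p).
Proof.
move=> cp df; apply: (@deriv_along_comp _ _ _ _ _ _ (id : M -> M) f p c u _ cp _ df).
  exact: cvg_id.
have [d _] := transition_smooth p c 1.
by apply: d; exists p => //; split => //; exact: dom_self.
Qed.

Lemma mdiff_chart c p : chart_dom c p -> mdiff (chart c) p.
Proof.
move=> cp; have [d _] := transition_smooth p c 1.
by apply: d; exists p => //; split => //; exact: dom_self.
Qed.

Lemma deriv_chart c p u : deriv_along (chart c) p u = u *m to_chart c p.
Proof. by rewrite mul_jacobian. Qed.

Lemma of_chart_differentiable c p : chart_dom c p ->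
  differentiable (chart p \o chart_inv c) (chart c p).
Proof.
move=> cp; have [d _] := transition_smooth c p 1.
by apply: d; exists p => //; split => //; exact: dom_self.
Qed.

Lemma to_chart_self p : to_chart p p = 1%:M.
Proof.
apply/row_matrixP => i; rewrite !rowE mulmx1 mul_jacobian.
have E : \forall y \near chart p p, id y = (chart p \o chart_inv p) y.
  by apply: filterS (near_chart (dom_self p) (@filterT _ (nbhs p) _)) => y [].
have did := is_diff_id (chart p p).
have dd : differentiable (id : 'rV[R]_n -> 'rV[R]_n) (chart p p) by exact: ex_diff.
have [_ ->] := near_is_diff E dd.
by rewrite (@diff_val _ _ _ _ _ _ _ did).
Qed.

Lemma of_chart_self p : of_chart p p = 1%:M.
Proof. exact: to_chart_self. Qed.

Lemma to_chartK c p : chart_dom c p -> to_chart c p *m of_chart c p = 1%:M.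
Proof.
move=> cp; apply/row_matrixP => i.
rewrite !rowE mulmxA mulmx1 mul_jacobian.
have [_ <-] := deriv_along_chart (delta_mx 0 i) cp (of_chart_differentiable cp).
by rewrite deriv_chart to_chart_self mulmx1.
Qed.

Lemma of_chartK c p : chart_dom c p -> of_chart c p *m to_chart c p = 1%:M.
Proof. by move=> /to_chartK /mulmx1C. Qed.

Lemma coord_field_self p u : coord_field p u p = u.
Proof. by rewrite /coord_field of_chart_self mulmx1. Qed.

Lemma smooth_fieldP U (X : M -> 'rV[R]_n) : open U ->
  smooth_field U X <-> forall c, smooth_mx (U `&` chart_dom c) (fun q => X q *m to_chart c q).
Proof.
move=> oU; split => sX c.
  apply: row_smooth_mx; first exact: openI oU (@dom_open _ _ _ c).
  exact: sX.
apply: smooth_mx_row; first exact: openI oU (@dom_open _ _ _ c).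
exact: sX.
Qed.

Lemma smooth_transition c d : smooth_mx (chart_dom c `&` chart_dom d)
  (fun q => of_chart c q *m to_chart d q).
Proof.
move=> i j; rewrite setIC.
pose h y := 'd (chart d \o chart_inv c) y (delta_mx 0 i) 0 j : R.
apply: (smooth_fun_ext (f := fun q => h (chart c q))).
- exact: openI (@dom_open _ _ _ d) (@dom_open _ _ _ c).
- move=> q [dq cq]; rewrite /h.
  have dd : differentiable (chart d \o chart_inv c) (chart c q).
    have [H _] := transition_smooth c d 1.
    by apply: H; exists q.
  have [_ E] := deriv_along_chart (row i (of_chart c q)) cq dd.
  have -> : delta_mx 0 i = row i (of_chart c q) *m to_chart c q :> 'rV_n.
    by rewrite -row_mul of_chartK // row1.
  by rewrite -E deriv_chart -row_mul mxE.
- apply: smooth_of_chart; first exact: (@dom_open _ _ _ d).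
  move=> k; apply: (@Cdiff_entry _ _ 1 n k _
    (fun y => 'd (chart d \o chart_inv c) y (delta_mx 0 i))).
    exact: open_chart_image (@dom_open _ _ _ d).
  by have [_ H] := transition_smooth c d k.+1; exact: H.
Qed.

Lemma smooth_coord_field c u : smooth_field (chart_dom c) (coord_field c u).
Proof.
apply/smooth_fieldP => [|d]; first exact: (@dom_open _ _ _ c).
have oI := openI (@dom_open _ _ _ c) (@dom_open _ _ _ d).
apply: (smooth_mx_ext (A := fun q => u *m (of_chart c q *m to_chart d q)) oI).
  by move=> q _; rewrite mulmxA.
apply: smooth_mxM => //; last exact: smooth_transition.
by move=> i j; exact: smooth_cst.
Qed.

Lemma deriv_coord_field (f : M -> R) U c q v : U q -> chart_dom c q ->
  smooth_fun U f ->
  deriv_along f q (coord_field c v q) = 'd (f \o chart_inv c) (chart c q) v.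
Proof.
move=> Uq cq sf.
have [_ ->] := deriv_along_chart (coord_field c v q) cq (smooth_differentiable Uq cq sf).
by rewrite /coord_field -mulmxA of_chartK // mulmx1.
Qed.

Lemma smooth_deriv_coord (f : M -> R) U c v : open U -> smooth_fun U f ->
  smooth_fun (U `&` chart_dom c) (fun q => deriv_along f q (coord_field c v q)).
Proof.
move=> oU sf.
have oI := openI oU (@dom_open _ _ _ c).
apply: (smooth_fun_ext (f := fun q => 'd (f \o chart_inv c) (chart c q) v) oI).
  by move=> q [Uq cq]; rewrite (deriv_coord_field _ Uq cq sf).
apply: (smooth_of_chart (h := fun y => 'd (f \o chart_inv c) y v)) => // k.
by have [_ H] := sf c k.+1; exact: H.
Qed.

(** The components of a vector at [q] refer to the chart preferred at [q], which
    need not depend continuously on [q]. Smoothness in [q] becomes visible only in a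
    fixed chart [c]. *)
Lemma deriv_along_coords (f : M -> R) U c q u : U q -> chart_dom c q ->
  smooth_fun U f ->
  deriv_along f q u = \sum_j (u *m to_chart c q) 0 j *
    deriv_along f q (coord_field c (delta_mx 0 j) q).
Proof.
move=> Uq cq sf.
have [_ ->] := deriv_along_chart u cq (smooth_differentiable Uq cq sf).
rewrite diff_row_basis; apply: eq_bigr => j _.
by rewrite (deriv_coord_field _ Uq cq sf).
Qed.

Lemma smooth_deriv U (f : M -> R) (X : M -> 'rV[R]_n) : open U ->
  smooth_fun U f -> smooth_field U X ->
  smooth_fun U (fun q => deriv_along f q (X q)).
Proof.
move=> oU sf /(smooth_fieldP _ oU) sX; apply: smooth_fun_dom => c.
have oI := openI oU (@dom_open _ _ _ c).
apply: (smooth_fun_ext (f := fun q => \sum_j (X q *m to_chart c q) 0 j *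
    deriv_along f q (coord_field c (delta_mx 0 j) q)) oI).
  by move=> q [Uq cq]; rewrite -(deriv_along_coords _ Uq cq sf).
apply: smooth_sum => // j; apply: smoothM => //; first exact: sX.
exact: smooth_deriv_coord.
Qed.

Lemma second_deriv_coord (f : M -> R) U p v w : open U -> U p -> smooth_fun U f ->
  deriv_along (fun q => deriv_along f q (coord_field p v q)) p w =
  'd (fun y => 'd (f \o chart_inv p) y v : R) (chart p p) w.
Proof.
move=> oU Up sf.
pose h y := 'd (f \o chart_inv p) y v : R.
pose k q := deriv_along f q (coord_field p v q).
have E : \forall y \near chart p p, h y = (k \o chart_inv p) y.
  apply: filterS (near_chart (dom_self p) (open_nbhs_nbhs (conj oU Up))) => y [py yK Uy].
  by rewrite /k /= (deriv_coord_field _ Uy py sf) yK.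
have dd : differentiable h (chart p p).
  have [_ /(_ v)[H _]] := sf p 2.
  by apply: H; exists p => //; split => //; exact: dom_self.
have [_ E2] := near_is_diff E dd.
exact: (congr1 (fun h => h w) E2).
Qed.

(** In the chart at [p] the terms with second derivatives of [f] cancel by the
    symmetry of the Hessian. *)
Lemma deriv_bracket U (f : M -> R) (X Y : M -> 'rV[R]_n) p : open U -> U p ->
  smooth_fun U f -> smooth_field U X -> smooth_field U Y ->
  deriv_along (fun q => deriv_along f q (Y q)) p (X p) -
  deriv_along (fun q => deriv_along f q (X q)) p (Y p) =
  deriv_along f p (bracket X Y p).
Proof.
move=> oU Up sf sX sY.
have oI := openI oU (@dom_open _ _ _ p).
have Ip : (U `&` chart_dom p) p by split => //; exact: dom_self.
pose D v w := deriv_along (fun q => deriv_along f q (coord_field p v q)) p w.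
pose g j q := deriv_along f q (coord_field p (delta_mx 0 j) q).
have second Z W : smooth_field U Z -> smooth_field U W ->
    deriv_along (fun q => deriv_along f q (W q)) p (Z p) =
    deriv_along f p (deriv_along (fun q => W q *m to_chart p q) p (Z p)) + D (W p) (Z p).
  move=> sZ sW; have := sW; move/(smooth_fieldP _ oU)/(_ p) => sWp.
  have dW := smooth_mdiff_mx Ip sWp.
  have dg j : mdiff (g j) p by exact: smooth_mdiff Ip (smooth_deriv_coord _ _ oU sf).
  rewrite -(deriv_along_ext (f := fun q => \sum_j (W q *m to_chart p q) 0 j * g j q) _ oI Ip).
  - rewrite deriv_along_sum => [|j]; last exact: mdiffM (dW 0 j) (dg j).
    under eq_bigr => j _ do rewrite (deriv_alongM _ (dW 0 j) (dg j)).
    rewrite big_split /=; congr (_ + _).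
      rewrite [RHS](deriv_along_coords _ Up (dom_self p) sf).
      apply: eq_bigr => j _; congr (_ * _).
      by rewrite to_chart_self mulmx1 deriv_along_row // (deriv_mxE, mxE).
    rewrite /D (_ : (fun q => _) = fun q => \sum_j (W p) 0 j * g j q); last first.
      apply/funext => q; rewrite /g /coord_field {1}(row_sum_delta (W p)).
      rewrite mulmx_suml /deriv_along linear_sum; apply: eq_bigr => j _.
      by rewrite -scalemxAl linearZ.
    have dc j : mdiff (fun=> W p 0 j) p by exact: mdiff_cst.
    rewrite deriv_along_sum => [|j]; last exact: mdiffM (dc j) (dg j).
    apply: eq_bigr => j _; rewrite (deriv_alongM _ (dc j) (dg j)).
    by rewrite deriv_along_cst mul0r add0r to_chart_self mulmx1.
  - by move=> q [Uq pq]; rewrite /g -(deriv_along_coords _ Uq pq sf).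
  - by apply: mdiff_sum => j; exact: mdiffM (dW 0 j) (dg j).
rewrite (second _ _ sX sY) (second _ _ sY sX) /bracket.
have DC : D (Y p) (X p) = D (X p) (Y p).
  rewrite /D !(second_deriv_coord _ _ oU Up sf).
  apply: (schwarz (U := chart p @` (chart_dom p `&` U))) => //.
  - exact: open_chart_image.
  - by exists p => //; split => //; exact: dom_self.
rewrite DC opprD addrACA subrr addr0 /deriv_along -linearB //.
Qed.

End ChartChange.

(** * Vector-valued 1-forms *)

Section SmoothMaps.
Variables (R : realType) (n m : nat) (M : manifold R n) (Q : manifold R m).
Variables (F : M -> Q) (sF : smooth_map F).
Implicit Types (p q : M) (U : set M).

Lemma smooth_map_differentiable p c : chart_dom c (F p) ->
  differentiable (chart c \o F \o chart_inv p) (chart p p).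
Proof.
move=> cp; have [_ /(_ p c 1)[d _]] := sF; apply: d.
by exists p => //; split => //; exact: dom_self.
Qed.

Lemma deriv_along_pull (W : normedModType R) (f : Q -> W) p u : mdiff f (F p) ->
  mdiff (f \o F) p /\
  deriv_along (f \o F) p u = deriv_along f (F p) (u *m tangent_map F p).
Proof.
move=> df; apply: deriv_along_comp (dom_self _) _ df; first by case: sF => + _; apply.
exact: smooth_map_differentiable (dom_self _).
Qed.

Lemma tangent_map_to_chart p c u : chart_dom c (F p) ->
  u *m tangent_map F p *m to_chart c (F p) = deriv_along (chart c \o F) p u.
Proof.
by move=> cp; rewrite -deriv_chart; have [_ ->] := deriv_along_pull u (mdiff_chart cp).
Qed.

Lemma open_preimage (U : set Q) : open U -> open (F @^-1` U).
Proof. by case: sF => /continuousP + _; apply. Qed.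

Lemma smooth_pull (U : set Q) (f : Q -> R) : open U -> smooth_fun U f ->
  smooth_fun (F @^-1` U) (f \o F).
Proof.
move=> oU sf p k; apply: Cdiff_local => _ [q [pq Uq] <-].
pose c := F q; have oUc := openI oU (@dom_open _ _ _ c).
have oI := open_preimage oUc.
exists (chart p @` (chart_dom p `&` F @^-1` (U `&` chart_dom c))).
  by exists q => //; split => //; split => //; exact: dom_self.
apply: (Cdiff_ext (f := (f \o chart_inv c) \o (chart c \o F \o chart_inv p))).
- exact: open_chart_image.
- by move=> _ [r [pr [Ur cr]] <-]; rewrite /= !chartK.
- apply: (Cdiff_comp _ _ _ (sf c k)).
  + exact: open_chart_image.
  + by move=> _ [r [pr [Ur cr]] <-]; rewrite /= chartK //; exists (F r).
  + have [_ /(_ p c k)] := sF; apply: Cdiff_sub.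
    by move=> _ [r [pr [Ur cr]] <-]; exists r.
Qed.

Lemma smooth_chart_pull c j :
  smooth_fun (F @^-1` chart_dom c) (fun q => chart c (F q) 0 j : R).
Proof.
move=> p k; have [_ /(_ p c k) H] := sF.
apply: (Cdiff_entry 0 j _ H).
exact: open_chart_image (open_preimage (@dom_open _ _ _ c)).
Qed.

Lemma smooth_push U (X : M -> 'rV[R]_n) : open U -> smooth_field U X ->
  smooth_along F U (push F X).
Proof.
move=> oU sX c.
have oI := openI oU (open_preimage (@dom_open _ _ _ c)).
apply: smooth_mx_row => // i j; rewrite (ord1 i) {i}.
apply: (smooth_fun_ext (f := fun q => deriv_along (fun r => chart c (F r) 0 j : R) q (X q)) oI).
  move=> q [Uq cq]; rewrite /push tangent_map_to_chart // deriv_along_entry //.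
  exact: smooth_map_differentiable.
apply: smooth_deriv => //.
  by apply: smooth_fun_sub (smooth_chart_pull c j) => q [].
by move=> d; apply: smooth_fun_sub (sX d) => q [[]].
Qed.

End SmoothMaps.

Section Forms.
Variables (R : realType) (n k : nat) (M : manifold R n).
Implicit Types (p q c : M) (U : set M).

(** The matrix [Phi q], acting on components with respect to the chart at [q],
    is the value at [q] of an [R^k]-valued 1-form. *)
Definition smooth_form (Phi : M -> 'M[R]_(n, k)) :=
  forall c, smooth_mx (chart_dom c) (fun q => of_chart c q *m Phi q).

Lemma smooth_field_sub U U' (X : M -> 'rV[R]_n) : U' `<=` U ->
  smooth_field U X -> smooth_field U' X.
Proof.
by move=> sU sX c; apply: smooth_fun_sub (sX c) => q [/sU].
Qed.

Lemma smooth_form_field Phi U X : open U -> smooth_form Phi ->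
  smooth_field U X -> smooth_mx U (fun q => X q *m Phi q).
Proof.
move=> oU sP /(smooth_fieldP _ oU) sX i j; apply: smooth_fun_dom => c.
have oI := openI oU (@dom_open _ _ _ c).
suff H : smooth_mx (U `&` chart_dom c) (fun q => X q *m Phi q) by exact: H.
apply: (smooth_mx_ext (A := fun q => X q *m to_chart c q *m (of_chart c q *m Phi q)) oI).
  by move=> q [_ cq]; rewrite mulmxA -(mulmxA _ (to_chart c q)) to_chartK // mulmx1.
apply: smooth_mxM => // i' j'.
by apply: smooth_fun_sub (sP c i' j') => q [].
Qed.

(** The exterior derivative at [p], evaluated on two coordinate fields of the chart
    at [p]: their bracket vanishes, so it does not occur. *)
Definition ext_deriv :=
  locked_with matrix_key (fun (Phi : M -> 'M[R]_(n, k)) p (x y : 'rV[R]_n) =>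
    deriv_mx (fun q => coord_field p y q *m Phi q) p x -
    deriv_mx (fun q => coord_field p x q *m Phi q) p y).

Lemma ext_deriv_def Phi p x y : ext_deriv Phi p x y =
  deriv_mx (fun q => coord_field p y q *m Phi q) p x -
  deriv_mx (fun q => coord_field p x q *m Phi q) p y.
Proof. by rewrite /ext_deriv unlock. Qed.

Lemma deriv_coord_form Phi p x y : smooth_form Phi ->
  deriv_mx (fun q => coord_field p y q *m Phi q) p x =
  y *m deriv_mx (fun q => of_chart p q *m Phi q) p x.
Proof.
move=> sP; rewrite -[RHS]add0r -[in RHS](mul0mx _ (of_chart p p *m Phi p)).
rewrite -(deriv_mx_cst y p x) -deriv_mxM.
- by congr (deriv_mx _ _ _); apply/funext => q; rewrite mulmxA.
- exact: mdiff_mx_cst.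
- by apply: smooth_mdiff_mx (sP p); exact: dom_self.
Qed.

Lemma ext_derivE Phi p x y : smooth_form Phi ->
  ext_deriv Phi p x y = y *m deriv_mx (fun q => of_chart p q *m Phi q) p x -
                        x *m deriv_mx (fun q => of_chart p q *m Phi q) p y.
Proof. by move=> sP; rewrite ext_deriv_def !deriv_coord_form. Qed.

Lemma deriv_mxP (a b : nat) (A : M -> 'M[R]_(a, b)) p s u v :
  deriv_mx A p (s *: u + v) = s *: deriv_mx A p u + deriv_mx A p v.
Proof. by apply/matrixP => i j; rewrite !(deriv_mxE, mxE) deriv_alongP. Qed.

Lemma ext_derivPl Phi p s x x' y : smooth_form Phi ->
  ext_deriv Phi p (s *: x + x') y = s *: ext_deriv Phi p x y + ext_deriv Phi p x' y.
Proof.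
move=> sP; rewrite !ext_derivE // deriv_mxP mulmxDl mulmxDr -scalemxAr -scalemxAl.
by rewrite scalerBr opprD addrACA.
Qed.

Lemma ext_derivC Phi p x y : ext_deriv Phi p y x = - ext_deriv Phi p x y.
Proof. by rewrite !ext_deriv_def opprB. Qed.

Lemma deriv_field_form Phi U Y p u : open U -> U p -> smooth_form Phi ->
  smooth_field U Y ->
  deriv_mx (fun q => Y q *m Phi q) p u =
  deriv_mx (fun q => Y q *m to_chart p q) p u *m Phi p +
  Y p *m deriv_mx (fun q => of_chart p q *m Phi q) p u.
Proof.
move=> oU Up sP sY.
have oI := openI oU (@dom_open _ _ _ p).
have Ip : (U `&` chart_dom p) p by split => //; exact: dom_self.
have dY : mdiff_mx (fun q => Y q *m to_chart p q) p.
  exact: smooth_mdiff_mx Ip ((iffLR (smooth_fieldP _ oU) sY) p).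
have dP : mdiff_mx (fun q => of_chart p q *m Phi q) p.
  exact: smooth_mdiff_mx (dom_self p) (sP p).
rewrite -(deriv_mx_ext (A := fun q => Y q *m to_chart p q *m (of_chart p q *m Phi q)) _ oI Ip).
- by rewrite deriv_mxM // of_chart_self to_chart_self mul1mx mulmx1.
- by move=> q [_ cq]; rewrite mulmxA -(mulmxA _ (to_chart p q)) to_chartK // mulmx1.
- exact: mdiff_mxM.
Qed.

(** Cartan's formula for the exterior derivative. In the chart at [p] the derivatives
    of the components of [X] and [Y] make up the bracket and those of [Phi] make up
    [ext_deriv]. *)
Lemma cartan Phi U X Y p : open U -> U p -> smooth_form Phi ->
  smooth_field U X -> smooth_field U Y ->
  deriv_mx (fun q => Y q *m Phi q) p (X p) - deriv_mx (fun q => X q *m Phi q) p (Y p)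
  = bracket X Y p *m Phi p + ext_deriv Phi p (X p) (Y p).
Proof.
move=> oU Up sP sX sY; rewrite !(deriv_field_form _ oU Up sP) // ext_derivE //.
have Ip : (U `&` chart_dom p) p by split => //; exact: dom_self.
have dY Z : smooth_field U Z -> mdiff_mx (fun q => Z q *m to_chart p q) p.
  by move=> sZ; exact: smooth_mdiff_mx Ip ((iffLR (smooth_fieldP _ oU) sZ) p).
rewrite /bracket mulmxBl !deriv_along_row; [|exact: dY..].
by rewrite opprD addrACA.
Qed.

Lemma bracket_coord_field p x y : bracket (coord_field p x) (coord_field p y) p = 0.
Proof.
have cst v u : deriv_along (fun q => coord_field p v q *m to_chart p q) p u = 0.
  rewrite -(deriv_along_cst v p u); apply: esym.
  apply: (deriv_along_ext _ (@dom_open _ _ _ p) (dom_self p)).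
    by move=> q pq; rewrite /coord_field -mulmxA of_chartK // mulmx1.
  exact: mdiff_cst.
by rewrite /bracket !cst subrr.
Qed.

End Forms.

Section PullbackForms.
Variables (R : realType) (n m k : nat) (M : manifold R n) (Q : manifold R m).
Variables (F : M -> Q) (sF : smooth_map F).
Implicit Types (p q : M) (U : set M).

Lemma smooth_along_form (Phi : Q -> 'M[R]_(m, k)) U V : open U ->
  smooth_form Phi -> smooth_along F U V -> smooth_mx U (fun q => V q *m Phi (F q)).
Proof.
move=> oU sP sV i j; apply: smooth_fun_local => q Uq; pose c := F q.
have oI := openI oU (open_preimage sF (@dom_open _ _ _ c)).
exists (U `&` F @^-1` chart_dom c); first by split => //; exact: dom_self.
suff H : smooth_mx (U `&` F @^-1` chart_dom c) (fun q => V q *m Phi (F q)) by exact: H.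
apply: (smooth_mx_ext (A := fun q =>
  V q *m to_chart c (F q) *m (of_chart c (F q) *m Phi (F q))) oI).
  by move=> r [_ cr]; rewrite mulmxA -(mulmxA _ (to_chart c _)) to_chartK // mulmx1.
apply: smooth_mxM => //; first exact: row_smooth_mx (sV c).
move=> i' j'.
apply: smooth_fun_sub (smooth_pull sF (@dom_open _ _ _ c) (sP c i' j')) => r [] //.
Qed.

Definition pull_form (Phi : Q -> 'M[R]_(m, k)) : M -> 'M[R]_(n, k) :=
  fun q => tangent_map F q *m Phi (F q).

Lemma smooth_pull_form (Phi : Q -> 'M[R]_(m, k)) : smooth_form Phi ->
  smooth_form (pull_form Phi).
Proof.
move=> sP c i j; have oc := @dom_open _ _ _ c.
have := smooth_along_form oc sP (smooth_push sF oc (smooth_coord_field c (delta_mx 0 i))).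
move=> /(_ 0 j); apply: smooth_fun_ext => // q _.
rewrite /push /coord_field /pull_form -!mulmxA.
by rewrite -rowE mxE.
Qed.

Lemma deriv_mx_pull (a b : nat) (A : Q -> 'M[R]_(a, b)) p u : mdiff_mx A (F p) ->
  mdiff_mx (fun q => A (F q)) p /\
  deriv_mx (fun q => A (F q)) p u = deriv_mx A (F p) (u *m tangent_map F p).
Proof.
move=> dA; split=> [i j|].
  by have [] := deriv_along_pull sF 0 (dA i j).
by apply/matrixP => i j; rewrite !(deriv_mxE, mxE); have [_ <-] := deriv_along_pull sF u (dA i j).
Qed.

(** The second derivatives of [F] in charts are symmetric and cancel. *)
Lemma ext_deriv_pull (Phi : Q -> 'M[R]_(m, k)) p x y : smooth_form Phi ->
  ext_deriv (pull_form Phi) p x y =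
  ext_deriv Phi (F p) (x *m tangent_map F p) (y *m tangent_map F p).
Proof.
move=> sP; pose c := F p; rewrite (ext_derivE _ _ _ sP) ext_deriv_def.
have oc := open_preimage sF (@dom_open _ _ _ c).
have cp : (F @^-1` chart_dom c) p by exact: dom_self.
pose G z q : 'rV[R]_m := \row_j deriv_along (fun r => chart c (F r) 0 j : R) q (coord_field p z q).
have oI := openI oc (@dom_open _ _ _ p).
have Ip : (F @^-1` chart_dom c `&` chart_dom p) p by split => //; exact: dom_self.
have sc j : smooth_fun (F @^-1` chart_dom c `&` chart_dom p) (fun q => chart c (F q) 0 j : R).
  by apply: smooth_fun_sub (smooth_chart_pull sF c j) => q [].
have sfield z : smooth_field (F @^-1` chart_dom c `&` chart_dom p) (coord_field p z).
  by apply: smooth_field_sub (smooth_coord_field p z) => q [].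
have GE z q : chart_dom c (F q) -> G z q = coord_field p z q *m tangent_map F q *m to_chart c (F q).
  move=> cq; rewrite tangent_map_to_chart //; apply/rowP => j; rewrite mxE.
  by rewrite deriv_along_entry //; exact: smooth_map_differentiable.
have sG z : smooth_mx (F @^-1` chart_dom c `&` chart_dom p) (G z).
  move=> i j; apply: (smooth_fun_ext oI _ (smooth_deriv oI (sc j) (sfield z))).
  by move=> q _; rewrite mxE.
have dG z := smooth_mdiff_mx Ip (sG z).
have dP : mdiff_mx (fun x => of_chart c x *m Phi x) (F p).
  exact: smooth_mdiff_mx (dom_self _) (sP c).
have [dPF _] := deriv_mx_pull 0 dP.
have E z w : deriv_mx (fun q => coord_field p z q *m pull_form Phi q) p w =
    deriv_mx (G z) p w *m Phi (F p) +
    z *m tangent_map F p *m deriv_mx (fun x => of_chart c x *m Phi x) (F p) (w *m tangent_map F p).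
  rewrite -(deriv_mx_ext (A := fun q => G z q *m (of_chart c (F q) *m Phi (F q))) _ oI Ip).
  - rewrite deriv_mxM // of_chart_self mul1mx GE // to_chart_self mulmx1 coord_field_self.
    by have [_ ->] := deriv_mx_pull w dP.
  - move=> q [cq _]; rewrite GE // /pull_form !mulmxA -(mulmxA _ (to_chart c _)) to_chartK //.
    by rewrite mulmx1.
  - exact: mdiff_mxM.
rewrite !E opprD addrACA -mulmxBl.
suff -> : deriv_mx (G y) p x = deriv_mx (G x) p y by rewrite subrr mul0mx add0r.
apply/eqP; rewrite -subr_eq0; apply/eqP/rowP => j; rewrite !(deriv_mxE, mxE).
have := deriv_bracket oI Ip (sc j) (sfield x) (sfield y).
rewrite !coord_field_self bracket_coord_field => H.
have gE z : (fun q => G z q 0 j) =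
    fun q => deriv_along (fun r => chart c (F r) 0 j : R) q (coord_field p z q).
  by apply/funext => q; rewrite mxE.
by rewrite !gE H /deriv_along linear0.
Qed.

(** A formula for the covariant derivatives of coordinate fields in the
    trivialization [Phi] carries over to sections along [F]. The matrix [T] makes room
    for formulas that only hold after projection, as in Gauss's formula for the
    sphere; [G] is the difference to the derivative of the components. *)
Lemma pullback_conn_form (l : nat) (Phi : Q -> 'M[R]_(m, k)) (T : 'M[R]_(k, l))
    (nabla : covder Q) (G : 'rV[R]_m -> 'rV[R]_m -> 'rV[R]_l) U p u V :
  open U -> U p -> smooth_form Phi -> smooth_along F U V ->
  (forall w v, nabla (F p) w (coord_field (F p) v) *m Phi (F p) *m T =
     deriv_mx (fun x => coord_field (F p) v x *m Phi x) (F p) w *m T + G w v) ->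
  pullback_conn nabla F p u V *m Phi (F p) *m T =
  deriv_mx (fun q => V q *m Phi (F q)) p u *m T + G (u *m tangent_map F p) (V p).
Proof.
move=> oU Up sP sV nP; pose c := F p.
have oI := openI oU (open_preimage sF (@dom_open _ _ _ c)).
have Ip : (U `&` F @^-1` chart_dom c) p by split => //; exact: dom_self.
have dV := smooth_mdiff_mx Ip (row_smooth_mx oI (sV c)).
have dP : mdiff_mx (fun x => of_chart c x *m Phi x) (F p).
  exact: smooth_mdiff_mx (dom_self _) (sP c).
have [dPF EP] := deriv_mx_pull u dP.
rewrite /pullback_conn !mulmxDl nP addrA; congr (_ + _).
rewrite -(deriv_mx_ext (A := fun q =>
  V q *m to_chart c (F q) *m (of_chart c (F q) *m Phi (F q))) _ oI Ip).
- rewrite [in RHS](deriv_mxM _ dV dPF) EP of_chart_self to_chart_self mul1mx mulmx1 mulmxDl.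
  by rewrite deriv_coord_form // deriv_along_row.
- by move=> r [_ cr]; rewrite mulmxA -(mulmxA _ (to_chart c _)) to_chartK // mulmx1.
- exact: mdiff_mxM.
Qed.

End PullbackForms.

(** * The Koszul argument *)

Section DotDeriv.
Variables (R : realType) (n : nat) (M : manifold R n) (k : nat).

Lemma mdiff_dot (a b : M -> 'rV[R]_k) p : mdiff_mx a p -> mdiff_mx b p ->
  mdiff (fun q => dot (a q) (b q) : R) p.
Proof. by move=> da db; apply: mdiff_sum => i; exact: mdiffM. Qed.

Lemma deriv_dot (a b : M -> 'rV[R]_k) p u : mdiff_mx a p -> mdiff_mx b p ->
  deriv_along (fun q => dot (a q) (b q) : R) p u =
  dot (deriv_mx a p u) (b p) + dot (a p) (deriv_mx b p u).
Proof.
move=> da db; rewrite /dot deriv_along_sum => [|i]; last exact: mdiffM.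
rewrite -big_split; apply: eq_bigr => i _.
by rewrite deriv_alongM // !(deriv_mxE, mxE).
Qed.

End DotDeriv.

Section Koszul.
Variables (R : realType) (n k : nat) (M : manifold R n).
Variables (g : metric M) (nabla : covder M) (Phi : M -> 'M[R]_(n, k)).
Hypothesis sPhi : smooth_form Phi.
Hypothesis gE : forall p u v, g p u v = dot (u *m Phi p) (v *m Phi p).
Hypothesis lc : levi_civita g nabla.

(** The expression on the left, as a function of three vector fields through [x], [Y]
    and [z], is symmetric in the first two because the torsion vanishes, and skew in
    the last two because the connection is metric; hence it vanishes. The correction
    by half the exterior derivative restores the symmetry when [Phi] is not closed,
    and is itself skew in the last two arguments by assumption. *)
Lemma koszul U Y p x z : open U -> U p -> smooth_field U Y ->
  (forall x y z, dot (ext_deriv Phi p x y) (z *m Phi p) =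
                 - dot (ext_deriv Phi p x z) (y *m Phi p)) ->
  dot (nabla p x Y *m Phi p - deriv_mx (fun q => Y q *m Phi q) p x +
       2^-1 *: ext_deriv Phi p x (Y p)) (z *m Phi p) = 0.
Proof.
move=> oU Up sY skew.
have oI := openI oU (@dom_open _ _ _ p).
have Ip : (U `&` chart_dom p) p by split => //; exact: dom_self.
pose B (X Y Z : M -> 'rV[R]_n) :=
  dot (nabla p (X p) Y *m Phi p - deriv_mx (fun q => Y q *m Phi q) p (X p) +
       2^-1 *: ext_deriv Phi p (X p) (Y p)) (Z p *m Phi p).
have Bsym X Y' Z : smooth_field (U `&` chart_dom p) X ->
    smooth_field (U `&` chart_dom p) Y' -> B X Y' Z = B Y' X Z.
  move=> sX sY'; rewrite /B; congr dot.
  have C := cartan oI Ip sPhi sX sY'.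
  have := lc_torsion_free lc oI sX sY' Ip.
  rewrite /torsion /covf => /eqP; rewrite subr_eq0 => /eqP T.
  apply/eqP; rewrite -subr_eq0; apply/eqP.
  rewrite (ext_derivC _ _ (X p)) scalerN.
  move: C; rewrite -T mulmxBl => /eqP; rewrite subr_eq => /eqP ->.
  set a := nabla p (X p) Y' *m Phi p; set b := nabla p (Y' p) X *m Phi p.
  set d := deriv_mx _ p (Y' p); set e := ext_deriv _ _ _ _.
  clearbody a b d e; apply/rowP => i; rewrite !mxE; lra.
have Banti X Y' Z : smooth_field (U `&` chart_dom p) X ->
    smooth_field (U `&` chart_dom p) Y' -> smooth_field (U `&` chart_dom p) Z ->
    B X Y' Z = - B X Z Y'.
  move=> sX sY' sZ.
  have dP V : smooth_field (U `&` chart_dom p) V -> mdiff_mx (fun q => V q *m Phi q) p.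
    by move=> sV; exact: smooth_mdiff_mx Ip (smooth_form_field oI sPhi sV).
  have := lc_metric lc (X p) oI sY' sZ Ip.
  rewrite (_ : (fun q => g q (Y' q) (Z q)) =
      fun q => dot (Y' q *m Phi q) (Z q *m Phi q)); last first.
    by apply/funext => q; rewrite gE.
  rewrite (deriv_dot _ (dP _ sY') (dP _ sZ)) !gE /B.
  have S := skew (X p) (Y' p) (Z p).
  move: S; set e := ext_deriv _ _ _ _; set e' := ext_deriv _ _ _ _.
  set y := Y' p *m _; set z' := Z p *m _; set dy := deriv_mx _ _ _.
  set dz := deriv_mx _ _ _; set ny := _ *m Phi p; set nz := _ *m Phi p.
  clearbody e e' y z' dy dz ny nz => S E.
  rewrite !dotDl !dotNl !dotZl S; rewrite (dotC y) (dotC y nz) in E.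
  by rewrite mulrN; lra.
have sC v : smooth_field (U `&` chart_dom p) (coord_field p v).
  by apply: smooth_field_sub (smooth_coord_field p v) => q [].
have {}sY : smooth_field (U `&` chart_dom p) Y by apply: smooth_field_sub sY => q [].
have : B (coord_field p x) Y (coord_field p z) = - B (coord_field p x) Y (coord_field p z).
  rewrite [LHS]Banti // Bsym // Banti // opprK Bsym // Banti //; congr (- _).
  by rewrite Bsym.
rewrite /B !coord_field_self => E.
by move: E; set t := dot _ _ => E; lra.
Qed.

End Koszul.

(** * Connections and linear combinations of fields *)

Section ConnectionSum.
Variables (R : realType) (n : nat) (M : manifold R n).
Implicit Types (U : set M).

Lemma smooth_fieldZ U (f : M -> R) (X : M -> 'rV[R]_n) : open U ->
  smooth_fun U f -> smooth_field U X -> smooth_field U (fun q => f q *: X q).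
Proof.
move=> oU sf /(smooth_fieldP _ oU) sX; apply/(smooth_fieldP _ oU) => c i j.
have oI := openI oU (@dom_open _ _ _ c).
apply: (smooth_fun_ext (f := fun q => f q * (X q *m to_chart c q) i j) oI).
  by move=> q _; rewrite -scalemxAl [RHS]mxE.
by apply: smoothM => //; [apply: smooth_fun_sub sf => q []|exact: sX].
Qed.

Lemma smooth_fieldD U (X Y : M -> 'rV[R]_n) : open U ->
  smooth_field U X -> smooth_field U Y -> smooth_field U (fun q => X q + Y q).
Proof.
move=> oU /(smooth_fieldP _ oU) sX /(smooth_fieldP _ oU) sY.
apply/(smooth_fieldP _ oU) => c i j.
have oI := openI oU (@dom_open _ _ _ c).
apply: (smooth_fun_ext (f := fun q => (X q *m to_chart c q) i j + (Y q *m to_chart c q) i j) oI).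
  by move=> q _; rewrite mulmxDl [RHS]mxE.
by apply: smoothD => //; [exact: sX|exact: sY].
Qed.

Lemma smooth_field0 U : open U -> smooth_field U (fun=> 0 : 'rV[R]_n).
Proof.
move=> oU; apply/(smooth_fieldP _ oU) => c i j.
have oI := openI oU (@dom_open _ _ _ c).
apply: (smooth_fun_ext (f := fun=> 0) oI); last exact: smooth_cst.
by move=> q _; rewrite mul0mx mxE.
Qed.

Lemma smooth_fieldB U (X Y : M -> 'rV[R]_n) : open U ->
  smooth_field U X -> smooth_field U Y -> smooth_field U (fun q => X q - Y q).
Proof.
move=> oU sX sY; apply: smooth_fieldD => //.
rewrite (_ : (fun q => - Y q) = fun q => (-1 : R) *: Y q).
  by apply: smooth_fieldZ => //; exact: smooth_cst.
by apply/funext => q; rewrite scaleN1r.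
Qed.

Lemma smooth_field_comb U m (f : 'I_m -> M -> R) (E : 'I_m -> M -> 'rV[R]_n) :
  open U -> (forall i, smooth_fun U (f i)) -> (forall i, smooth_field U (E i)) ->
  smooth_field U (fun q => \sum_i f i q *: E i q).
Proof.
move=> oU; elim: m f E => [|m IH] f E sf sE.
  rewrite (_ : (fun q => _) = fun=> 0); first exact: smooth_field0.
  by apply/funext => q; rewrite big_ord0.
rewrite (_ : (fun q => _) = fun q => f ord0 q *: E ord0 q +
   \sum_i (f \o lift ord0) i q *: (E \o lift ord0) i q).
  apply: smooth_fieldD => //; first exact: smooth_fieldZ.
  by apply: IH => i; [exact: sf|exact: sE].
by apply/funext => q; rewrite big_ord_recl.
Qed.

Lemma conn_comb (nabla : covder M) U p u m (f : 'I_m -> M -> R)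
    (E : 'I_m -> M -> 'rV[R]_n) : is_connection nabla ->
  open U -> U p -> (forall i, smooth_fun U (f i)) -> (forall i, smooth_field U (E i)) ->
  nabla p u (fun q => \sum_i f i q *: E i q) =
  \sum_i (deriv_along (f i) p u *: E i p + f i p *: nabla p u (E i)).
Proof.
move=> cn oU Up; elim: m f E => [|m IH] f E sf sE.
  rewrite big_ord0 (_ : (fun q => _) = fun q => (0 : R) *: (0 : 'rV[R]_n)); last first.
    by apply/funext => q; rewrite big_ord0 scale0r.
  rewrite (conn_leibniz cn (f := fun=> 0) _ oU Up); last exact: smooth_field0.
    by rewrite deriv_along_cst !scale0r addr0.
  exact: smooth_cst.
rewrite (_ : (fun q => _) = fun q => f ord0 q *: E ord0 q +
   \sum_i (f \o lift ord0) i q *: (E \o lift ord0) i q); last first.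
  by apply/funext => q; rewrite big_ord_recl.
rewrite (conn_additive cn _ oU Up).
- rewrite big_ord_recl; congr (_ + _); first exact: (conn_leibniz cn _ oU Up (sf ord0) (sE ord0)).
  by rewrite IH // => i; [exact: sf|exact: sE].
- exact: smooth_fieldZ.
- by apply: smooth_field_comb => // i; [exact: sf|exact: sE].
Qed.

Lemma smooth_chart (c : M) j : smooth_fun (chart_dom c) (fun q => chart c q 0 j : R).
Proof.
rewrite -[chart_dom c]setTI.
apply: (smooth_of_chart (h := fun y : 'rV[R]_n => y 0 j : R)) => [|k].
  exact: openT.
exact: Cdiff_coord.
Qed.

(** The components of the bracket in a fixed chart are the derivatives along it of the
    coordinate functions, hence commutators of derivatives. *)
Lemma smooth_bracket U (X Y : M -> 'rV[R]_n) : open U -> smooth_field U X ->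
  smooth_field U Y -> smooth_field U (bracket X Y).
Proof.
move=> oU sX sY; apply/(smooth_fieldP _ oU) => c i j; rewrite (ord1 i) {i}.
have oI := openI oU (@dom_open _ _ _ c).
have sc : smooth_fun (U `&` chart_dom c) (fun q => chart c q 0 j : R).
  by apply: smooth_fun_sub (smooth_chart c j) => q [].
have {}sX : smooth_field (U `&` chart_dom c) X by apply: smooth_field_sub sX => q [].
have {}sY : smooth_field (U `&` chart_dom c) Y by apply: smooth_field_sub sY => q [].
have sD := smooth_deriv oI (smooth_deriv oI sc sY) sX.
have sD' := smooth_deriv oI (smooth_deriv oI sc sX) sY.
have := smoothD oI sD (smoothM oI (smooth_cst _ (-1 : R)) sD').
apply: smooth_fun_ext => // q Iq; have [_ cq] := Iq.
rewrite mulN1r (deriv_bracket oI Iq sc sX sY) deriv_along_entry ?deriv_chart //.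
exact: mdiff_chart.
Qed.

End ConnectionSum.

(** * The torsion of a Weitzenböck manifold *)

Section WeitzenbockTorsion.
Variables (R : realType) (m : nat) (Mt : weitzenbock R m).
Implicit Types (p q : Mt) (U : set Mt) (a b c : 'rV[R]_m).

Definition coframe (q : Mt) : 'M[R]_m := invmx (frame_mx q).

Lemma frame_unit q : frame_mx q \in unitmx.
Proof. exact: frame_basis. Qed.

Lemma frameK q : frame_mx q *m coframe q = 1%:M.
Proof. by rewrite mulmxV // frame_unit. Qed.

Lemma coframeK q : coframe q *m frame_mx q = 1%:M.
Proof. by rewrite mulVmx // frame_unit. Qed.

(** In the chart [c] it is the inverse of the matrix of components of the frame. *)
Lemma smooth_coframe : smooth_form coframe.
Proof.
move=> c; have oc := @dom_open _ _ _ c.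
pose T q := frame_mx q *m to_chart c q.
have TK q : chart_dom c q -> T q *m (of_chart c q *m coframe q) = 1%:M.
  by move=> cq; rewrite /T -mulmxA (mulmxA (to_chart c q)) to_chartK // mul1mx frameK.
have uT q : chart_dom c q -> T q \in unitmx by move=> /TK /mulmx1_unit [].
apply: (smooth_mx_ext (A := fun q => invmx (T q)) oc).
  by move=> q cq; rewrite -[LHS]mulmx1 -(TK q cq) mulKmx // uT.
apply: smooth_mx_inv => // i j.
have sF : smooth_mx (setT `&` chart_dom c) (fun q => frame i q *m to_chart c q).
  exact: (iffLR (smooth_fieldP _ openT) (@frame_smooth _ _ Mt i)).
move: (sF 0 j); rewrite setTI; apply: smooth_fun_ext => // q _.
by rewrite /T /frame_mx -[RHS]mulr1 -(rowK (fun i => frame i q)) -row_mul mxE mulr1.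
Qed.

Lemma coframe_inj q (u v : 'rV[R]_m) : u *m coframe q = v *m coframe q -> u = v.
Proof.
by move=> E; rewrite -[u]mulmx1 -[v]mulmx1 -(coframeK q) !mulmxA E.
Qed.

Lemma row_frame i q : row i (frame_mx q) = frame i q.
Proof. exact: rowK. Qed.

Lemma frame_coframe i q : frame i q *m coframe q = delta_mx 0 i.
Proof. by rewrite -row_frame -row_mul frameK row1. Qed.

(** Leibniz's rule applied to the expansion of [Y] in the frame. *)
Lemma wz_connE U Y p u : open U -> U p -> smooth_field U Y ->
  wz_conn p u Y *m coframe p = deriv_mx (fun q => Y q *m coframe q) p u.
Proof.
move=> oU Up sY; have sy := smooth_form_field oU smooth_coframe sY.
have -> : wz_conn p u Y = wz_conn p u
    (fun q => \sum_a (Y q *m coframe q) 0 a *: frame a q).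
  congr (wz_conn p u _); apply/funext => q.
  rewrite -[LHS]mulmx1 -(coframeK q) mulmxA mulmx_sum_row.
  by apply: eq_bigr => a _; rewrite row_frame.
have sF i : smooth_field U (frame i : Mt -> _).
  by apply: smooth_field_sub (@frame_smooth _ _ Mt i).
rewrite (conn_comb _ (wz_connection Mt) oU Up (sy 0) sF).
rewrite (eq_bigr (fun i => deriv_mx (fun q => Y q *m coframe q) p u 0 i *: frame i p)).
  rewrite -[RHS]mulmx1 -(frameK p) mulmxA (mulmx_sum_row _ (frame_mx p)).
  by congr (_ *m _); apply: eq_bigr => i _; rewrite row_frame.
by move=> a _; rewrite wz_frame_parallel scaler0 addr0 (deriv_mxE, mxE).
Qed.

(** Cartan's first structure equation, for a parallel frame. *)
Lemma wz_torsionE U X Y p : open U -> U p -> smooth_field U X -> smooth_field U Y ->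
  wz_torsion X Y p *m coframe p = ext_deriv coframe p (X p) (Y p).
Proof.
move=> oU Up sX sY; rewrite /wz_torsion /torsion /covf mulmxBl mulmxBl.
rewrite (wz_connE _ oU Up sX) (wz_connE _ oU Up sY).
by rewrite (cartan oU Up smooth_coframe sX sY) addrC addKr.
Qed.

(** The torsion tensor as a product on coefficient vectors: on the frame it is given by
    the structure functions, up to sign. *)
Definition structure := locked_with matrix_key (fun p a b =>
  ext_deriv coframe p (a *m frame_mx p) (b *m frame_mx p)).

Lemma structure_def p a b :
  structure p a b = ext_deriv coframe p (a *m frame_mx p) (b *m frame_mx p).
Proof. by rewrite /structure unlock. Qed.

Lemma ext_deriv_structure p x y :
  ext_deriv coframe p x y = structure p (x *m coframe p) (y *m coframe p).
Proof. by rewrite structure_def -!mulmxA coframeK !mulmx1. Qed.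

Lemma structureC p a b : structure p a b = - structure p b a.
Proof. by rewrite !structure_def ext_derivC. Qed.

Lemma structurePl p s a a' b :
  structure p (s *: a + a') b = s *: structure p a b + structure p a' b.
Proof.
by rewrite !structure_def mulmxDl -scalemxAl ext_derivPl //; exact: smooth_coframe.
Qed.

Lemma structureDl p a a' b : structure p (a + a') b = structure p a b + structure p a' b.
Proof. by rewrite -[a]scale1r structurePl !scale1r. Qed.

Lemma structure0l p b : structure p 0 b = 0.
Proof.
have := structureDl p 0 0 b; rewrite addr0 => E.
by apply: (addrI (structure p 0 b)); rewrite -E addr0.
Qed.

Lemma structure0r p a : structure p a 0 = 0.
Proof. by rewrite structureC structure0l oppr0. Qed.

Lemma structureZl p s a b : structure p (s *: a) b = s *: structure p a b.
Proof. by rewrite -[s *: a]addr0 structurePl structure0l addr0. Qed.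

Lemma structureNl p a b : structure p (- a) b = - structure p a b.
Proof. by rewrite -scaleN1r structureZl scaleN1r. Qed.

Lemma structureDr p a b b' : structure p a (b + b') = structure p a b + structure p a b'.
Proof. by rewrite !(structureC p a) structureDl opprD. Qed.

Lemma structureZr p s a b : structure p a (s *: b) = s *: structure p a b.
Proof. by rewrite !(structureC p a) structureZl scalerN. Qed.

Lemma structureNr p a b : structure p a (- b) = - structure p a b.
Proof. by rewrite !(structureC p a) structureNl. Qed.

Lemma structure_suml p k (f : 'I_k -> 'rV[R]_m) b :
  structure p (\sum_i f i) b = \sum_i structure p (f i) b.
Proof.
by elim/big_rec2: _ => [|i y1 y2 _ IH]; rewrite ?structure0l // structureDl IH.
Qed.

Lemma structure_sumr p k (f : 'I_k -> 'rV[R]_m) a :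
  structure p a (\sum_i f i) = \sum_i structure p a (f i).
Proof.
by rewrite structureC structure_suml -sumrN; apply: eq_bigr => i _; rewrite structureC opprK.
Qed.

Lemma structure_basis p a b : structure p a b =
  \sum_i \sum_j (a 0 i * b 0 j) *: ext_deriv coframe p (frame i p) (frame j p).
Proof.
rewrite {1}(row_sum_delta a) structure_suml; apply: eq_bigr => i _.
rewrite {1}(row_sum_delta b) structure_sumr; apply: eq_bigr => j _.
rewrite structureZl structureZr scalerA; congr (_ *: _).
by rewrite ext_deriv_structure !frame_coframe.
Qed.

Hypothesis torsion_par : parallel_torsion Mt.

(** This is the parallelism of the torsion, applied to two members of the frame: their
    own derivatives vanish. *)
Lemma deriv_structure_const i j p u :
  mdiff_mx (fun q => ext_deriv coframe q (frame i q) (frame j q)) p /\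
  deriv_mx (fun q => ext_deriv coframe q (frame i q) (frame j q)) p u = 0.
Proof.
have oT := @openT Mt.
have sF i' : smooth_field setT (frame i' : Mt -> _) by exact: (@frame_smooth _ _ Mt).
have sc i' j' : smooth_field setT (covf wz_conn (frame i') (frame j' : Mt -> _)).
  exact: (conn_smooth (wz_connection Mt)).
have sT : smooth_field setT (wz_torsion (frame i) (frame j : Mt -> _)).
  apply: smooth_fieldB => //; last exact: smooth_bracket.
  by apply: smooth_fieldB.
have E : (fun q => ext_deriv coframe q (frame i q) (frame j q)) =
    fun q => wz_torsion (frame i) (frame j) q *m coframe q.
  by apply/funext => q; rewrite (wz_torsionE oT I (sF i) (sF j)).
rewrite E; split.
  exact: (@smooth_mdiff_mx _ _ _ _ _ setT _ _ I (smooth_form_field oT smooth_coframe sT)).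
rewrite -(wz_connE _ oT I sT).
have op := @dom_open _ _ _ p.
have sF' i' : smooth_field (chart_dom p) (frame i' : Mt -> _).
  exact: smooth_field_sub (sF i').
have := torsion_par op (dom_self p) (smooth_coord_field p u) (sF' i) (sF' j).
rewrite coord_field_self => ->.
have c0 i' : covf wz_conn (coord_field p u) (frame i' : Mt -> _) = fun=> 0.
  by apply/funext => q; rewrite /covf wz_frame_parallel.
rewrite !c0 mulmxDl (wz_torsionE op (dom_self p) (smooth_field0 op) (sF' j)).
rewrite (wz_torsionE op (dom_self p) (sF' i) (smooth_field0 op)).
rewrite !ext_deriv_structure !mul0mx structure0l structureC structure0l oppr0.
by rewrite addr0.
Qed.

Lemma mdiff_structure k (N : manifold R k) (F : N -> Mt) (a b : N -> 'rV[R]_m) (p : N) :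
  smooth_map F -> mdiff_mx a p -> mdiff_mx b p ->
  mdiff_mx (fun r => structure (F r) (a r) (b r)) p.
Proof.
move=> sF da db i' l.
have -> : (fun r => structure (F r) (a r) (b r) i' l) = fun r => \sum_i \sum_j
    (a r 0 i * b r 0 j) * ext_deriv coframe (F r) (frame i (F r)) (frame j (F r)) 0 l.
  apply/funext => r; rewrite structure_basis (ord1 i') summxE; apply: eq_bigr => i _.
  by rewrite summxE; apply: eq_bigr => j _; rewrite mxE.
apply: mdiff_sum => i; apply: mdiff_sum => j; apply: mdiffM; first exact: mdiffM.
have [dk _] := deriv_structure_const i j (F p) 0.
by have [+ _] := deriv_mx_pull sF 0 dk; apply.
Qed.

(** The components of a parallel torsion are locally constant, so only the arguments
    contribute. *)
Lemma deriv_structure k (N : manifold R k) (F : N -> Mt) (a b : N -> 'rV[R]_m) (p : N) u :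
  smooth_map F -> mdiff_mx a p -> mdiff_mx b p ->
  deriv_mx (fun r => structure (F r) (a r) (b r)) p u =
  structure (F p) (deriv_mx a p u) (b p) + structure (F p) (a p) (deriv_mx b p u).
Proof.
move=> sF da db.
apply/rowP => l; rewrite (deriv_mxE, mxE) [RHS](deriv_mxE, mxE).
pose kk i j r := ext_deriv coframe (F r) (frame i (F r)) (frame j (F r)) 0 l.
have sE a' b' r : structure (F r) a' b' 0 l = \sum_i \sum_j (a' 0 i * b' 0 j) * kk i j r.
  rewrite structure_basis summxE; apply: eq_bigr => i _.
  by rewrite summxE; apply: eq_bigr => j _; rewrite mxE.
have -> : (fun r => structure (F r) (a r) (b r) 0 l) = fun r => \sum_i \sum_j
    (a r 0 i * b r 0 j) * kk i j r.
  by apply/funext => r; exact: sE.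
have dk i j : mdiff (kk i j) p /\ deriv_along (kk i j) p u = 0.
  have [dk Ek] := deriv_structure_const i j (F p) (u *m tangent_map F p).
  have [d1 E1] := deriv_mx_pull sF u dk; split; first exact: d1.
  by move: E1; rewrite Ek => /matrixP/(_ 0 l); rewrite !(deriv_mxE, mxE).
have dab i j : mdiff (fun r => a r 0 i * b r 0 j : R) p by exact: mdiffM.
have dabk i j : mdiff (fun r => (a r 0 i * b r 0 j) * kk i j r : R) p.
  by apply: mdiffM => //; have [] := dk i j.
rewrite deriv_along_sum => [|i]; last exact: mdiff_sum.
rewrite !sE -big_split; apply: eq_bigr => i _.
rewrite deriv_along_sum // -big_split; apply: eq_bigr => j _.
have [dkij Ekij] := dk i j.
rewrite (deriv_alongM _ (dab i j) dkij) Ekij mulr0 addr0 deriv_alongM //.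
by rewrite mulrDl !(deriv_mxE, mxE).
Qed.

Hypothesis torsion_skew : skew_torsion Mt.

Lemma structure_skew p a b : dot a (structure p a b) = 0.
Proof.
pose x := a *m frame_mx p; pose y := b *m frame_mx p.
have op := @dom_open _ _ _ p.
have [+ _ _] := torsion_skew op (dom_self p) (smooth_coord_field p x) (smooth_coord_field p y).
rewrite /wz_metric /coords -/(coframe p).
rewrite (wz_torsionE op (dom_self p) (smooth_coord_field p x) (smooth_coord_field p y)).
by rewrite !coord_field_self ext_deriv_structure /x /y -!mulmxA frameK !mulmx1.
Qed.

Lemma structure_skew12 p a b c : dot a (structure p b c) = - dot b (structure p a c).
Proof.
have := structure_skew p (a + b) c.
rewrite structureDl dotDl !dotDr !structure_skew add0r addr0 addrC => /eqP.
by rewrite addr_eq0 => /eqP ->; rewrite opprK.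
Qed.

Lemma structure_skew13 p a b c : dot a (structure p b c) = - dot c (structure p b a).
Proof.
by rewrite structureC dotNr structure_skew12 structureC dotNr !opprK.
Qed.

Lemma structure_alt p a b : structure p a a = 0 /\ dot b (structure p a b) = 0.
Proof.
split; last by rewrite structureC dotNr structure_skew oppr0.
apply: dot_eq0; set c := structure p a a.
by rewrite {2}/c structure_skew13 structure_skew oppr0.
Qed.

End WeitzenbockTorsion.

(** * The ambient Levi-Civita connection and its Ricci curvature *)

Section DerivMx.
Variables (R : realType) (n : nat) (M : manifold R n) (a b : nat).
Implicit Types (U : set M) (A B : M -> 'M[R]_(a, b)) (p : M).

Lemma smooth_id : smooth_map (id : M -> M).
Proof. by split; [move=> p; exact: cvg_id|move=> p c; exact: transition_smooth]. Qed.

Lemma deriv_mxD A B p u : mdiff_mx A p -> mdiff_mx B p ->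
  deriv_mx (fun q => A q + B q) p u = deriv_mx A p u + deriv_mx B p u.
Proof.
move=> dA dB; apply/matrixP => i j; rewrite deriv_mxE [RHS]mxE !deriv_mxE.
rewrite -(deriv_alongD _ (dA i j) (dB i j)).
rewrite (_ : (fun q => _) = fun q => A q i j + B q i j) //.
by apply/funext => q; rewrite mxE.
Qed.

Lemma deriv_mxZ s A p u : mdiff_mx A p ->
  deriv_mx (fun q => s *: A q) p u = s *: deriv_mx A p u.
Proof.
move=> dA; apply/matrixP => i j; rewrite deriv_mxE [RHS]mxE deriv_mxE.
rewrite (_ : (fun q => _) = fun q => s * A q i j); last first.
  by apply/funext => q; rewrite mxE.
by rewrite (deriv_alongM _ (mdiff_cst s p) (dA i j)) deriv_along_cst mul0r add0r.
Qed.

Lemma mdiff_mxZ s A p : mdiff_mx A p -> mdiff_mx (fun q => s *: A q) p.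
Proof.
move=> dA i j; rewrite (_ : (fun q => _) = fun q => s * A q i j).
  by apply: mdiffM => //; exact: mdiff_cst.
by apply/funext => q; rewrite mxE.
Qed.

Lemma smooth_deriv_mx U A X : open U -> smooth_mx U A -> smooth_field U X ->
  smooth_mx U (fun q => deriv_mx A q (X q)).
Proof.
move=> oU sA sX i j; apply: (smooth_fun_ext oU _ (smooth_deriv oU (sA i j) sX)).
by move=> q _; rewrite deriv_mxE.
Qed.

Lemma deriv_mx_bracket U A X Y p : open U -> U p -> smooth_mx U A ->
  smooth_field U X -> smooth_field U Y ->
  deriv_mx (fun q => deriv_mx A q (Y q)) p (X p) -
  deriv_mx (fun q => deriv_mx A q (X q)) p (Y p) = deriv_mx A p (bracket X Y p).
Proof.
move=> oU Up sA sX sY; apply/matrixP => i j; rewrite mxE [in X in _ + X]mxE !deriv_mxE.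
rewrite -(deriv_bracket oU Up (sA i j) sX sY).
have E Z : (fun q => deriv_mx A q (Z q) i j) =
    fun q => deriv_along (fun r => A r i j : R) q (Z q).
  by apply/funext => q; rewrite deriv_mxE.
by rewrite !E.
Qed.

End DerivMx.

Section LeviCivitaWeitzenbock.
Variables (R : realType) (m : nat) (Mt : weitzenbock R m).
Hypothesis torsion_par : parallel_torsion Mt.
Hypothesis torsion_skew : skew_torsion Mt.
Variables (nabla : covder Mt) (lc : levi_civita (wz_metric Mt) nabla).
Implicit Types (p q : Mt) (U : set Mt).
Local Notation S := structure.

(** Half of the torsion separates the two ambient connections, by [koszul] for the
    coframe. *)
Lemma lc_wzE U Y p x : open U -> U p -> smooth_field U Y ->
  nabla p x Y *m coframe p = deriv_mx (fun q => Y q *m coframe q) p x -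
    2^-1 *: structure p (x *m coframe p) (Y p *m coframe p).
Proof.
move=> oU Up sY; apply/eqP; rewrite -subr_eq0 opprB addrA; apply/eqP.
rewrite addrAC -ext_deriv_structure; apply: dot_eq0.
set v := (X in dot X X).
rewrite -{2}[v]mulmx1 -(frameK p) mulmxA /v {v}.
apply: (koszul (@smooth_coframe _ _ Mt) _ lc _ _ oU Up sY) => // x' y' z'.
rewrite !ext_deriv_structure dotC (structure_skew13 torsion_skew).
rewrite (dotC _ (y' *m _)) structureC dotNr opprK.
by rewrite (structure_skew12 torsion_skew) structureC dotNr opprK.
Qed.

(** The second derivatives of the components of [Z] combine to the derivative along
    the bracket; what remains is algebraic because [structure] is differentiated by
    [deriv_structure]. *)
Lemma lc_curvatureE U X Y Z p : open U -> U p -> smooth_field U X ->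
  smooth_field U Y -> smooth_field U Z ->
  let x := X p *m coframe p in let y := Y p *m coframe p in
  let z := Z p *m coframe p in
  curvature nabla X Y Z p *m coframe p =
  - (2^-1 *: structure p (structure p x y) z) +
  4^-1 *: structure p x (structure p y z) - 4^-1 *: structure p y (structure p x z).
Proof.
move=> oU Up sX sY sZ x y z.
have sc V : smooth_field U V -> smooth_mx U (fun q => V q *m coframe q).
  by move=> sV; exact: smooth_form_field oU (@smooth_coframe _ _ Mt) sV.
have dc V : smooth_field U V -> mdiff_mx (fun q => V q *m coframe q) p.
  by move=> sV; exact: smooth_mdiff_mx Up (sc V sV).
have sC V W : smooth_field U V -> smooth_field U W -> smooth_field U (covf nabla V W).
  by move=> sV sW; exact: (conn_smooth (lc_connection lc) oU sV sW).
have covE V W : smooth_field U V -> smooth_field U W ->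
  covf nabla V (covf nabla W Z) p *m coframe p =
  deriv_mx (fun q => deriv_mx (fun r => Z r *m coframe r) q (W q)) p (V p) -
  2^-1 *: (structure p (deriv_mx (fun q => W q *m coframe q) p (V p)) z +
    structure p (W p *m coframe p) (deriv_mx (fun q => Z q *m coframe q) p (V p))) -
  2^-1 *: structure p (V p *m coframe p)
    (deriv_mx (fun q => Z q *m coframe q) p (W p) -
     2^-1 *: structure p (W p *m coframe p) z).
  move=> sV sW; rewrite {1}/covf (lc_wzE _ oU Up (sC _ _ sW sZ)) /covf.
  rewrite (lc_wzE _ oU Up sZ); congr (_ - _).
  rewrite -(deriv_mx_ext (A := fun q => deriv_mx (fun r => Z r *m coframe r) q (W q) +
    - 2^-1 *: structure q (W q *m coframe q) (Z q *m coframe q)) _ oU Up).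
  - have dS := mdiff_structure torsion_par (smooth_id Mt) (dc _ sW) (dc _ sZ).
    rewrite deriv_mxD ?deriv_mxZ //.
    + by rewrite (deriv_structure torsion_par _ (smooth_id Mt) (dc _ sW) (dc _ sZ)) scaleNr.
    + exact: smooth_mdiff_mx Up (smooth_deriv_mx oU (sc _ sZ) sW).
    + exact: mdiff_mxZ.
  - by move=> q Uq; rewrite scaleNr (lc_wzE _ oU Uq sZ).
  - move=> i j; rewrite (_ : (fun q => _) =
      fun q => deriv_mx (fun r => Z r *m coframe r) q (W q) i j +
      (- 2^-1 *: structure q (W q *m coframe q) (Z q *m coframe q)) i j); last first.
      by apply/funext => q; rewrite mxE.
    apply: mdiffD.
      exact: (smooth_mdiff_mx Up (smooth_deriv_mx oU (sc _ sZ) sW)).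
    have dS := mdiff_structure torsion_par (smooth_id Mt) (dc _ sW) (dc _ sZ).
    exact: (mdiff_mxZ (- 2^-1) dS).
rewrite /curvature mulmxBl mulmxBl (covE _ _ sX sY) (covE _ _ sY sX).
rewrite /covf (lc_wzE _ oU Up sZ) -(deriv_mx_bracket oU Up (sc _ sZ) sX sY).
have -> : bracket X Y p *m coframe p =
   deriv_mx (fun q => Y q *m coframe q) p (X p) -
   deriv_mx (fun q => X q *m coframe q) p (Y p) - structure p x y.
  by rewrite (cartan oU Up (@smooth_coframe _ _ Mt) sX sY) ext_deriv_structure addrK.
rewrite -/x -/y -/z.
set dXY := deriv_mx _ p (X p); set dYX := deriv_mx _ p (Y p).
set dX := deriv_mx _ p (X p); set dY := deriv_mx _ p (Y p).
set yX := deriv_mx _ p (X p); set xY := deriv_mx _ p (Y p).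
clearbody dXY dYX dX dY yX xY.
rewrite !(structureDl, structureDr, structureNl, structureNr, structureZr).
move: (S p x dY) (S p y dX) (S p yX z) (S p xY z) (S p (S p x y) z).
move: (S p x (S p y z)) (S p y (S p x z)) => v1 v2 v3 v4 v5 v6 v7.
apply/rowP => i; rewrite !mxE; lra.
Qed.

(** For [y = z] the curvature formula collapses to minus a quarter of the square of
    [B], and [B] is skew-symmetric. *)
Lemma ricciE p (N : 'rV[R]_m) :
  let B := \matrix_i structure p (delta_mx 0 i) (N *m coframe p) in
  ricci nabla p N N = 4^-1 * \tr (B *m B^T).
Proof.
move=> B; set nu := N *m coframe p in B *.
have BE x : x *m B = structure p x nu.
  rewrite mulmx_sum_row {2}(row_sum_delta x) structure_suml; apply: eq_bigr => i _.
  by rewrite rowK structureZl.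
have BT : B^T = - B.
  apply/matrixP => i j; rewrite !mxE.
  have dotE (v : 'rV[R]_m) l : v 0 l = dot (delta_mx 0 l) v :> R.
    by rewrite dot_mulmx -rowE !mxE.
  by rewrite !dotE (structure_skew12 torsion_skew).
have -> : ricci nabla p N N = \tr (coframe p *m (- 4^-1 *: (B *m B)) *m frame_mx p).
  congr (\tr _); apply/matrixP => i j; rewrite mxE.
  set u := delta_mx 0 i.
  have op := @dom_open _ _ _ p.
  have := lc_curvatureE op (dom_self p) (smooth_coord_field p u)
    (smooth_coord_field p N) (smooth_coord_field p N).
  rewrite /= !coord_field_self -/nu (structure_alt torsion_skew p nu nu).1.
  set c := curvature _ _ _ _ _ => E.
  rewrite -[c]mulmx1 -(coframeK p) mulmxA E.
  rewrite [X in _ = X](_ : _ =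
      (u *m (coframe p *m (- 4^-1 *: (B *m B)) *m frame_mx p)) 0 j); last first.
    by rewrite /u -rowE [RHS]mxE.
  rewrite !mulmxA; congr ((_ *m frame_mx p) 0 j).
  rewrite structure0r scaler0 addr0 (structureC p nu) scalerN opprK.
  rewrite -scalemxAr mulmxA !BE; move: (S p _ nu) => w.
  by apply/rowP => l; rewrite !mxE; lra.
rewrite mxtrace_mulC mulmxA frameK mul1mx BT mulmxN scaleNr.
by rewrite !raddfN /= mxtraceZ mulrN.
Qed.

End LeviCivitaWeitzenbock.

(** * Euclidean space and the round sphere *)

Section Euclid.
Variables (R : realType) (k : nat).

Lemma of_chart_euclid (c p : euclid R k) : of_chart c p = 1%:M.
Proof. exact: to_chart_self. Qed.

Definition euclid_form (_ : euclid R k) : 'M[R]_k := 1%:M.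

Lemma smooth_euclid_form : smooth_form euclid_form.
Proof.
move=> c i j; apply: (smooth_fun_ext (f := fun=> (1%:M : 'M[R]_k) i j)).
- exact: openT.
- by move=> q _; rewrite of_chart_euclid mul1mx.
- exact: smooth_cst.
Qed.

Lemma ext_deriv_euclid_form p x y : ext_deriv euclid_form p x y = 0.
Proof.
rewrite ext_derivE; last exact: smooth_euclid_form.
have -> : (fun q => of_chart p q *m euclid_form q) = fun=> 1%:M.
  by apply/funext => q; rewrite of_chart_euclid mul1mx.
by rewrite !deriv_mx_cst !mulmx0 subrr.
Qed.

Variables (n : nat) (M : manifold R n) (F : M -> euclid R k) (sF : smooth_map F).

Lemma smooth_mx_euclid : smooth_mx setT (F : M -> 'rV[R]_k).
Proof.
move=> i j; rewrite (ord1 i); have := smooth_chart_pull sF (0 : euclid R k) j.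
exact.
Qed.

Lemma tangent_map_euclid p u :
  u *m tangent_map F p = deriv_mx (F : M -> 'rV[R]_k) p u.
Proof.
have dF := smooth_mdiff_mx (I : [set: M] p) smooth_mx_euclid.
by rewrite -deriv_along_row // mul_jacobian.
Qed.

(** The Levi-Civita connection of the Euclidean space differentiates components: the
    identity is a closed form, so this is an instance of [koszul]. *)
Lemma pullback_conn_euclid nabla U p u V : levi_civita (euclid_metric R k) nabla ->
  open U -> U p -> smooth_along F U V ->
  pullback_conn nabla F p u V = deriv_mx V p u.
Proof.
move=> lc oU Up sV.
have := pullback_conn_form (T := 1%:M) (nabla := nabla) (G := fun _ _ => 0)
  sF u oU Up smooth_euclid_form sV.
have V1 : (fun q => V q *m euclid_form (F q)) = V.
  by apply/funext => q; rewrite mulmx1.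
rewrite V1 !mulmx1 addr0; apply => w v.
rewrite !mulmx1 addr0; apply/eqP; rewrite -subr_eq0; apply/eqP/dot_eq0.
set d := _ - _.
have gE q x y : euclid_metric R k q x y = dot (x *m euclid_form q) (y *m euclid_form q).
  by rewrite !mulmx1.
have skew x y z : dot (ext_deriv euclid_form (F p) x y) (z *m euclid_form (F p)) =
    - dot (ext_deriv euclid_form (F p) x z) (y *m euclid_form (F p)).
  by rewrite !ext_deriv_euclid_form !dot0l oppr0.
have := koszul smooth_euclid_form gE lc w d (@dom_open _ _ _ (F p)) (dom_self _)
  (smooth_coord_field (F p) v) skew.
by rewrite ext_deriv_euclid_form scaler0 addr0 /euclid_form !mulmx1.
Qed.

End Euclid.

Section Sphere.
Variables (R : realType) (n : nat).
Local Notation incl := (@sphere_incl R n).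

Lemma smooth_sphere_incl : smooth_map incl.
Proof.
split; first exact: initial_continuous.
move=> p c k; apply: (@Cdiff_sub _ _ _ k setT) => //; exact: Cdiff_stereo_inv.
Qed.

(** The differential of the stereographic projection is a left inverse. *)
Lemma sphere_incl_immersion p : row_free (tangent_map incl p).
Proof.
apply/row_freeP; pose e := hemisphere (set_val p).
have ee : e * e = 1 by exact: hemisphere_sqr.
pose y := sphere_chart p p.
have yE : stereo_inv e y = set_val p.
  by have := congr1 set_val (sphere_chartK (sphere_dom_self p)).
exists ('J (stereo e) (set_val p)).
apply/row_matrixP => i; rewrite !rowE mulmxA mulmx1 !mul_jacobian.
have di : differentiable (stereo_inv e) y by have [+ _] := @Cdiff_stereo_inv R n 1 e; apply.
have ds : differentiable (stereo e) (stereo_inv e y).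
  by rewrite yE; have [+ _] := @Cdiff_stereo R n 1 e; apply; exact: sphere_dom_self.
have E := diff_comp di ds.
have -> : 'd (stereo e) (set_val p) ('d (id \o incl \o chart_inv p) (chart p p) (delta_mx 0 i)) =
   'd (stereo e \o stereo_inv e) y (delta_mx 0 i).
  by rewrite E /= yE.
have -> : stereo e \o stereo_inv e = id :> ('rV[R]_n -> 'rV[R]_n).
  by apply/funext => z; exact: stereo_invK.
have did := is_diff_id y.
by rewrite (@diff_val _ _ _ _ _ _ _ did).
Qed.

Lemma sphere_tangent p u : dot (u *m tangent_map incl p) (set_val p) = 0.
Proof.
rewrite tangent_map_euclid; last exact: smooth_sphere_incl.
have di : mdiff_mx (incl : sphere R n -> 'rV[R]_n.+1) p.
  exact: (smooth_mdiff_mx (I : [set: sphere R n] p) (smooth_mx_euclid smooth_sphere_incl)).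
have := deriv_dot u di di.
have -> : (fun q : sphere R n => dot (incl q) (incl q)) = fun=> 1.
  by apply/funext => q; exact: (set_valP q).
rewrite deriv_along_cst (dotC (incl p)) => /esym/eqP; rewrite -mulr2n mulrn_eq0 /=.
by move/eqP.
Qed.

Definition sphere_form : sphere R n -> 'M[R]_(n, n.+1) :=
  pull_form incl (@euclid_form R n.+1).

Lemma sphere_formE p : sphere_form p = tangent_map incl p.
Proof. by rewrite /sphere_form /pull_form mulmx1. Qed.

Lemma smooth_sphere_form : smooth_form sphere_form.
Proof. exact: smooth_pull_form smooth_sphere_incl _ (@smooth_euclid_form _ _). Qed.

Variables (k : nat) (M : manifold R k) (F : M -> sphere R n) (sF : smooth_map F).

(** Gauss's formula, from [koszul] for the closed form [sphere_form]. Multiplying by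
    the transpose of [sphere_form] extracts tangential parts. *)
Lemma pullback_conn_sphere nabla U p u V : levi_civita (round_metric R n) nabla ->
  open U -> U p -> smooth_along F U V ->
  pullback_conn nabla F p u V *m sphere_form (F p) *m (sphere_form (F p))^T =
  deriv_mx (fun q => V q *m sphere_form (F q)) p u *m (sphere_form (F p))^T.
Proof.
move=> lc oU Up sV.
rewrite (pullback_conn_form (G := fun _ _ => 0) sF u oU Up smooth_sphere_form sV).
  by rewrite addr0.
move=> w v; rewrite addr0; apply/eqP; rewrite -subr_eq0 -mulmxBl; apply/eqP/rowP => j.
have := koszul smooth_sphere_form _ lc w (delta_mx 0 j) (@dom_open _ _ _ (F p))
  (dom_self _) (smooth_coord_field (F p) v).
have e0 x y : ext_deriv sphere_form (F p) x y = 0.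
  rewrite ext_deriv_pull ?ext_deriv_euclid_form //; first exact: smooth_sphere_incl.
  exact: smooth_euclid_form.
rewrite e0 scaler0 addr0 dot_mulmx trmx_mul mulmxA => H; rewrite [RHS]mxE -H.
- by rewrite [in RHS]trmx_delta -colE [RHS]mxE.
- by move=> q x y; rewrite sphere_formE.
- by move=> x y z; rewrite !e0 !dot0l oppr0.
Qed.

End Sphere.

(** * Laplacians as sums of iterated derivatives *)

Section SmoothMapsTo.
Variables (R : realType) (k : nat) (M : manifold R k).

Lemma smooth_continuous (m : nat) (f : M -> 'rV[R]_m) : smooth_mx setT f ->
  continuous f.
Proof.
move=> sf p; have /(_ p 0 (chart p p)) := smooth_mx_row openT sf.
rewrite setIT => cf.
have {}cf : {for chart p p, continuous (f \o chart_inv p)}.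
  by apply: cf; exists p => //; exact: dom_self.
have H : (f \o chart_inv p) \o chart p @ p --> f p.
  have -> : f p = (f \o chart_inv p) (chart p p).
    by rewrite /= chartK //; exact: dom_self.
  exact: continuous_comp (chart_continuous (dom_self p)) cf.
apply: cvg_trans H; apply: near_eq_cvg.
have op := open_nbhs_nbhs (conj (@dom_open _ _ _ p) (dom_self p)).
by apply: filterS op => q pq; rewrite /= chartK.
Qed.

Lemma smooth_map_euclid (m : nat) (F : M -> euclid R m) :
  smooth_mx setT (F : M -> 'rV[R]_m) -> smooth_map F.
Proof.
move=> sF; split; first exact: smooth_continuous sF.
move=> p c j; have := smooth_mx_row openT sF p j.
by rewrite (_ : F @^-1` chart_dom c = setT).
Qed.

Variable (n : nat).
Local Notation incl := (@sphere_incl R n).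

Lemma smooth_map_sphere (F : M -> sphere R n) :
  smooth_mx setT (incl \o F : M -> 'rV[R]_n.+1) -> smooth_map F.
Proof.
move=> sF; have cF := smooth_continuous sF.
have contF : continuous F.
  move=> p W [_ [[U oU <-] Up UW]].
  have H := cF p U (open_nbhs_nbhs (conj oU Up)).
  have sUW : (incl \o F) @^-1` U `<=` F @^-1` W by move=> q Uq; exact: UW.
  exact: filterS sUW H.
split=> // p c j.
pose e := hemisphere (set_val c).
have oD : open (F @^-1` chart_dom c).
  by move/continuousP : contF; apply; exact: (@dom_open _ _ _ c).
have oI := @open_chart_image _ _ _ p _ oD.
apply: Cdiff_row => // i.
apply: (@Cdiff_comp _ _ n.+1 j _ (stereo_dom e)
  ((incl \o F) \o chart_inv p) (fun x => stereo e x 0 i)) => //.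
- by move=> _ [q [pq cq] <-] /=; rewrite chartK.
- apply: Cdiff_sub (smooth_mx_row openT sF p j).
  by move=> _ [q [pq cq] <-]; exists q.
- apply: Cdiff_entry; first exact: open_stereo_dom.
  exact: Cdiff_stereo.
Qed.

End SmoothMapsTo.

Section Laplacians.
Variables (R : realType) (k : nat) (M : manifold R k).
Variables (nablaM : covder M) (U : set M) (E : 'I_k -> M -> 'rV[R]_k).
Hypotheses (oU : open U) (sE : forall i, smooth_field U (E i)).

Definition flat_laplacian (m : nat) (f : M -> 'rV[R]_m) (p : M) : 'rV[R]_m :=
  \sum_i (deriv_mx (fun q => deriv_mx f q (E i q)) p (E i p) -
          deriv_mx f p (covf nablaM (E i) (E i) p)).

Lemma laplacian_euclid (m : nat) (nablaE : covder (euclid R m)) (F : M -> euclid R m) p :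
  levi_civita (euclid_metric R m) nablaE -> smooth_map F -> U p ->
  laplacian nablaM nablaE E F p = flat_laplacian (F : M -> 'rV[R]_m) p.
Proof.
move=> lc sF Up; apply: eq_bigr => i _; congr (_ - _); last exact: tangent_map_euclid.
rewrite (pullback_conn_euclid sF _ lc oU Up (smooth_push sF oU (sE i))).
congr (deriv_mx _ _ _); apply/funext => q; exact: tangent_map_euclid.
Qed.

Variable (n : nat).
Local Notation incl := (@sphere_incl R n).

Lemma tangent_map_incl (F : M -> sphere R n) p u : smooth_map F ->
  u *m tangent_map F p *m sphere_form (F p) =
  deriv_mx (incl \o F : M -> 'rV[R]_n.+1) p u.
Proof.
move=> sF; rewrite sphere_formE (tangent_map_euclid (@smooth_sphere_incl R n)).
have di := smooth_mdiff_mx (I : [set: sphere R n] (F p))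
  (smooth_mx_euclid (@smooth_sphere_incl R n)).
by have [_ <-] := deriv_mx_pull sF u di.
Qed.

Lemma laplacian_sphere (nablaS : covder (sphere R n)) (F : M -> sphere R n) p :
  levi_civita (round_metric R n) nablaS -> smooth_map F -> U p ->
  laplacian nablaM nablaS E F p *m sphere_form (F p) *m (sphere_form (F p))^T =
  flat_laplacian (incl \o F : M -> 'rV[R]_n.+1) p *m (sphere_form (F p))^T.
Proof.
move=> lc sF Up; rewrite /laplacian !mulmx_suml; apply: eq_bigr => i _.
rewrite mulmxBl (tangent_map_incl _ _ sF) !mulmxBl; congr (_ - _).
rewrite (pullback_conn_sphere sF _ lc oU Up (smooth_push sF oU (sE i))).
congr (deriv_mx _ _ _ *m _); apply/funext => q; exact: tangent_map_incl.
Qed.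

End Laplacians.

(** * The hypersurface in the parallel frame *)

Section Hypersurface.
Variables (R : realType) (n : nat) (Mt : weitzenbock R n.+1) (M : hypersurface Mt).
Hypothesis torsion_par : parallel_torsion Mt.
Hypothesis torsion_skew : skew_torsion Mt.
Implicit Types (p q : M) (U : set M).
Local Notation iota := (@hs_incl R n Mt M).
Local Notation S p := (structure (iota p)).

Lemma smooth_iota : smooth_map iota.
Proof. exact: embedding_smooth (hs_incl_embedding M). Qed.

(** The identification of tangent vectors of [M] with coefficient vectors in the
    parallel frame. *)
Definition omega : M -> 'M[R]_(n, n.+1) := pull_form iota (@coframe R n.+1 Mt).

Definition nu (p : M) : 'rV[R]_n.+1 := hs_normal p *m coframe (iota p).

Lemma smooth_omega : smooth_form omega.
Proof. exact: smooth_pull_form smooth_iota _ (@smooth_coframe _ _ Mt). Qed.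

Lemma smooth_nu : smooth_mx setT nu.
Proof.
have := smooth_along_form smooth_iota openT (@smooth_coframe _ _ Mt).
by move=> /(_ hs_normal); apply; exact: normal_smooth.
Qed.

Lemma mdiff_nu p : mdiff_mx nu p.
Proof. exact: smooth_mdiff_mx (I : [set: M] p) smooth_nu. Qed.

Lemma hs_metricE p x y : hs_metric M p x y = dot (x *m omega p) (y *m omega p).
Proof. by rewrite /omega /pull_form !mulmxA. Qed.

Lemma dot_nu p : dot (nu p) (nu p) = 1.
Proof. exact: normal_unit. Qed.

Lemma dot_nu_omega p x : dot (nu p) (x *m omega p) = 0.
Proof. by rewrite /omega /pull_form mulmxA; exact: (normal_orthogonal p x). Qed.

Lemma nu_neq0 p : nu p != 0.
Proof.
by apply: contraTneq isT => E; have := dot_nu p; rewrite E dot0l => /esym/eqP; rewrite oner_eq0.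
Qed.

Lemma omega_nu p : omega p *m (nu p)^T = 0.
Proof.
apply/row_matrixP => i; rewrite row_mul row0; apply/rowP => j; rewrite (ord1 j).
by rewrite -dot_mulmx rowE dotC dot_nu_omega mxE.
Qed.

Lemma coframe_unit (q : Mt) : coframe q \in unitmx.
Proof. by rewrite unitmx_inv frame_unit. Qed.

Lemma omega_free p : row_free (omega p).
Proof.
rewrite /row_free /omega /pull_form mxrankMfree ?row_free_unit ?coframe_unit //.
exact: embedding_immersion (hs_incl_embedding M) p.
Qed.

Lemma omega_inj p (x y : 'rV[R]_n) : x *m omega p = y *m omega p -> x = y.
Proof. exact: row_free_inj (omega_free p) _ _. Qed.

Lemma tangent_omega p (v : 'rV[R]_n.+1) : dot v (nu p) = 0 ->
  exists x, v = x *m omega p.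
Proof.
move=> v0; apply/submxP.
apply: submx_orthogonal (omega_free p) (nu_neq0 p) (omega_nu p) _.
by apply/rowP => j; rewrite (ord1 j) -dot_mulmx v0 mxE.
Qed.

Lemma omega_nu_eq0 p (v : 'rV[R]_n.+1) : dot v (nu p) = 0 ->
  (forall x, dot v (x *m omega p) = 0) -> v = 0.
Proof. by move=> /tangent_omega[x ->] H; apply: dot_eq0. Qed.

Lemma pullback_wz U p u V : open U -> U p -> smooth_along iota U V ->
  pullback_conn wz_conn iota p u V *m coframe (iota p) =
  deriv_mx (fun q => V q *m coframe (iota q)) p u.
Proof.
move=> oU Up sV.
have := pullback_conn_form (T := 1%:M) (nabla := wz_conn) (G := fun _ _ => 0)
  smooth_iota u oU Up (@smooth_coframe _ _ Mt) sV.
rewrite !mulmx1 addr0; apply => w v.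
rewrite !mulmx1 addr0.
exact: wz_connE (@dom_open _ _ _ _) (dom_self _) (smooth_coord_field _ _).
Qed.

Lemma pullback_lc nabla U p u V : levi_civita (wz_metric Mt) nabla ->
  open U -> U p -> smooth_along iota U V ->
  pullback_conn nabla iota p u V *m coframe (iota p) =
  deriv_mx (fun q => V q *m coframe (iota q)) p u -
  2^-1 *: S p (u *m omega p) (V p *m coframe (iota p)).
Proof.
move=> lc oU Up sV.
have := pullback_conn_form (T := 1%:M) (nabla := nabla)
  (G := fun w v => - (2^-1 *: S p (w *m coframe (iota p)) (v *m coframe (iota p))))
  smooth_iota u oU Up (@smooth_coframe _ _ Mt) sV.
rewrite !mulmx1 /omega /pull_form mulmxA; apply => w v; rewrite !mulmx1.
rewrite (lc_wzE torsion_skew lc w (@dom_open _ _ _ (iota p)) (dom_self _)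
  (smooth_coord_field (iota p) v)).
by rewrite coord_field_self.
Qed.

Lemma push_coframe (Y : M -> 'rV[R]_n) :
  (fun q => push iota Y q *m coframe (iota q)) = fun q => Y q *m omega q.
Proof. by apply/funext => q; rewrite /push /omega /pull_form mulmxA. Qed.

(** Componentwise differentiation is the ambient connection, by [pullback_wz]; the
    second term is the normal part that [tangential] removes. *)
Lemma hs_connE U Y p u : open U -> U p -> smooth_field U Y ->
  let d := deriv_mx (fun q => Y q *m omega q) p u in
  hs_conn M p u Y *m omega p = d - dot d (nu p) *: nu p.
Proof.
move=> oU Up sY d.
set z := pullback_conn wz_conn iota p u (push iota Y).
have zE : z *m coframe (iota p) = d.
  rewrite (pullback_wz u oU Up (smooth_push smooth_iota oU sY)).
  by rewrite push_coframe.
rewrite /hs_conn -/z /tangential.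
have -> : wz_metric Mt (iota p) z (hs_normal p) = dot d (nu p) by rewrite -zE.
set w := z - _.
have wE : w *m coframe (iota p) = d - dot d (nu p) *: nu p.
  by rewrite mulmxBl zE -scalemxAl.
rewrite -wE /omega /pull_form mulmxA; congr (_ *m _).
apply: mulmxKpV.
have [|x] := @tangent_omega p (w *m coframe (iota p)).
  by rewrite wE dotBl dotZl dot_nu mulr1 subrr.
rewrite /omega /pull_form mulmxA => /coframe_inj ->; exact: submxMl.
Qed.

Lemma structure_eq_omega U X Y p : open U -> U p -> smooth_field U X -> smooth_field U Y ->
  deriv_mx (fun q => Y q *m omega q) p (X p) - deriv_mx (fun q => X q *m omega q) p (Y p)
  = bracket X Y p *m omega p + S p (X p *m omega p) (Y p *m omega p).
Proof.
move=> oU Up sX sY; rewrite (cartan oU Up smooth_omega sX sY); congr (_ + _).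
rewrite (ext_deriv_pull smooth_iota _ _ _ (@smooth_coframe _ _ Mt)).
by rewrite ext_deriv_structure -!mulmxA.
Qed.

Lemma mdiff_omega U Y p : open U -> U p -> smooth_field U Y ->
  mdiff_mx (fun q => Y q *m omega q) p.
Proof.
by move=> oU Up sY; exact: smooth_mdiff_mx Up (smooth_form_field oU smooth_omega sY).
Qed.

Lemma dot_deriv_nu p x : dot (deriv_mx nu p x) (nu p) = 0.
Proof.
have := deriv_dot x (mdiff_nu p) (mdiff_nu p).
rewrite (_ : (fun q => _) = fun=> 1); last by apply/funext => q; exact: dot_nu.
rewrite deriv_along_cst (dotC (nu p)) => /esym/eqP; rewrite -mulr2n mulrn_eq0 /=.
by move/eqP.
Qed.

Lemma dot_deriv_nu_omega U Y p x : open U -> U p -> smooth_field U Y ->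
  dot (deriv_mx nu p x) (Y p *m omega p) =
  - dot (nu p) (deriv_mx (fun q => Y q *m omega q) p x).
Proof.
move=> oU Up sY; have := deriv_dot x (mdiff_nu p) (mdiff_omega oU Up sY).
rewrite (_ : (fun q => _) = fun=> 0); last by apply/funext => q; exact: dot_nu_omega.
by rewrite deriv_along_cst => /esym/eqP; rewrite addr_eq0 => /eqP.
Qed.

(** The normal component of the structure equation, in which the bracket drops out
    because it is tangent to [M]. *)
Lemma shape_skew p x y :
  dot (deriv_mx nu p x) (y *m omega p) - dot (deriv_mx nu p y) (x *m omega p) =
  - dot (nu p) (S p (x *m omega p) (y *m omega p)).
Proof.
have op := @dom_open _ _ _ p; have pp := dom_self p.
have sc := @smooth_coord_field _ _ M p.
have := structure_eq_omega op pp (sc x) (sc y).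
have := dot_deriv_nu_omega x op pp (sc y); have := dot_deriv_nu_omega y op pp (sc x).
rewrite !coord_field_self bracket_coord_field mul0mx add0r => -> -> <-.
by rewrite dotBr opprB opprK addrC.
Qed.

Section Weingarten.
Variables (W : M -> 'M[R]_n) (WP : is_weingarten wz_conn W).

Lemma weingartenE U Y p x : open U -> U p -> smooth_field U Y ->
  dot (x *m W p *m omega p) (Y p *m omega p) =
  dot (nu p) (deriv_mx (fun q => Y q *m omega q) p x).
Proof.
move=> oU Up sY; rewrite -hs_metricE (WP x oU Up sY).
rewrite -(push_coframe Y) -(pullback_wz _ oU Up (smooth_push smooth_iota oU sY)).
by [].
Qed.

(** Weingarten's equation. *)
Lemma deriv_nu p x : deriv_mx nu p x = - (x *m W p *m omega p).
Proof.
apply/eqP; rewrite -subr_eq0 opprK; apply/eqP; apply: (@omega_nu_eq0 p).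
  by rewrite dotDl dot_deriv_nu add0r dotC dot_nu_omega.
move=> y; have op := @dom_open _ _ _ p; have pp := dom_self p.
have := dot_deriv_nu_omega x op pp (@smooth_coord_field _ _ M p y).
have := weingartenE x op pp (@smooth_coord_field _ _ M p y).
rewrite dotDl !coord_field_self => -> ->.
by rewrite addNr.
Qed.

Variables (nabla : covder Mt) (lc : levi_civita (wz_metric Mt) nabla).
Variables (Wbar : M -> 'M[R]_n) (WbarP : is_weingarten nabla Wbar).

Lemma weingarten_bar p x y :
  dot (x *m Wbar p *m omega p) (y *m omega p) =
  dot (x *m W p *m omega p) (y *m omega p) -
  2^-1 * dot (nu p) (S p (x *m omega p) (y *m omega p)).
Proof.
have op := @dom_open _ _ _ p; have pp := dom_self p.
have sY := @smooth_coord_field _ _ M p y.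
have := weingartenE x op pp sY; have := WbarP x op pp sY.
rewrite hs_metricE !coord_field_self => -> ->.
have := pullback_lc x lc op pp (smooth_push smooth_iota op sY).
rewrite push_coframe {2}/push coord_field_self -mulmxA -/(omega p) => E.
by rewrite -dotZr -dotBr -E.
Qed.

(** By [weingarten_bar] the difference [D] is skew-symmetric for the metric, whose Gram
    matrix is [G], so its trace vanishes. *)
Lemma trace_weingarten p : \tr (W p) = \tr (Wbar p).
Proof.
pose D := W p - Wbar p; pose G := omega p *m (omega p)^T.
have GT : G^T = G by rewrite trmx_mul trmxK.
have uG : G \in unitmx.
  rewrite -row_free_unit -kermx_eq0; apply/rowV0P => v /sub_kermxP vG.
  apply: (@omega_inj p); rewrite mul0mx; apply: dot_eq0.
  by rewrite dot_mulmx trmx_mul mulmxA -(mulmxA v) vG mul0mx mxE.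
have dotG x y : dot (x *m omega p) (y *m omega p) = (x *m G *m y^T) 0 0.
  by rewrite dot_mulmx trmx_mul !mulmxA.
have skew (x : 'rV[R]_n) : (x *m (D *m G) *m x^T) 0 0 = 0.
  rewrite mulmxA -dotG mulmxBr mulmxBl dotBl weingarten_bar opprB addrCA subrr addr0.
  by rewrite (structure_alt torsion_skew _ _ 0).1 dot0r mulr0.
have DGT := skew_form_mx skew.
apply/eqP; rewrite -subr_eq0 -linearB /= -/D; apply/eqP.
have : \tr D = - \tr D.
  rewrite -{1}(mulmxK uG D) -mxtrace_tr trmx_mul DGT trmx_inv GT mulmxN raddfN /=.
  by rewrite mxtrace_mulC mulmxK.
move/eqP; rewrite -addr_eq0 -mulr2n mulrn_eq0 /=; move/eqP => //.
Qed.

End Weingarten.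

(** * Orthonormal frames and the Codazzi equation *)

Section OrthonormalFrame.
Variables (U : set M) (E : 'I_n -> M -> 'rV[R]_n) (oU : open U).
Hypothesis onE : orthonormal_frame (hs_metric M) U E.

Definition frame_coords i q := E i q *m omega q.
Local Notation e := frame_coords.

Let sE i : smooth_field U (E i). Proof. exact: onE.1. Qed.

Lemma dot_frame p i j : U p -> dot (e i p) (e j p) = (i == j)%:R.
Proof. by move=> Up; rewrite /frame_coords -hs_metricE onE.2. Qed.

Lemma dot_frame_nu p i : dot (e i p) (nu p) = 0.
Proof. by rewrite dotC dot_nu_omega. Qed.

Lemma frame_mx_unit p : U p ->
  (\matrix_i E i p) *m (omega p *m (\matrix_i e i p)^T) = 1%:M.
Proof.
move=> Up; rewrite mulmxA; apply/matrixP => i j; rewrite [RHS]mxE -(dot_frame i j Up).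
by rewrite mulmx_trE row_mul !rowK.
Qed.

Lemma frame_span p x : U p -> exists c : 'I_n -> R,
  x *m omega p = \sum_l c l *: e l p.
Proof.
move=> Up; have E1 := mulmx1C (frame_mx_unit Up).
exists (fun l => (x *m (omega p *m (\matrix_i e i p)^T)) 0 l).
have -> : x *m omega p = x *m (omega p *m (\matrix_i e i p)^T) *m
    (\matrix_i E i p *m omega p).
  by rewrite mulmxA -(mulmxA x) E1 mulmx1.
by rewrite mulmx_sum_row; apply: eq_bigr => l _; rewrite row_mul rowK.
Qed.

Lemma frame_eq0 p v : U p -> dot v (nu p) = 0 -> (forall l, dot v (e l p) = 0) ->
  v = 0.
Proof.
move=> Up v0 ve; apply: (omega_nu_eq0 v0) => x.
have [c ->] := frame_span x Up.
by rewrite dot_sumr big1 // => l _; rewrite dotZr ve mulr0.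
Qed.

Lemma frame_expand p v : U p ->
  v = \sum_l dot v (e l p) *: e l p + dot v (nu p) *: nu p.
Proof.
move=> Up; apply/eqP; rewrite -subr_eq0; apply/eqP; apply: (frame_eq0 Up) => [|k].
  rewrite dotBl dotDl dotZl dot_nu mulr1 dot_suml big1 ?add0r ?subrr // => l _.
  by rewrite dotZl dot_frame_nu mulr0.
rewrite dotBl dotDl dotZl (dotC (nu p)) dot_frame_nu mulr0 addr0 dot_suml.
rewrite (bigD1 k) //= big1 ?addr0 => [|l lk].
  by rewrite dotZl dot_frame // eqxx mulr1 subrr.
by rewrite dotZl dot_frame // (negbTE lk) mulr0.
Qed.

Lemma parseval p v w : U p ->
  dot v w = \sum_l dot v (e l p) * dot w (e l p) + dot v (nu p) * dot w (nu p).
Proof.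
move=> Up; rewrite {1}(frame_expand w Up) dotDr dotZr dot_sumr mulrC; congr (_ + _).
by apply: eq_bigr => l _; rewrite dotZr mulrC.
Qed.

Lemma trace_frame p (A : 'M[R]_n) : U p ->
  \tr A = \sum_i dot (E i p *m A *m omega p) (e i p).
Proof.
move=> Up; have E1 := mulmx1C (frame_mx_unit Up).
have -> : \tr A = \tr (A *m (omega p *m (\matrix_i e i p)^T) *m \matrix_i E i p).
  by rewrite -mulmxA E1 mulmx1.
rewrite mxtrace_mulC 2!mulmxA; apply: eq_bigr => i _.
by rewrite (mulmxA _ A) mulmx_trE !row_mul !rowK.
Qed.

Lemma smooth_frame_coords i : smooth_mx U (e i).
Proof. exact: smooth_form_field oU smooth_omega (sE i). Qed.

Lemma mdiff_frame i p : U p -> mdiff_mx (e i) p.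
Proof. by move=> Up; exact: smooth_mdiff_mx Up (smooth_frame_coords i). Qed.

Definition deriv_nu_frame i q := deriv_mx nu q (E i q).
Local Notation ne := deriv_nu_frame.

Lemma smooth_nu_dom : smooth_mx U nu.
Proof. by move=> i j; apply: smooth_fun_sub (smooth_nu i j). Qed.

Lemma mdiff_deriv_nu i p : U p -> mdiff_mx (ne i) p.
Proof.
move=> Up; exact: smooth_mdiff_mx Up (smooth_deriv_mx oU smooth_nu_dom (sE i)).
Qed.

Lemma deriv_frame_skew p u i l : U p ->
  dot (deriv_mx (e i) p u) (e l p) = - dot (deriv_mx (e l) p u) (e i p).
Proof.
move=> Up; have := deriv_dot u (mdiff_frame i Up) (mdiff_frame l Up).
rewrite -(deriv_along_ext (f := fun=> (i == l)%:R : R) _ oU Up).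
- by rewrite deriv_along_cst (dotC (e i p)) => /esym/eqP; rewrite addr_eq0 => /eqP.
- by move=> q Uq; rewrite dot_frame.
- exact: mdiff_cst.
Qed.

(** Only the metric and the bracket enter on the right: the torsion drops out because
    it is totally skew. [lc_conn_frame] has the same right-hand side, so the two
    connections have the same sum over [i]. *)
Lemma hs_conn_frame p i j : U p ->
  dot (covf (hs_conn M) (E i) (E i) p *m omega p) (e j p) =
  - dot (e i p) (bracket (E i) (E j) p *m omega p).
Proof.
move=> Up; rewrite /covf (hs_connE _ oU Up (sE i)) dotBl dotZl.
rewrite (dotC (nu p) (e j p)) dot_frame_nu mulr0 subr0 -/(e i) deriv_frame_skew //.
have -> : deriv_mx (e j) p (E i p) = deriv_mx (e i) p (E j p) +
   (bracket (E i) (E j) p *m omega p + S p (e i p) (e j p)).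
  by rewrite -(structure_eq_omega oU Up (sE i) (sE j)) addrC subrK.
rewrite !dotDl (dotC (S p _ _)) (structure_skew torsion_skew) addr0 (dotC (_ *m omega p)).
have /eqP := deriv_frame_skew (E j p) i i Up.
by rewrite -addr_eq0 -mulr2n mulrn_eq0 /= => /eqP ->; rewrite add0r.
Qed.

Lemma lc_conn_frame lcM p i j : levi_civita (hs_metric M) lcM -> U p ->
  dot (covf lcM (E i) (E i) p *m omega p) (e j p) =
  - dot (e i p) (bracket (E i) (E j) p *m omega p).
Proof.
move=> lc Up; rewrite -!hs_metricE.
have cst a b : deriv_along (fun q => hs_metric M q (E a q) (E b q)) p =1 fun=> 0.
  move=> u; rewrite -(deriv_along_ext (f := fun=> (a == b)%:R : R) _ oU Up).
  - exact: deriv_along_cst.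
  - by move=> q Uq; rewrite onE.2.
  - exact: mdiff_cst.
have C x y : hs_metric M p x y = hs_metric M p y x by rewrite !hs_metricE dotC.
have := lc_metric lc (E i p) oU (sE i) (sE j) Up; rewrite cst => /esym/eqP.
rewrite addr_eq0 /covf => /eqP ->; congr (- _).
have := lc_torsion_free lc oU (sE i) (sE j) Up.
rewrite /torsion /covf => /eqP; rewrite subr_eq0 subr_eq => /eqP ->.
have := lc_metric lc (E j p) oU (sE i) (sE i) Up; rewrite cst => /esym/eqP.
rewrite (C (lcM _ _ _)) -mulr2n mulrn_eq0 /= => /eqP H.
by rewrite !hs_metricE mulmxDl dotDr -!hs_metricE H addr0.
Qed.

Lemma sum_conn_frame lcM p : levi_civita (hs_metric M) lcM -> U p ->
  \sum_i covf (hs_conn M) (E i) (E i) p = \sum_i covf lcM (E i) (E i) p.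
Proof.
move=> lc Up; apply: (@omega_inj p); apply/eqP; rewrite -subr_eq0 -mulmxBl; apply/eqP.
apply: (frame_eq0 Up) => [|j]; first by rewrite dotC dot_nu_omega.
rewrite mulmxBl dotBl !mulmx_suml !dot_suml -sumrB big1 // => i _.
by rewrite hs_conn_frame // (lc_conn_frame _ _ lc) // subrr.
Qed.

Lemma sum_skew (f : 'I_n -> 'I_n -> R) : (forall i l, f i l = - f l i) ->
  \sum_i \sum_l f i l = 0.
Proof.
move=> skew; set s := LHS; have : s = - s.
  rewrite {1}/s exchange_big /= -sumrN; apply: eq_bigr => i _.
  by rewrite -sumrN; apply: eq_bigr => l _.
by move/eqP; rewrite -addr_eq0 -mulr2n mulrn_eq0 /= => /eqP.
Qed.

Lemma shape_skew_frame q i l : dot (ne i q) (e l q) - dot (ne l q) (e i q) =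
  - dot (nu q) (S q (e i q) (e l q)).
Proof. exact: shape_skew. Qed.

Lemma dot_deriv_nu_frame q i : dot (ne i q) (nu q) = 0.
Proof. exact: dot_deriv_nu. Qed.

(** Differentiate [dot_deriv_nu_frame] along [E i]. *)
Lemma laplacian_normal p : U p ->
  dot (flat_laplacian (hs_conn M) E nu p) (nu p) = - \sum_i dot (ne i p) (ne i p).
Proof.
move=> Up; rewrite /flat_laplacian dot_suml -sumrN; apply: eq_bigr => i _.
rewrite dotBl dot_deriv_nu subr0.
have := deriv_dot (E i p) (mdiff_deriv_nu i Up) (mdiff_nu p).
rewrite -(deriv_along_ext (f := fun=> 0 : R) _ oU Up).
- by rewrite deriv_along_cst => /esym/eqP; rewrite addr_eq0 => /eqP.
- by move=> q _; rewrite dot_deriv_nu_frame.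
- exact: mdiff_cst.
Qed.

(** Moving the derivative of [nu] along [E i] twice to one along [E j] and [E i] costs
    the terms on the right. The equation combines the flatness of the parallel frame,
    the derivative of [shape_skew_frame] along [E i], and [shape_skew] itself. *)
Lemma codazzi_term p i j : U p ->
  let P := deriv_mx (e j) p (E i p) + bracket (E j) (E i) p *m omega p in
  dot (deriv_mx (ne i) p (E i p)) (e j p) -
  dot (deriv_mx nu p (covf (hs_conn M) (E i) (E i) p)) (e j p) -
  dot (deriv_mx (ne i) p (E j p)) (e i p) -
  dot (ne i p) (deriv_mx (e i) p (E j p)) =
  - 2 * dot (ne i p) P - dot (nu p) (S p (e i p) P).
Proof.
move=> Up P; set b := bracket (E j) (E i) p.
set G := covf (hs_conn M) (E i) (E i) p.
(* Flatness: derivatives of [nu] commute up to the bracket. *)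
have Ea : deriv_mx (ne i) p (E j p) = deriv_mx (ne j) p (E i p) + deriv_mx nu p b.
  rewrite /b -(deriv_mx_bracket oU Up smooth_nu_dom (sE j) (sE i)).
  by rewrite addrC subrK.
(* The structure equation for [E j] and [E i]. *)
have Ee : deriv_mx (e i) p (E j p) = deriv_mx (e j) p (E i p) +
    (b *m omega p + S p (e j p) (e i p)).
  by rewrite -(structure_eq_omega oU Up (sE j) (sE i)) addrC subrK.
(* The derivative of [shape_skew_frame] along [E i]. *)
have Eb : dot (deriv_mx (ne i) p (E i p)) (e j p) + dot (ne i p) (deriv_mx (e j) p (E i p))
  - (dot (deriv_mx (ne j) p (E i p)) (e i p) + dot (ne j p) (deriv_mx (e i) p (E i p)))
  = - (dot (ne i p) (S p (e i p) (e j p)) +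
       dot (nu p) (S p (deriv_mx (e i) p (E i p)) (e j p) +
                   S p (e i p) (deriv_mx (e j) p (E i p)))).
  have dne := mdiff_deriv_nu _ Up; have de := mdiff_frame _ Up.
  have dS := mdiff_structure torsion_par smooth_iota (de i) (de j).
  rewrite -(deriv_structure torsion_par _ smooth_iota (de i) (de j)).
  rewrite -(deriv_dot _ (mdiff_nu p) dS) -!deriv_dot //.
  pose f l k q := dot (ne l q) (e k q).
  have df l k : mdiff (f l k) p by exact: mdiff_dot.
  have dg := mdiff_dot (mdiff_nu p) dS.
  have := deriv_along_ext (E i p) oU Up _ (mdiffD (df i j) dg).
  move=> /(_ (f j i)) <-; first by rewrite (deriv_alongD _ (df i j) dg) opprD addrA addrN add0r.
  move=> q _; apply/eqP; rewrite -subr_eq0 addrAC shape_skew_frame addNr.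
  by [].
have Gw : G *m omega p = deriv_mx (e i) p (E i p) -
    dot (deriv_mx (e i) p (E i p)) (nu p) *: nu p.
  exact: (hs_connE _ oU Up (sE i)).
(* [shape_skew] for [E j] and [G]; the normal part of the derivative of [e i] does
   not contribute. *)
have Ec : dot (ne j p) (deriv_mx (e i) p (E i p)) - dot (deriv_mx nu p G) (e j p) =
    dot (nu p) (S p (deriv_mx (e i) p (E i p)) (e j p)).
  have := shape_skew p (E j p) G; rewrite Gw dotBr dotZr dot_deriv_nu mulr0 subr0.
  rewrite structureDr structureNr structureZr dotBr dotZr.
  rewrite (structure_alt torsion_skew _ (E j p *m omega p) (nu p)).2 mulr0 subr0.
  by rewrite structureC dotNr opprK.
(* [shape_skew] for [b] and [E i]. *)
have Ed : dot (deriv_mx nu p b) (e i p) - dot (ne i p) (b *m omega p) =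
    dot (nu p) (S p (e i p) (b *m omega p)).
  by rewrite structureC dotNr -(shape_skew p b (E i p)).
rewrite Ea Ee /P !dotDl !dotDr structureDr (structureC _ (e j p)) dotNr !dotDr.
rewrite dotDr in Eb.
by lra.
Qed.

(** After [codazzi_term], the difference of the two sides pairs the components of the
    [P i], which are skew-symmetric, with the symmetric part of the second fundamental
    form [a]. *)
Lemma laplacian_tangent p j : U p ->
  dot (flat_laplacian (hs_conn M) E nu p) (e j p) =
  \sum_i (dot (deriv_mx (ne i) p (E j p)) (e i p) +
          dot (ne i p) (deriv_mx (e i) p (E j p))).
Proof.
move=> Up; apply/eqP; rewrite -subr_eq0; apply/eqP.
rewrite /flat_laplacian dot_suml -sumrB.
pose P i := deriv_mx (e j) p (E i p) + bracket (E j) (E i) p *m omega p.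
pose a i l := dot (ne i p) (e l p).
have PE i : P i = deriv_mx (e i) p (E j p) + S p (e i p) (e j p).
  rewrite /P structureC; apply/eqP; rewrite eq_sym subr_eq -addrA; apply/eqP.
  by rewrite -(structure_eq_omega oU Up (sE j) (sE i)) addrC subrK.
have Pskew i l : dot (P i) (e l p) = - dot (P l) (e i p).
  rewrite !PE !dotDl deriv_frame_skew // opprD; congr (_ + _).
  by rewrite dotC (structure_skew12 torsion_skew) dotC.
rewrite (eq_bigr (fun i => \sum_l - (dot (P i) (e l p) * (a i l + a l i)))).
  apply: sum_skew => i l; rewrite Pskew mulNr (addrC (a i l)) //.
move=> i _; rewrite dotBl opprD addrA codazzi_term // -/(P i).
rewrite (structure_skew13 torsion_skew) opprK.
rewrite (parseval (ne i p) _ Up) (parseval (P i) (S p _ _) Up).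
rewrite dot_deriv_nu_frame mul0r addr0 (dotC (S p _ _) (nu p)).
rewrite (structure_alt torsion_skew _ (e i p) (nu p)).2 mulr0 addr0.
rewrite mulr_sumr -big_split /=; apply: eq_bigr => l _.
rewrite (dotC (S p _ _)) (structure_skew13 torsion_skew) -shape_skew_frame.
by rewrite /a; ring.
Qed.

Variables (W : M -> 'M[R]_n) (WP : is_weingarten wz_conn W).

Lemma trace_weingarten_frame q : U q -> \tr (W q) = - \sum_i dot (ne i q) (e i q).
Proof.
move=> Uq; rewrite (trace_frame _ Uq) -sumrN; apply: eq_bigr => i _.
by rewrite /deriv_nu_frame (deriv_nu WP) dotNl opprK.
Qed.

Lemma deriv_trace p u : U p -> deriv_along (fun q => \tr (W q)) p u =
  - \sum_i (dot (deriv_mx (ne i) p u) (e i p) + dot (ne i p) (deriv_mx (e i) p u)).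
Proof.
move=> Up.
have df i : mdiff (fun q => dot (ne i q) (e i q) : R) p.
  by apply: mdiff_dot; [exact: mdiff_deriv_nu|exact: mdiff_frame].
have ds : mdiff (fun q => \sum_i dot (ne i q) (e i q) : R) p by exact: mdiff_sum.
rewrite -(deriv_along_ext (f := fun q => (-1 : R) * \sum_i dot (ne i q) (e i q)) _ oU Up).
- rewrite (deriv_alongM _ (mdiff_cst (-1 : R) p) ds) deriv_along_cst mul0r add0r mulN1r.
  rewrite deriv_along_sum //; congr (- _); apply: eq_bigr => i _.
  by rewrite deriv_dot //; [exact: mdiff_deriv_nu|exact: mdiff_frame].
- by move=> q Uq; rewrite mulN1r trace_weingarten_frame.
- by apply: mdiffM => //; exact: mdiff_cst.
Qed.

Lemma sqnormE p : sqnorm E W p = \sum_i dot (ne i p) (ne i p).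
Proof.
apply: eq_bigr => i _; rewrite hs_metricE /deriv_nu_frame (deriv_nu WP).
by rewrite dotNl dotNr opprK.
Qed.

Lemma laplacian_nu p gradH : is_gradient (hs_metric M) (fun q => \tr (W q)) gradH ->
  U p -> flat_laplacian (hs_conn M) E nu p =
  - (gradH p *m omega p + sqnorm E W p *: nu p).
Proof.
move=> gH Up; apply/eqP; rewrite -subr_eq0 opprK; apply/eqP.
apply: (frame_eq0 Up) => [|j]; rewrite dotDl dotDl dotZl.
  rewrite laplacian_normal // -sqnormE dot_nu mulr1 (dotC _ (nu p)) dot_nu_omega add0r addNr //.
rewrite laplacian_tangent // (dotC (nu p)) dot_frame_nu mulr0 addr0.
by rewrite -hs_metricE gH deriv_trace // addrN.
Qed.

Lemma sqnorm_frame (V : M -> 'M[R]_n) p : U p ->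
  sqnorm E V p = \sum_i \sum_l dot (E i p *m V p *m omega p) (e l p) ^+ 2.
Proof.
move=> Up; apply: eq_bigr => i _; rewrite hs_metricE (parseval _ _ Up).
rewrite (dotC _ (nu p)) dot_nu_omega mul0r addr0.
by apply: eq_bigr => l _; rewrite expr2.
Qed.

Variables (nabla : covder Mt) (lc : levi_civita (wz_metric Mt) nabla).
Variables (Wbar : M -> 'M[R]_n) (WbarP : is_weingarten nabla Wbar).

(** The trace in [ricciE], computed in the orthonormal basis formed by the [e i] and
    [nu]. *)
Lemma ricci_frame p : U p ->
  ricci nabla (iota p) (hs_normal p) (hs_normal p) =
  4^-1 * \sum_i \sum_l dot (nu p) (S p (e i p) (e l p)) ^+ 2.
Proof.
move=> Up; rewrite (ricciE torsion_par torsion_skew lc) -/(nu p); congr (_ * _).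
set B := \matrix_i _.
have BE x : x *m B = S p x (nu p).
  rewrite mulmx_sum_row {2}(row_sum_delta x) structure_suml; apply: eq_bigr => i _.
  by rewrite rowK structureZl.
pose em := \matrix_i e i p.
have id1 : em^T *m em + (nu p)^T *m nu p = 1%:M.
  apply/row_matrixP => i; rewrite !rowE mulmx1 mulmxDr (mulmxA _ em^T) (mulmxA _ (nu p)^T).
  rewrite [RHS](frame_expand _ Up); congr (_ + _).
    rewrite mulmx_sum_row; apply: eq_bigr => l _; rewrite rowK mulmx_trE rowK.
    by rewrite (row_id 0).
  by rewrite dot_mulmx [X in X *m nu p]mx11_scalar mul_scalar_mx.
rewrite mxtrace_mulC -[B^T]mulmx1 -id1 mulmxDr mulmxDl linearD /=.
rewrite -(mulmxA _ ((nu p)^T *m _)) -(mulmxA (nu p)^T) BE.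
rewrite (structure_alt torsion_skew _ _ 0).1 !mulmx0 linear0 addr0.
rewrite (mulmxA _ em^T) -(mulmxA _ em) mxtrace_mulC -trmx_mul; apply: eq_bigr => i _.
rewrite mulmx_trE row_mul rowK BE (parseval _ _ Up) (dotC _ (nu p)).
rewrite (structure_alt torsion_skew _ _ (nu p)).2 mul0r addr0.
apply: eq_bigr => l _; rewrite (dotC _ (e l p)) (structure_skew13 torsion_skew).
by rewrite expr2 mulrNN.
Qed.

(** In components [Wbar] is the symmetric part of [W], and the skew part [c / 2] has the
    square norm of [ricci_frame]. *)
Lemma sqnorm_bar p : U p ->
  sqnorm E W p = sqnorm E Wbar p + ricci nabla (iota p) (hs_normal p) (hs_normal p).
Proof.
move=> Up; rewrite ricci_frame // !sqnorm_frame //.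
pose a i l := dot (E i p *m W p *m omega p) (e l p).
pose c i l := dot (nu p) (S p (e i p) (e l p)).
have ac i l : a i l - a l i = c i l.
  have := shape_skew_frame p i l; rewrite /deriv_nu_frame !(deriv_nu WP) !dotNl.
  by rewrite -/(a i l) -/(a l i) -/(c i l) => H; lra.
apply/eqP; rewrite -subr_eq0 opprD addrA mulr_sumr -!sumrB; apply/eqP.
rewrite (eq_bigr (fun i => \sum_l 2^-1 * (a i l + a l i) * c i l)).
  apply: sum_skew => i l; rewrite -(ac l i) -(ac i l); ring.
move=> i _; rewrite mulr_sumr -!sumrB; apply: eq_bigr => l _.
rewrite (weingarten_bar WP lc WbarP) -/(a i l) -/(c i l) -(ac i l).
by field.
Qed.

End OrthonormalFrame.

End Hypersurface.

(** * The Gauss map *)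

Section GaussMap.
Variables (R : realType) (n : nat) (Mt : weitzenbock R n.+1) (M : hypersurface Mt).
Implicit Types p : M.

Lemma smooth_gauss_map_hat : smooth_map (gauss_map_hat M).
Proof. exact: smooth_map_euclid (@smooth_nu _ _ _ M). Qed.

Lemma smooth_gauss_map : smooth_map (gauss_map M).
Proof. by apply: smooth_map_sphere; exact: smooth_nu. Qed.

(** Both [omega] and [sphere_form] have the orthogonal complement of [nu] as row
    space. *)
Lemma phi_sphere_form p :
  phi p *m sphere_form (gauss_map M p) = omega p.
Proof.
rewrite sphere_formE /phi; apply: mulmxKpV.
have nu0 := nu_neq0 p.
apply: submx_orthogonal (sphere_incl_immersion _) nu0 _ (omega_nu p).
apply/row_matrixP => i; rewrite row_mul row0 rowE; apply/rowP => j; rewrite (ord1 j).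
by rewrite -dot_mulmx -[nu p]/(set_val (gauss_map M p)) sphere_tangent mxE.
Qed.

Lemma phi_unit p : phi p \in unitmx.
Proof.
rewrite -row_full_unit -col_leq_rank; have := omega_free p.
rewrite /row_free -(phi_sphere_form p) => /eqP {1}<-; exact: mxrankM_maxl.
Qed.

Lemma sphere_form_inj (q : sphere R n) (x : 'rV[R]_n) :
  x *m sphere_form q *m (sphere_form q)^T = 0 -> x = 0.
Proof.
move=> E; apply: (row_free_inj (sphere_incl_immersion q)); rewrite mul0mx -sphere_formE.
by apply: dot_eq0; rewrite dot_mulmx trmx_mul mulmxA E mul0mx mxE.
Qed.

End GaussMap.

Theorem theorem3p17 (R : realType) (n : nat)
    (Mt : weitzenbock R n.+1) (M : hypersurface Mt)
    (torsion_par : parallel_torsion Mt) (torsion_skew : skew_torsion Mt)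
    (lcMt : covder Mt) (lcMtP : levi_civita (wz_metric Mt) lcMt)
    (lcM : covder M) (lcMP : levi_civita (hs_metric M) lcM)
    (lcS : covder (sphere R n)) (lcSP : levi_civita (round_metric R n) lcS)
    (lcE : covder (euclid R n.+1))
    (lcEP : levi_civita (euclid_metric R n.+1) lcE)
    (W : M -> 'M[R]_n) (WP : is_weingarten wz_conn W)
    (Wbar : M -> 'M[R]_n) (WbarP : is_weingarten lcMt Wbar)
    (gradH : M -> 'rV[R]_n)
    (gradHP : is_gradient (hs_metric M) (fun p => \tr (W p)) gradH) :
  (forall p : M, \tr (W p) = \tr (Wbar p)) /\
  (forall (U : set M) (E : 'I_n -> M -> 'rV[R]_n), open U ->
    orthonormal_frame (hs_metric M) U E ->
    forall p : M, U p ->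
    [/\ - (laplacian (hs_conn M) lcS E (gauss_map M) p
             *m invmx (phi p)) = gradH p,
        - (laplacian (hs_conn M) lcE E (gauss_map_hat M) p
             *m frame_mx (hs_incl p)) =
          gradH p *m tangent_map hs_incl p + sqnorm E W p *: hs_normal p,
        laplacian (hs_conn M) lcS E (gauss_map M) p =
          laplacian lcM lcS E (gauss_map M) p,
        laplacian (hs_conn M) lcE E (gauss_map_hat M) p =
          laplacian lcM lcE E (gauss_map_hat M) p &
        sqnorm E W p =
          sqnorm E Wbar p + ricci lcMt (hs_incl p) (hs_normal p) (hs_normal p)]).
Proof.
split=> [p|U E oU onE p Up]; first exact: (trace_weingarten torsion_skew WP lcMtP WbarP).
have sE i : smooth_field U (E i) by exact: onE.1.
have lapE := laplacian_nu torsion_par torsion_skew oU onE WP gradHP Up.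
have eqlap m (Q : manifold R m) nablaQ F :
    laplacian (hs_conn M) nablaQ E F p = laplacian lcM nablaQ E (F : M -> Q) p.
  rewrite /laplacian !sumrB; congr (_ - _).
  have := congr1 (fun v => v *m tangent_map F p)
    (sum_conn_frame torsion_skew oU onE lcMP Up).
  by rewrite 2!mulmx_suml.
have sqE := sqnorm_bar torsion_par torsion_skew onE WP lcMtP WbarP Up.
split; [| |exact: eqlap|exact: eqlap|exact: sqE].
- suff -> : laplacian (hs_conn M) lcS E (gauss_map M) p = - (gradH p *m phi p).
    by rewrite mulNmx opprK mulmxK // phi_unit.
  apply/eqP; rewrite -subr_eq0 opprK; apply/eqP; apply: (@sphere_form_inj _ _ (gauss_map M p)).
  rewrite !mulmxDl (laplacian_sphere _ oU sE lcSP (smooth_gauss_map M) Up).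
  have -> : flat_laplacian (hs_conn M) E (@sphere_incl R n \o gauss_map M) p = _ := lapE.
  rewrite -(mulmxA (gradH p)) phi_sphere_form mulNmx mulmxDl opprD addrAC addNr add0r.
  rewrite -scalemxAl; apply/eqP; rewrite oppr_eq0 scaler_eq0; apply/orP; right.
  apply/eqP/rowP => j; rewrite -[nu p](row_id 0) -row_mul.
  rewrite mxE [RHS]mxE mulmx_trE row_id rowE sphere_formE dotC.
  exact: sphere_tangent.
- apply: (@coframe_inj _ _ _ (hs_incl p)).
  rewrite mulNmx -mulmxA frameK mulmx1 (laplacian_euclid _ oU sE lcEP (smooth_gauss_map_hat M) Up).
  have -> : flat_laplacian (hs_conn M) E (gauss_map_hat M) p = _ := lapE.
  by rewrite opprK mulmxDl -scalemxAl -mulmxA.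
Qed.
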